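(* Let $X$ be a spectrally positive Lévy process with $\mathbb{E}X(1)<0$. Then for all $\alpha,\beta,\vartheta>0$, $$\int_0^\infty e^{-\vartheta t}\,\mathbb{E}_\pi\big[e^{-\alpha Q(0)-\beta Q(t)},\,T>t\big]\,dt=\frac{\hat\psi'(0+)}{\vartheta-\hat\psi(\beta)}\left(\frac{\alpha+\beta}{\hat\psi(\alpha+\beta)}-\frac{\alpha+\hat\Phi(\vartheta)}{\hat\psi(\alpha+\hat\Phi(\vartheta))}\right),$$ where for $\vartheta=\hat\psi(\beta)$ the right-hand side is understood by continuity.
   Context: Spectrally positive means that $X$ has no negative jumps. $\mathbb{P}_x$ is the law of $X$ started from $X(0)=x$; $\mathbb{P}=\mathbb{P}_0$. The notation $\mathbb{E}[Y,A]$ means $\mathbb{E}[Y\mathbf 1_A]$. Under $\mathbb{P}_x$ ($x\ge0$) the workload process is $Q(t)=X(t)-\min\{0,\inf_{s\le t}X(s)\}$ (the process $X$ reflected at $0$, started at $Q(0)=x$), and $T=\inf\{t\ge0:Q(t)=0\}$. The stationary distribution of $Q$ is $\pi$, the law of $\sup_{t\ge0}X(t)$ under $\mathbb{P}$; $\mathbb{E}_\pi$ means that $Q(0)$ is distributed according to $\pi$, i.e. $\mathbb{E}_\pi[\cdot]=\int_{[0,\infty)}\mathbb{E}_x[\cdot]\,\pi(dx)$. $\hat\psi$ is the Laplace exponent of the dual (spectrally negative) process $\hat X=-X$: $\mathbb{E}e^{-\eta X(t)}=e^{t\hat\psi(\eta)}$, and $\hat\Phi(s)=\sup\{\eta\ge0:\hat\psi(\eta)=s\}$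 for $s\ge0$. *)

(* Defs.v *)
From HB Require Import structures.
From mathcomp Require Import all_boot all_order all_algebra.
From mathcomp Require Import all_classical all_reals all_analysis.

Set Implicit Arguments.
Unset Strict Implicit.
Unset Printing Implicit Defensive.

Import Order.TTheory GRing.Theory Num.Theory.
Import numFieldNormedType.Exports.

Local Open Scope classical_set_scope.
Local Open Scope ring_scope.

(* Time is indexed by the whole of R, but only the random variables X t with
   0 <= t are ever constrained or used. *)

Section levy.
Context {R : realType} {d : measure_display} {Omega : measurableType d}
  {P : probability Omega R}.
Implicit Types X : R -> {RV P >-> R}.

Definition increment X (s t : R) : Omega -> R := fun w => X t w - X s w.

(* The events of a subfamily of the increments are obtained by taking
   A i = setT for the others. *)
Definition independent_increments X : Prop :=
  forall (n : nat) (t : nat -> R) (A : nat -> set R),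
    0 <= t 0%N -> {homo t : i j / (i <= j)%N >-> i <= j} ->
    (forall i, measurable (A i)) ->
    P (\bigcap_(i in [set i : nat | (i < n)%N])
         (increment X (t i) (t i.+1) @^-1` A i)) =
    (\prod_(i < n) P (increment X (t i) (t i.+1) @^-1` A i))%E.

Definition stationary_increments X : Prop :=
  forall (s h : R) (A : set R), 0 <= s -> 0 <= h -> measurable A ->
    P (increment X s (s + h) @^-1` A) = P (X h @^-1` A).

Definition cadlag (x : R -> R) : Prop :=
  (forall t, 0 <= t -> x s @[s --> t^'+] --> x t) /\
  (forall t, 0 < t -> cvg (x s @[s --> t^'-])).

Definition no_negative_jumps (x : R -> R) : Prop :=
  forall t, 0 < t -> lim (x s @[s --> t^'-]) <= x t.

(* All paths are cadlag, as on the canonical path space, so that infima and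
   suprema of X over time intervals are measurable without completing P. *)
Definition levy_process X : Prop :=
  [/\ {ae P, forall w, X 0 w = 0},
      independent_increments X,
      stationary_increments X &
      forall w, cadlag (fun t => X t w)].

Definition spectrally_positive X : Prop :=
  {ae P, forall w, no_negative_jumps (fun t => X t w)}.

(* The law of X started from x is that of x + X, so Q under P_x is realised on
   Omega as workload X x. *)
Definition workload X (x t : R) (w : Omega) : R :=
  (x + X t w) - Num.min 0 (inf [set x + X s w | s in `[0, t]]).

(* Equal to +oo if the workload never vanishes. *)
Definition busy_period X (x : R) (w : Omega) : \bar R :=
  ereal_inf [set t%:E | t in [set t : R | 0 <= t /\ workload X x t w = 0]].

(* The real supremum is 0 on the paths that are unbounded above; when the drift
   of X is negative these form a null event. *)
Definition all_time_sup X (w : Omega) : R := sup [set X t w | t in `[0, +oo[].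

Definition stationary_law X : set R -> \bar R := pushforward P (all_time_sup X).

(* E_x[exp(-alpha Q(0) - beta Q(t)), T > t] *)
Definition busy_transform_at X (alpha beta t x : R) : \bar R :=
  'E_P[fun w => expR (- alpha * workload X x 0 w - beta * workload X x t w)
                * \1_[set w | (t%:E < busy_period X x w)%E] w].

(* E_pi[exp(-alpha Q(0) - beta Q(t)), T > t] *)
Definition busy_transform X (alpha beta t : R) : \bar R :=
  \int[stationary_law X]_(x in `[0, +oo[) busy_transform_at X alpha beta t x.

(* The Laplace exponent of -X, read off at time 1:
   E exp(-eta X(1)) = exp(dual_exponent X eta). *)
Definition dual_exponent X (eta : R) : R :=
  ln (fine 'E_P[fun w => expR (- eta * X 1 w)]).

Definition dual_inverse X (s : R) : R :=
  sup [set eta : R | 0 <= eta /\ dual_exponent X eta = s].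

End levy.

(* psi'(0+) is right_derivative psi 0. *)
Definition right_derivative {R : realType} (f : R -> R) (a : R) : R :=
  lim (h^-1 * (f (a + h) - f a) @[h --> 0^'+]).

(* Meaningful for theta <> dual_exponent X beta. *)
Definition busy_formula {R : realType} {d : measure_display}
    {Omega : measurableType d} {P : probability Omega R}
    (X : R -> {RV P >-> R}) (alpha beta theta : R) : R :=
  let psi := dual_exponent X in
  let Phi := dual_inverse X in
  right_derivative psi 0 / (theta - psi beta) *
  ((alpha + beta) / psi (alpha + beta)
   - (alpha + Phi theta) / psi (alpha + Phi theta)).

(* Main.v *)
(* Write psi for the dual exponent and Phi for its inverse. On the grid of mesh
   2^-n the process X is a random walk. As X has no negative jumps, the part of a
   step below -e contributes only o(2^-n) to the exponential moments, so that in
   the limit the walk passes downwards over a level without overshoot. For the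
   recursion satisfied by the running maximum this shows that
   psi(s) E[e^(-s sup X)] / s does not depend on s, which is the
   Pollaczek-Khinchine formula E[e^(-s sup X)] = psi'(0+) s / psi(s). For the
   walk started at x > 0 and killed on leaving the positive half-line,
   telescoping the discounted exponentials of exponents beta and Phi(theta) gives
     (theta - psi(beta)) int_0^oo e^(-theta t) E_x[e^(-beta Q(t)), T > t] dt
       = e^(-beta x) - e^(-Phi(theta) x),
   and integrating this against e^(-alpha x) pi(dx) gives the theorem.

   The left-hand side is handled without knowing that it involves measurable
   functions only: the event T > t lies between the events that the path observed
   at dyadic times stays above 0, resp. above dl > 0. The gap between the two
   corresponding transforms decreases in theta, so it vanishes as dl -> 0 for
   theta = psi(beta) too, where the formula itself says nothing. *)
Require Import Defs.
From mathcomp Require Import all_boot all_order all_algebra.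
From mathcomp Require Import all_classical all_reals all_analysis.
From mathcomp Require Import measurable_realfun ring lra.
Set Implicit Arguments.
Unset Strict Implicit.
Unset Printing Implicit Defensive.
Import Order.TTheory GRing.Theory Num.Theory.
Import numFieldNormedType.Exports.
Local Open Scope classical_set_scope.
Local Open Scope ring_scope.

(** * Random walks with independent steps *)

Section expectation.
Context {R : realType} {d : measure_display} {T : measurableType d}
  (P : probability T R).
Implicit Types f g : T -> R.

(** That E exp(-b X(1)) is finite for b >= 0 is not among the hypotheses and has to come from the
    paths. On a short time interval the probability q of dipping below -1 is small, and as long as
    no step of a fine grid is below -1, every passage overshoots by at most one unit. So the depth
    2k is reached with probability at most q^k up to a vanishing error, and q beats any given
    exponential rate. The exponential moments of large downward steps are then bounded in two
    stages: second differences of the Laplace transform give O(2^-n), and the fact that such steps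
    have probability o(2^-n) improves this to o(2^-n). Independence of s comes from an inequality
    between two arbitrary exponents, read in both directions. Once psi(s) supF(s) = kappa s is
    known, it takes over the role of convexity: monotonicity and a Lipschitz bound for supF make psi
    strictly increasing and continuous, and a lower bound on kappa shows that the supremum is finite
    almost surely. In both limit arguments the number of steps goes to infinity first, then the mesh
    to 0, and last the tolerance e. *)

Lemma bounded_integrable f (M : R) : measurable_fun setT f ->
  (forall w, `|f w| <= M) -> P.-integrable setT (EFin \o f).
Proof.
move=> mf fM; apply: (@le_integrable _ _ _ P setT measurableT _ (cst M%:E)).
- exact/measurable_EFinP.
- by move=> w _ /=; rewrite lee_fin (le_trans (fM w))// ler_norm.
- exact: finite_measure_integrable_cst.
Qed.

Lemma Rintegral_cst_prob (c : R) : \int[P]_w c = c.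
Proof. by rewrite (Rintegral_cst P measurableT) [X in fine X](probability_setT P) mulr1. Qed.

Lemma integrable_le f g : measurable_fun setT f ->
  (forall w, 0 <= f w) -> (forall w, f w <= g w) ->
  P.-integrable setT (EFin \o g) -> P.-integrable setT (EFin \o f).
Proof.
move=> mf f0 fg; apply: le_integrable => //; first exact/measurable_EFinP.
by move=> w _ /=; rewrite lee_fin ger0_norm// (le_trans (fg w))// ler_norm.
Qed.

Lemma integrable_EFinD f g : P.-integrable setT (EFin \o f) ->
  P.-integrable setT (EFin \o g) -> P.-integrable setT (fun w => (f w + g w)%:E).
Proof.
move=> fi gi; have := integrableD measurableT fi gi.
by apply: eq_integrable => // w _ /=; rewrite EFinD.
Qed.

Lemma integrable_EFinZl (c : R) f : P.-integrable setT (EFin \o f) ->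
  P.-integrable setT (fun w => (c * f w)%:E).
Proof.
move=> fi; have := integrableZl measurableT c fi.
by apply: eq_integrable => // w _ /=; rewrite EFinM.
Qed.

Lemma integrable_indicR (A : set T) : measurable A ->
  P.-integrable setT (EFin \o (\1_A : T -> R)).
Proof.
move=> mA; apply: (@bounded_integrable _ 1) => [|w]; first exact: measurable_indic.
by rewrite indicE; case: (_ \in _); rewrite ?normr0 ?normr1.
Qed.

Lemma integral_prob_cst (c : \bar R) : (\int[P]_w c = c)%E.
Proof.
rewrite (integral_cst P measurableT) -[RHS]mule1; congr (_ * _)%E.
exact: probability_setT.
Qed.

Lemma Rintegral_EFin f : P.-integrable setT (EFin \o f) ->
  (\int[P]_w (f w)%:E)%E = (\int[P]_w f w)%:E.
Proof. by move=> fi; rewrite /Rintegral fineK//; exact: integrable_fin_num. Qed.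

Lemma Rintegral_indic (A : set T) : measurable A ->
  \int[P]_w (\1_A w : R) = fine (P A).
Proof. by move=> mA; rewrite /Rintegral integral_indic// setIT. Qed.

Lemma Rintegral_dct (f_ : nat -> T -> R) f (g : T -> R) :
  (forall n, measurable_fun setT (f_ n)) -> measurable_fun setT f ->
  P.-integrable setT (EFin \o g) ->
  (forall w, f_ ^~ w @ \oo --> f w) ->
  (forall n w, `|f_ n w| <= g w) ->
  (\int[P]_w f_ n w) @[n --> \oo] --> \int[P]_w f w.
Proof.
move=> mf_ mf ig cf fg.
have [//|//|||//|] := @dominated_convergence _ _ _ P setT measurableT
  (fun n => EFin \o f_ n) (EFin \o f) (EFin \o g).
- by move=> n; apply/measurable_EFinP.
- by apply/measurable_EFinP.
- by apply: aeW => w _; apply/fine_cvgP; split; [exact: nearW|exact: cf].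
- exact: ig.
- by apply: aeW => w n _; rewrite /= lee_fin.
move=> intf _ cvf.
apply: fine_cvg.
by rewrite fineK ?integrable_fin_num.
Qed.

Lemma Rintegral_bct (f_ : nat -> T -> R) f (M : R) :
  (forall n, measurable_fun setT (f_ n)) -> measurable_fun setT f ->
  (forall w, f_ ^~ w @ \oo --> f w) ->
  (forall n w, `|f_ n w| <= M) ->
  (\int[P]_w f_ n w) @[n --> \oo] --> \int[P]_w f w.
Proof.
move=> mf_ mf cf fM; apply: (@Rintegral_dct _ _ (cst M)) => //.
exact: finite_measure_integrable_cst.
Qed.

End expectation.

(** * Independence of one step from all the others *)

Section iid.
Context {R : realType} {d : measure_display} {Omega : measurableType d}
  (P : probability Omega R) (xi : nat -> Omega -> R) (mu : probability R R).
Hypothesis mxi : forall i, measurable_fun setT (xi i).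
Hypothesis ind : forall n (A : nat -> set R), (forall i, measurable (A i)) ->
  P (\bigcap_(i in [set i : nat | (i < n)%N]) (xi i @^-1` A i)) =
  (\prod_(i < n) mu (A i))%E.

Lemma iid_law i (B : set R) : measurable B -> P (xi i @^-1` B) = mu B.
Proof.
move=> mB.
pose A j := if j == i then B else setT.
have mA j : measurable (A j) by rewrite /A; case: ifP.
have := ind i.+1 mA.
rewrite (_ : \bigcap_(_ in _) _ = xi i @^-1` B); last first.
  apply/seteqP; split => w.
    by move=> /(_ i) /=; rewrite /A eqxx; apply; exact: leqnn.
  by move=> Bw j _; rewrite /A; case: eqP => [->|].
move=> ->; rewrite (bigD1 ord_max)//= big1 ?mule1 /A ?eqxx// => j.
rewrite -val_eqE /= => /negbTE ->; exact: probability_setT.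
Qed.

(* A pi-system generating the events that depend on the steps other than step k. *)
Definition others (k : nat) : set (set Omega) := [set C | exists n (A : nat -> set R),
  [/\ forall i, measurable (A i), A k = setT &
      C = \bigcap_(i in [set i : nat | (i < n)%N]) (xi i @^-1` A i)]].

Lemma measurable_xi i (B : set R) : measurable B -> measurable (xi i @^-1` B).
Proof. by move=> mB; rewrite -[X in measurable X]setTI; exact: mxi. Qed.

Lemma others_measurable k : others k `<=` measurable.
Proof.
move=> _ [n [A [mA _ ->]]]; apply: fin_bigcap_measurable => // i _.
exact: measurable_xi.
Qed.

Lemma others_setI k : setI_closed (others k).
Proof.
move=> _ _ [n [A [mA Ak ->]]] [m [B [mB Bk ->]]].
exists (maxn n m), (fun i => (if (i < n)%N then A i else setT) `&`
  (if (i < m)%N then B i else setT)); split.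
- by move=> i; apply: measurableI; case: ifP.
- by rewrite Ak Bk; case: ifP; case: ifP; rewrite setTI.
- apply/seteqP; split => w.
    by move=> [Aw Bw] i /= _; split; case: ifP => // h; [apply: Aw|apply: Bw].
  move=> H; split => i /= h.
    have /= := H i; rewrite /= leq_max h => /(_ isT) [+ _]; by [].
  have /= := H i; rewrite /= leq_max h orbT => /(_ isT) [_]; by [].
Qed.

Lemma others_setT k : others k setT.
Proof.
exists 0%N, (fun=> setT); split => //.
by apply/seteqP; split => // w _ i.
Qed.

Lemma others_sub k : <<s others k >> `<=` measurable.
Proof.
by apply: smallest_sub; [exact: sigma_algebra_measurable|exact: others_measurable].
Qed.

(** Both sides are finite measures in E that agree on the pi-system [others k], hence on the
    sigma-algebra it generates. *)
Lemma others_indep k (E : set Omega) (B : set R) : <<s others k >> E ->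
  measurable B -> P (E `&` xi k @^-1` B) = (P E * mu B)%E.
Proof.
move=> sE mB.
have muBfin : mu B \is a fin_num by exact: fin_num_measure.
have c0 : 0 <= fine (mu B) by rewrite fine_ge0.
have mE := others_sub sE.
have := @g_sigma_algebra_measure_unique _ _ _ (others k)
  (@others_measurable k) (fun=> setT) (fun=> @others_setT k) _
  (mrestr P (measurable_xi k mB)) (mscale (NngNum c0) P)
  (@others_setI k) _ _ E sE.
move=> H; transitivity (mscale (NngNum c0) P E); last first.
  by rewrite /mscale /= fineK// muleC.
apply: H.
- by rewrite bigcup_const//; exists 0%N.
- move=> _ [n [A [mA Ak ->]]].
  set C := \bigcap_(_ in _) _.
  suff : P (C `&` xi k @^-1` B) = (mu B * P C)%E.
    by move=> h; transitivity (mu B * P C)%E; [exact: h|rewrite -[in LHS](fineK muBfin)].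
  rewrite {}/C.
  (* C puts no condition on step k, since [A k = setT], so B can be written in its place; N is large
     enough to include step k even when n <= k. *)
  pose A' m i := if i == k then B else if (i < m)%N then A i else setT.
  have mA' i : measurable (A' n i) by rewrite /A'; do 2 case: ifP => // _.
  pose N := maxn n k.+1.
  have kN : (k < N)%N by rewrite leq_max leqnn orbT.
  rewrite (_ : _ `&` _ =
      \bigcap_(i in [set i : nat | (i < N)%N]) xi i @^-1` A' n i); last first.
    apply/seteqP; split => w /=.
      move=> [H Bw] i _; rewrite /A'; case: eqP => [->//|_].
      by case: ifP => // ii; exact: H.
    move=> H; split; last by have := H k kN; rewrite /A' eqxx.
    move=> i /= ii; have [->|ik] := eqVneq i k; first by rewrite /preimage Ak.
    have := H i; rewrite /A' /= (negbTE ik) ii; apply.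
    by rewrite leq_max ii.
  rewrite ind//.
  pose A'' i := if (i < n)%N then A i else setT.
  have mA'' i : measurable (A'' i) by rewrite /A''; case: ifP.
  rewrite (_ : \bigcap_(_ in _) _ =
      \bigcap_(i in [set i : nat | (i < N)%N]) xi i @^-1` A'' i); last first.
    apply/seteqP; split => w /= H i /= ii; rewrite /A''.
      by case: ifP => // /H.
    by have := H i; rewrite /A'' /= ii; apply; rewrite /N leq_max ii.
  rewrite ind// (bigD1 (Ordinal kN))//= [in RHS](bigD1 (Ordinal kN))//=.
  rewrite /A' /A'' eqxx Ak if_same [mu setT]probability_setT mul1e.
  congr (_ * _)%E; apply: eq_bigr => i /negbTE ik.
  by rewrite -val_eqE /= in ik; rewrite ik.
- move=> _; rewrite /= /mrestr setTI (le_lt_trans (probability_le1 _ _)) ?ltry//.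
  exact: measurable_xi.
Qed.

(** The points of Omega with a coarser sigma-algebra that does not see step k. Independence of
    [xi k] thereby becomes measurability on this type, which composes like any other
    measurability. *)
Definition OT k := g_sigma_algebraType (others k).

Lemma others_id_measurable k : measurable_fun setT (id : Omega -> OT k).
Proof. by move=> _ A mA; rewrite setTI; exact: (@others_sub k A mA). Qed.

Lemma others_measurable_fun k d' (T' : measurableType d') (f : OT k -> T') :
  measurable_fun setT f -> measurable_fun setT (f : Omega -> T').
Proof. by move=> mf; exact: (measurableT_comp mf (@others_id_measurable k)). Qed.

Lemma others_xi k i : i != k -> measurable_fun setT (xi i : OT k -> R).
Proof.
move=> ik _ B mB; rewrite setTI; apply: sub_sigma_algebra.
exists i.+1, (fun j => if j == i then B else setT); split.
- by move=> j; case: ifP.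
- by rewrite eq_sym (negbTE ik).
- apply/seteqP; split => w /=.
    by move=> Bw j _; case: eqP => [->|].
  by move=> /(_ i) /=; rewrite eqxx; apply; exact: leqnn.
Qed.

(** By [others_indep] the pair (w, xi k w) has the product law on [OT k * R]; the rest is
    Tonelli. *)
Lemma others_integral k (F : OT k * R -> \bar R) : measurable_fun setT F ->
  (forall z, 0 <= F z)%E ->
  (\int[P]_w F (w, xi k w) = \int[P]_w \int[mu]_y F (w, y))%E.
Proof.
move=> mF F0.
pose idm := [the {mfun Omega >-> OT k} of mfun_Sub (mem_set (@others_id_measurable k))].
pose Q := distribution P idm.
have mpair : measurable_fun setT (fun w => (w, xi k w) : OT k * R).
  by apply/measurable_fun_pairP; split => /=; [exact: others_id_measurable|exact: mxi].
pose prm := [the {mfun Omega >-> (OT k * R)%type} of mfun_Sub (mem_set mpair)].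
transitivity (\int[Q \x mu]_z F z)%E; last first.
  rewrite fubini_tonelli1//= ge0_integral_distribution//.
  - exact: measurable_fun_fubini_tonelli_F.
  - by move=> y; exact: integral_ge0.
transitivity (\int[distribution P prm]_z F z)%E.
  by rewrite ge0_integral_distribution.
apply: eq_measure_integral => A mA _.
apply/esym/product_measure_unique => // E B mE mB.
exact: others_indep.
Qed.

Lemma xi_integral k (f : R -> \bar R) : measurable_fun setT f ->
  (forall y, 0 <= f y)%E -> (\int[P]_w f (xi k w) = \int[mu]_y f y)%E.
Proof.
move=> mf f0.
pose xm := [the {mfun Omega >-> R} of mfun_Sub (mem_set (mxi k))].
have <- : (\int[distribution P xm]_y f y = \int[P]_w f (xi k w))%E.
  by rewrite ge0_integral_distribution.
by apply: eq_measure_integral => B mB _; exact: iid_law.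
Qed.

End iid.

(** * Recursions along the walk and invariance under a shift of the steps *)

Section recursion.
Context {R : realType} {d : measure_display} {Omega : measurableType d}
  (P : probability Omega R) (xi : nat -> Omega -> R) (mu : probability R R).
Hypothesis mxi : forall i, measurable_fun setT (xi i).
Hypothesis ind : forall n (A : nat -> set R), (forall i, measurable (A i)) ->
  P (\bigcap_(i in [set i : nat | (i < n)%N]) (xi i @^-1` A i)) =
  (\prod_(i < n) mu (A i))%E.

Lemma others_mul k (f : OT xi k -> \bar R) (g : R -> \bar R) :
  measurable_fun setT f -> measurable_fun setT g ->
  (forall w, 0 <= f w)%E -> (forall y, 0 <= g y)%E ->
  (\int[P]_w (f w * g (xi k w)) = (\int[P]_w f w) * \int[mu]_y g y)%E.
Proof.
move=> mf mg f0 g0.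
have := @others_integral _ _ _ _ _ _ mxi ind k (fun z => f z.1 * g z.2)%E.
rewrite /= => -> //; first last.
- by move=> z; exact: mule_ge0.
- by apply: emeasurable_funM; [exact: measurableT_comp mf _|exact: measurableT_comp mg _].
rewrite -ge0_integralZr//; [|exact: others_measurable_fun mf|exact: integral_ge0].
by apply: eq_integral => w _; rewrite ge0_integralZl.
Qed.

Variables (G : R * R -> R) (z0 : R).
Hypothesis mG : measurable_fun setT G.

(* The step [xi k] is applied last, so that it is independent of the inner recursion
   and the law of [backward N k] does not depend on k. *)
Fixpoint backward N k (w : Omega) : R :=
  if N is N'.+1 then G (xi k w, backward N' k.+1 w) else z0.

Lemma backward_others N k j : (j < k)%N ->
  measurable_fun setT (backward N k : OT xi j -> R).
Proof.
elim: N k => [|N IH] k jk /=; first exact: measurable_cst.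
apply: (measurableT_comp mG); apply/measurable_fun_pairP; split.
  by apply: others_xi => //; rewrite gtn_eqF.
exact: (IH k.+1 (ltnW jk)).
Qed.

Lemma backward_measurable N k : measurable_fun setT (backward N k).
Proof.
elim: N k => [|N IH] k /=; first exact: measurable_cst.
apply: (measurableT_comp mG).
exact: (measurable_fun_pair (mxi k) (IH k.+1)).
Qed.

Lemma backward_step N k (f : R * R -> \bar R) : measurable_fun setT f ->
  (forall z, 0 <= f z)%E ->
  (\int[P]_w f (xi k w, backward N k.+1 w) =
   \int[mu]_y \int[P]_w f (y, backward N k.+1 w))%E.
Proof.
move=> mf f0.
have := @others_integral _ _ _ _ _ _ mxi ind k
  (fun z => f (z.2, backward N k.+1 z.1)).
rewrite /= => ->; first last.
- by move=> z.
- apply: (measurableT_comp mf); apply: measurable_fun_pair; first exact: measurable_snd.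
  exact: (measurableT_comp (@backward_others N k.+1 k (leqnn _)) measurable_fst).
apply: (@fubini_tonelli _ _ _ _ _ P mu (fun z => f (z.2, backward N k.+1 z.1))) => //=.
apply: (measurableT_comp mf); apply: measurable_fun_pair; first exact: measurable_snd.
exact: (measurableT_comp (@backward_measurable N k.+1) measurable_fst).
Qed.

(** Peeling off the outermost step replaces it by an integral over mu, which is the same for every
    k; the inner recursion is handled by induction. *)
Lemma backward_law N k l (f : R -> \bar R) : measurable_fun setT f ->
  (forall z, 0 <= f z)%E ->
  (\int[P]_w f (backward N k w) = \int[P]_w f (backward N l w))%E.
Proof.
elim: N k l f => [//|N IH] k l f mf f0 /=.
have mfG : measurable_fun setT (fun z => f (G z)) by exact: measurableT_comp.
transitivity (\int[mu]_y \int[P]_w f (G (y, backward N k.+1 w)))%E.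
  by apply: (backward_step N k mfG) => z.
transitivity (\int[mu]_y \int[P]_w f (G (y, backward N l.+1 w)))%E; last first.
  by apply/esym/(backward_step N l mfG) => z.
apply: eq_integral => y _; apply: (IH _ _ (fun z => f (G (y, z)))) => //.
exact: (measurableT_comp mfG (measurable_pair1 y)).
Qed.

Lemma backward_rec N (f : R * R -> \bar R) : measurable_fun setT f ->
  (forall z, 0 <= f z)%E ->
  (\int[P]_w f (xi 0 w, backward N 1 w) =
   \int[mu]_y \int[P]_w f (y, backward N 0 w))%E.
Proof.
move=> mf f0.
transitivity (\int[mu]_y \int[P]_w f (y, backward N 1 w))%E.
  exact: (backward_step N 0 mf).
apply: eq_integral => y _.
apply: (backward_law _ _ _ (f := fun z => f (y, z))) => //.
exact: (measurableT_comp mf (measurable_pair1 y)).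
Qed.

End recursion.

(** * Tail of a walk whose steps rarely fall below -1 *)

Section random_walk.
Context {R : realType} {d : measure_display} {Omega : measurableType d}
  (P : probability Omega R) (xi : nat -> Omega -> R) (mu : probability R R).
Hypothesis mxi : forall i, measurable_fun setT (xi i).
Hypothesis ind : forall n (A : nat -> set R), (forall i, measurable (A i)) ->
  P (\bigcap_(i in [set i : nat | (i < n)%N]) (xi i @^-1` A i)) =
  (\prod_(i < n) mu (A i))%E.

Definition walk k (w : Omega) : R := \sum_(i < k) xi i w.

Lemma walk0 w : walk 0 w = 0. Proof. by rewrite /walk big_ord0. Qed.
Lemma walkS k w : walk k.+1 w = walk k w + xi k w.
Proof. by rewrite /walk big_ord_recr. Qed.

Lemma walk_others k j : (j <= k)%N -> measurable_fun setT (walk j : OT xi k -> R).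
Proof.
move=> jk; apply: measurable_sum => i.
by apply: others_xi => //; rewrite ltn_eqF// (leq_trans _ jk).
Qed.

Lemma measurable_walk j : measurable_fun setT (walk j).
Proof. by apply: measurable_sum => i. Qed.

(** Stated in the extended reals because the finiteness of the moments will be deduced from this
    identity. *)
Lemma expR_walk (b : R) n :
  (\int[P]_w (expR (- b * walk n w))%:E = (\int[mu]_y (expR (- b * y))%:E) ^+ n)%E.
Proof.
elim: n => [|n IH].
  under eq_integral do rewrite walk0 mulr0 expR0.
  by rewrite integral_prob_cst expe0.
under eq_integral do rewrite walkS mulrDr expRD EFinM.
rewrite (others_mul (k := n) mxi ind (f := fun w => (expR (- b * walk n w))%:E)
  (g := fun y => (expR (- b * y))%:E)) ?IH ?expeS 1?muleC//.
- by apply/measurable_EFinP; apply: measurableT_comp => //;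
    apply: measurable_funM => //; exact: walk_others.
- by apply/measurable_EFinP; apply: measurableT_comp => //; exact: measurable_funM.
Qed.

(** Iterated by [backward], this gives the running minimum, time 0 included, of the walk whose steps
    are raised to at least -1. *)
Definition trunc_step (z : R * R) : R := Num.min 0 (Num.max z.1 (- 1) + z.2).

Lemma measurable_trunc_step : measurable_fun setT trunc_step.
Proof.
apply: measurable_minr => //; apply: measurable_funD => //.
exact: measurable_maxr.
Qed.

Let W N (a : R) : \bar R :=
  (\int[P]_w (\1_[set z : R | z < - a] (backward xi trunc_step 0 N 0 w))%:E)%E.

Let trunc_le0 N k w : backward xi trunc_step 0 N k w <= 0.
Proof. by case: N => [|N] //=; rewrite ge_min lexx. Qed.

Let mind (a : R) : measurable_fun setT (fun z => (\1_[set z : R | z < - a] z : R)%:E).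
Proof.
apply/measurable_EFinP; apply: measurable_indic.
by rewrite (_ : [set z | z < - a] = `]-oo, (- a)[%classic)//; apply/seteqP; split => z /=; rewrite in_itv.
Qed.

Let mback N k := @backward_measurable _ _ _ xi mxi trunc_step 0 measurable_trunc_step N k.

Let W_ge0 N a : (0 <= W N a)%E.
Proof. by apply: integral_ge0 => w _; rewrite lee_fin. Qed.

Let W_le1 N a : (W N a <= 1)%E.
Proof.
rewrite -[leRHS](integral_prob_cst P).
apply: ge0_le_integral => //.
- by apply: (measurableT_comp (mind a)).
- by move=> w _; rewrite lee_fin indicE; case: (_ \in _).
Qed.

Let W_neg N a : a < 0 -> W N a = 1%E.
Proof.
move=> a0; rewrite /W (eq_integral (cst 1%E)); last first.
  move=> w _; rewrite indicE mem_set//=.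
  by rewrite (le_lt_trans (trunc_le0 _ _ _))// oppr_gt0.
by rewrite integral_prob_cst.
Qed.

Let W_rec N a : 0 <= a -> W N.+1 a = (\int[mu]_y W N (a + Num.max y (- 1))%R)%E.
Proof.
move=> a0.
have := @backward_rec _ _ _ P xi mu mxi ind trunc_step 0 measurable_trunc_step N
  (fun z => (\1_[set z : R | z < - a] (trunc_step z))%:E).
move=> H; transitivity (\int[mu]_y \int[P]_w
    (\1_[set z : R | z < - a] (trunc_step (y, backward xi trunc_step 0 N 0 w)))%:E)%E.
  apply: H; last by move=> z; rewrite lee_fin.
  exact: (measurableT_comp (mind a) measurable_trunc_step).
apply: eq_integral => y _; apply: eq_integral => w _.
congr (_%:E); rewrite !indicE; congr ((nat_of_bool _)%:R).
apply/idP/idP; rewrite !inE /= /trunc_step/= gt_min.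
  by move=> /orP[|]; [lra|rewrite opprD ltrBrDl].
by move=> h; apply/orP; right; move: h; rewrite opprD ltrBrDl.
Qed.

Let W_nd N a : (W N a <= W N.+1 a)%E.
Proof.
apply: ge0_le_integral => //.
- by apply: (measurableT_comp (mind a)).
- by apply: (measurableT_comp (mind a)); exact: mback.
move=> w _; rewrite lee_fin !indicE.
suff h k : backward xi trunc_step 0 N.+1 k w <= backward xi trunc_step 0 N k w.
  case: (boolP (_ \in _)) => //; rewrite inE => /= wa.
  by rewrite mem_set//=; exact: le_lt_trans (h 0%N) wa.
elim: N k => [|N IH] k; first exact: trunc_le0.
rewrite [leLHS]/= [leRHS]/= /trunc_step/=.
rewrite le_min ge_min lexx/= ge_min; apply/orP; right.
by rewrite lerD2l; exact: IH.
Qed.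

(* Lack of memory: truncating the steps at -1 bounds the overshoot below a level by 1. *)
Lemma trunc_submul N (a b : R) : 0 <= a -> 0 <= b ->
  (W N (a + b + 1) <= W N a * W N b)%E.
Proof.
elim: N a b => [|N IH] a b a0 b0.
  rewrite {1}/W integral0_eq ?mule_ge0// => w _.
  by rewrite indicE memNset//= ltNge => /negP; apply; lra.
rewrite W_rec; last by lra.
have mW c : measurable_fun setT (fun y : R => W N (c + Num.max y (- 1))).
  apply: (measurable_fun_fubini_tonelli_F (m2 := P) (fun z : R * Omega => 
   (\1_[set u : R | u < - (c + Num.max z.1 (-1))] (backward xi trunc_step 0 N 0 z.2))%:E)) => //.
  rewrite (_ : (fun z => _) = (fun z => (\1_[set u : R | u < - c] (backward xi trunc_step 0 N 0 z.2 + Num.max z.1 (-1)))%:E)).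
    apply: (measurableT_comp (mind c)); apply: measurable_funD.
      exact: measurableT_comp (mback N 0) _.
    exact: measurable_maxr.
  apply/funext => z; rewrite !indicE; congr ((nat_of_bool _)%:R%:E).
  by apply/idP/idP; rewrite !inE /=; lra.
apply: (@le_trans _ _ (\int[mu]_y (W N (a + Num.max y (- 1))%R * W N b)))%E.
  apply: ge0_le_integral => //.
  - by apply: emeasurable_funM.
  move=> y _.
  have y1 : - 1 <= Num.max y (- 1) by rewrite le_max lexx orbT.
  have [h|h] := leP 0 (a + Num.max y (- 1)).
    rewrite (_ : a + b + 1 + Num.max y (- 1) = a + Num.max y (- 1) + b + 1); last by ring.
    exact: IH.
  rewrite (W_neg N h) mul1e /W.
  apply: ge0_le_integral => //.
  - by apply: (measurableT_comp (mind _)).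
  - by apply: (measurableT_comp (mind _)).
  move=> w _; rewrite lee_fin !indicE; case: (boolP (_ \in _)) => //.
  by rewrite inE => /= wa; rewrite mem_set//=; lra.
by rewrite ge0_integralZr// -W_rec//; apply: lee_wpmul2l.
Qed.

(** Each factor accounts for a depth of 2: one unit to be descended and one unit for the
    overshoot. *)
Lemma trunc_geometric N k : (W N (2 * k%:R) <= W N 1 ^+ k)%E.
Proof.
elim: k => [|k IH]; first by rewrite expe0.
rewrite expeS (_ : 2 * k.+1%:R = 1 + 2 * k%:R + 1); last by rewrite -natr1; ring.
apply: le_trans (lee_wpmul2l _ IH) => //; exact: trunc_submul.
Qed.

Lemma backward_walk N (a : R) w : 0 <= a -> backward xi trunc_step 0 N 0 w < - a ->
  exists2 j, (j <= N)%N & walk j w < - a.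
Proof.
suff h k b : 0 <= b -> backward xi trunc_step 0 N k w < - b ->
    exists2 j, (j <= N)%N & \sum_(k <= i < k + j) xi i w < - b.
  move=> a0 /h -/(_ a0)[j jN]; rewrite add0n big_mkord => ?; by exists j.
elim: N k b => [|N IH] k b b0 /=; first by lra.
rewrite /trunc_step/= gt_min => /orP[|hb]; first by lra.
have le1 : xi k w <= Num.max (xi k w) (-1) by rewrite le_max lexx.
have [c0|c0] := leP 0 (b + Num.max (xi k w) (-1)).
  have [||j jN hj] := IH k.+1 (b + Num.max (xi k w) (-1)) => //; first by lra.
  exists j.+1 => //; rewrite big_ltn ?addnS ?ltnS ?leq_addr//.
  rewrite addSn in hj; lra.
exists 1%N => //; rewrite addn1 big_nat1; lra.
Qed.

Lemma walk_backward N w : (forall i, (i < N)%N -> - 1 <= xi i w) ->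
  backward xi trunc_step 0 N 0 w <= walk N w.
Proof.
suff h k : (forall i, (i < N)%N -> - 1 <= xi (k + i)%N w) ->
    backward xi trunc_step 0 N k w <= \sum_(k <= i < k + N) xi i w.
  by move=> /(h 0%N); rewrite add0n big_mkord.
elim: N k => [|N IH] k H /=; first by rewrite addn0 big_geq.
rewrite /trunc_step/= ge_min; apply/orP; right.
rewrite big_ltn ?addnS ?ltnS ?leq_addr//.
have := H 0%N isT; rewrite addn0 => h0; rewrite (max_idPl h0) lerD2l -addSn.
by apply: IH => i iN; rewrite addSnnS; exact: H.
Qed.

(** Outside an event of probability at most e no step is truncated, so the truncated minimum lies
    below the walk and the geometric bound applies. Since truncation only raises the path, its first
    factor [W N 1] is at most the probability q for the original walk. *)
Lemma walk_tail N k (q e : \bar R) :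
  (P [set w | exists2 j, (j <= N)%N & (walk j w < - 1)%R] <= q)%E ->
  (P [set w | exists2 i, (i < N)%N & (xi i w < - 1)%R] <= e)%E ->
  (P [set w | (walk N w < - (2 * k%:R))%R] <= q ^+ k + e)%E.
Proof.
move=> hq he.
have mset1 (f : Omega -> R) (a : R) : measurable_fun setT f ->
    measurable [set w | f w < a].
  move=> mf; rewrite -[X in measurable X]setTI.
  rewrite (_ : [set w | f w < a] = f @^-1` `]-oo, a[%classic); first exact: mf.
  by apply/seteqP; split => z /=; rewrite in_itv.
have mB a : measurable [set w | backward xi trunc_step 0 N 0 w < - a].
  by apply: mset1; exact: mback.
have WP a : W N a = P [set w | backward xi trunc_step 0 N 0 w < - a].
  rewrite -[X in _ = P X]setIT -(integral_indic P measurableT (mB a)).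
  apply: eq_integral => w _; rewrite !indicE; congr ((nat_of_bool _)%:R%:E).
have mex (f : nat -> Omega -> R) (p : nat -> bool) : (forall i, measurable_fun setT (f i)) ->
    measurable [set w | exists2 j, p j & f j w < -1].
  move=> mf; rewrite (_ : [set w | _] = \bigcup_(j in [set j | p j]) [set w | f j w < -1]).
    by apply: bigcup_measurable => j _; exact: mset1.
  by apply/seteqP; split => w [j pj fj]; exists j.
have Wq : (W N 1 <= q)%E.
  rewrite WP; apply: le_trans hq; apply: le_measure; rewrite ?inE//.
    by apply: mex => i; exact: measurable_walk.
  by move=> w /=; exact: backward_walk.
apply: (@le_trans _ _ (W N (2 * k%:R) + e)%E); last first.
  apply: leeD => //; apply: le_trans (trunc_geometric N k) _.
  elim: k => [|k IHk]; first by rewrite !expe0.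
  by rewrite !expeS; apply: lee_pmul => //; rewrite expe_ge0.
rewrite WP.
set E1 := [set w | backward _ _ _ _ _ _ < _].
set E2 := [set w | exists2 i, (i < N)%N & xi i w < - 1] in he *.
have mE2 : measurable E2 by apply: (mex xi (fun i => (i < N)%N)).
apply: (@le_trans _ _ (P (E1 `|` E2))).
  apply: le_measure; rewrite ?inE//.
  - by apply: mset1; exact: measurable_walk.
  - by apply: measurableU => //; exact: mB.
  move=> w /= wN; have [w2|w2] := pselect (E2 w); [by right|left].
  rewrite /E1 /=; apply: le_lt_trans wN; apply: walk_backward => i iN.
  by rewrite leNgt; apply/negP => h; apply: w2; exists i.
apply: le_trans (leeD2l _ he).
by apply: measureU2 => //; exact: mB.
Qed.

End random_walk.

(** * Elementary inequalities for the exponential *)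

Section expR_bounds.
Context {R : realType}.
Implicit Types s x y t e : R.

(** The tangent of exp at t x lies below exp at x and at 0; weighting these two inequalities with t
    and 1 - t cancels the linear terms. *)
Lemma expR_convex t x : 0 <= t <= 1 -> expR (t * x) <= 1 + t * (expR x - 1).
Proof.
move=> /andP[t0 t1].
have h1 : expR (t * x) * (1 + (1 - t) * x) <= expR x.
  have -> : expR x = expR (t * x) * expR ((1 - t) * x).
    by rewrite -expRD; congr expR; ring.
  by rewrite ler_wpM2l ?expR_ge0// expR_ge1Dx.
have h2 : expR (t * x) * (1 - t * x) <= 1.
  have := expR_ge1Dx (- (t * x)); rewrite expRN => h.
  rewrite -[leRHS](mulfV (lt0r_neq0 (expR_gt0 (t * x)))) ler_wpM2l ?expR_ge0//.
have -> : 1 + t * (expR x - 1) = t * expR x + (1 - t) * 1 by ring.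
have := ler_wpM2l t0 h1; have := @ler_wpM2l _ (1 - t) _ _ _ h2.
rewrite subr_ge0 => /(_ t1); nra.
Qed.

Lemma expRB1_le y : expR y - 1 <= y * expR y.
Proof.
have := expR_ge1Dx (- y); rewrite expRN => h.
have e0 := expR_gt0 y.
have : expR y * (1 - y) <= 1.
  by rewrite -[leRHS](mulfV (lt0r_neq0 e0)) ler_wpM2l ?expR_ge0.
lra.
Qed.

Lemma expR_slope s t y : 0 < s -> s <= t -> 0 <= y ->
  (expR (s * y) - 1) / s <= (expR (t * y) - 1) / t.
Proof.
move=> s0 st y0; have t0 := lt_le_trans s0 st.
have st1 : 0 <= s / t <= 1 by rewrite divr_ge0 ?(ltW s0) ?(ltW t0)//= ler_pdivrMr// mul1r.
have := expR_convex (t * y) st1.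
rewrite (_ : s / t * (t * y) = s * y); last by field; rewrite gt_eqF.
move=> h; rewrite ler_pdivrMr//.
rewrite (_ : _ / t * s = s / t * (expR (t * y) - 1)); last by ring.
lra.
Qed.

(** Both quotients are compared with y: the left one is at most y exp(s y), the right one at least
    y. So s and t may come in either order, at the cost of a factor close to 1 for small e. *)
Lemma expR_slope_le s t y e : 0 < s -> 0 < t -> 0 <= y -> y <= e ->
  (expR (s * y) - 1) / s <= expR (s * e) * ((expR (t * y) - 1) / t).
Proof.
move=> s0 t0 y0 ye.
apply: (@le_trans _ _ (y * expR (s * y))).
  rewrite ler_pdivrMr// (_ : _ * s = s * y * expR (s * y)); last by ring.
  exact: expRB1_le.
rewrite mulrC; apply: ler_pM; rewrite ?expR_ge0// ?ler_expR ?ler_wpM2l ?(ltW s0)//.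
rewrite ler_pdivlMr//; have := expR_ge1Dx (t * y); lra.
Qed.

Lemma expR_neg_part s y : 0 <= s ->
  expR (s * Num.max 0 (- y)) <= 1 + expR (- s * y).
Proof.
move=> s0; have [h|h] := leP 0 (- y).
  by rewrite mulrN mulNr lerDr.
by rewrite mulr0 expR0 lerDl expR_ge0.
Qed.

End expR_bounds.

(** * Exponential moments of the running maximum of a walk *)

Section pollaczek_khinchine.
Context {R : realType} {d : measure_display} {Omega : measurableType d}
  (P : probability Omega R) (xi : nat -> Omega -> R) (mu : probability R R).
Hypothesis mxi : forall i, measurable_fun setT (xi i).
Hypothesis ind : forall n (A : nat -> set R), (forall i, measurable (A i)) ->
  P (\bigcap_(i in [set i : nat | (i < n)%N]) (xi i @^-1` A i)) =
  (\prod_(i < n) mu (A i))%E.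

Lemma xi_integrable k (g : R -> R) : measurable_fun setT g -> (forall y, 0 <= g y) ->
  mu.-integrable setT (EFin \o g) ->
  P.-integrable setT (EFin \o (g \o xi k)) /\
  \int[P]_w g (xi k w) = \int[mu]_y g y.
Proof.
move=> mg g0 ig.
have mg' : measurable_fun setT (EFin \o g) by exact/measurable_EFinP.
have g0' y : (0 <= (EFin \o g) y)%E by rewrite lee_fin.
have h := xi_integral mxi ind k mg' g0'.
split; last by rewrite /Rintegral h.
apply/integrableP; split.
  by apply/measurable_EFinP; exact: measurableT_comp.
rewrite (eq_integral (fun w => (EFin \o g) (xi k w))); last first.
  by move=> w _ /=; rewrite ger0_norm.
rewrite h; move/integrableP : ig => [_]; apply: le_lt_trans.
rewrite le_eqVlt; apply/orP; left; apply/eqP; apply: eq_integral => y _ /=.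
by rewrite ger0_norm.
Qed.

Lemma others_mulR k (f : OT xi k -> R) (g : R -> R) :
  measurable_fun setT f -> (forall w, 0 <= f w) -> P.-integrable setT (EFin \o f) ->
  measurable_fun setT g -> (forall y, 0 <= g y) -> mu.-integrable setT (EFin \o g) ->
  P.-integrable setT (fun w => (f w * g (xi k w))%:E) /\
  \int[P]_w (f w * g (xi k w)) = (\int[P]_w f w) * (\int[mu]_y g y).
Proof.
move=> mf f0 fi mg g0 gi.
have h : (\int[P]_w (f w * g (xi k w))%:E =
    (\int[P]_w f w)%:E * (\int[mu]_y g y)%:E)%E.
  rewrite -!Rintegral_EFin//.
  rewrite -(others_mul mxi ind (k := k) (f := EFin \o f) (g := EFin \o g))//.
  - exact/measurable_EFinP.
  - exact/measurable_EFinP.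
split; last by rewrite {1}/Rintegral h.
apply/integrableP; split.
  apply/measurable_EFinP/measurable_funM.
    exact: others_measurable_fun mf.
  exact: measurableT_comp.
have -> : (\int[P]_w `|(f w * g (xi k w))%:E| = \int[P]_w (f w * g (xi k w))%:E)%E.
  by congr integral; apply/funext => w /=; rewrite ger0_norm// mulr_ge0.
by rewrite h -EFinM ltry.
Qed.

(** The Lindley recursion: through [backward] it produces the maximum of the next N partial sums,
    the empty one included. *)
Definition max_step (z : R * R) : R := Num.max 0 (z.1 + z.2).

Lemma measurable_max_step : measurable_fun setT max_step.
Proof. by apply: measurable_maxr => //; exact: measurable_funD. Qed.

Definition future_max N k := backward xi max_step 0 N k.

Lemma measurable_future_max N k : measurable_fun setT (future_max N k).
Proof. exact: backward_measurable measurable_max_step _ _. Qed.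

Lemma future_max_ge0 N k w : 0 <= future_max N k w.
Proof. by case: N => [|N] //; rewrite /future_max /= /max_step le_max lexx. Qed.

Lemma future_max_nd N k w : future_max N k w <= future_max N.+1 k w.
Proof.
elim: N k => [|N IH] k; first exact: future_max_ge0.
rewrite /future_max [leLHS]/= [leRHS]/= /max_step/=.
rewrite ge_max le_max lexx/= le_max; apply/orP; right.
by rewrite lerD2l; exact: IH.
Qed.

Lemma walk_le_max N j w : (j <= N)%N -> walk xi j w <= future_max N 0 w.
Proof.
suff h k : (j <= N)%N -> \sum_(k <= i < k + j) xi i w <= future_max N k w.
  by move=> /(h 0%N); rewrite add0n big_mkord.
elim: N j k => [|N IH] [|j] k // jN; rewrite ?addn0 ?(big_geq (leqnn _)) ?future_max_ge0//.
rewrite big_ltn ?addnS ?ltnS ?leq_addr// /future_max /= /max_step/= le_max.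
by apply/orP; right; rewrite lerD2l -addSn; exact: IH.
Qed.

Lemma max_eq_walk N w : exists2 j, (j <= N)%N & future_max N 0 w = walk xi j w.
Proof.
suff h k : exists2 j, (j <= N)%N & future_max N k w = \sum_(k <= i < k + j) xi i w.
  by have [j jN] := h 0%N; rewrite add0n big_mkord => ?; exists j.
elim: N k => [|N IH] k; first by exists 0%N => //; rewrite addn0 big_geq.
rewrite /future_max /= /max_step/=.
have [h|h] := leP (xi k w + future_max N k.+1 w) 0.
  by exists 0%N => //; rewrite addn0 big_geq//; apply/max_idPl.
have [j jN jE] := IH k.+1; exists j.+1 => //.
rewrite jE.
by rewrite [RHS]big_ltn ?addnS ?ltnS ?leq_addr// addSn.
Qed.

Hypothesis mgf : forall b, 0 <= b -> mu.-integrable setT (fun y => (expR (- b * y))%:E).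

Definition laplace (b : R) : R := \int[mu]_y expR (- b * y).

Lemma measurable_expRM (b : R) : measurable_fun setT (fun y : R => expR (b * y)).
Proof. by apply: measurableT_comp => //; exact: measurable_funM. Qed.

Lemma measurable_EFin_expRM (b : R) : measurable_fun setT (fun y : R => (expR (b * y))%:E).
Proof. by apply/measurable_EFinP; exact: measurable_expRM. Qed.

Definition pkF N (s : R) : R := \int[P]_w expR (- s * future_max N 0 w).

Definition shortfall N w : R := Num.max 0 (- (xi 0 w + future_max N 1 w)).

(** The defect of the Lindley recursion on exponential moments. As exp(s z) - 1 is about s z for a
    small shortfall z, the ratio [pkJ N s / s] hardly depends on s; this is the source of the
    Pollaczek-Khinchine formula. *)
Definition pkJ N (s : R) : R := \int[P]_w (expR (s * shortfall N w) - 1).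

(** The part of the exponential moment due to steps below -e: the price for treating every overshoot
    as at most e. *)
Definition jump_tail (s e : R) : R :=
  \int[mu]_y (expR (s * Num.max 0 (- y)) * \1_[set y : R | e < - y] y).

Lemma shortfall_ge0 N w : 0 <= shortfall N w.
Proof. by rewrite le_max lexx. Qed.

Lemma shortfall_le N w : shortfall N w <= Num.max 0 (- xi 0 w).
Proof.
rewrite /shortfall ge_max le_max lexx/= le_max; apply/orP; right.
by rewrite lerN2 lerDl future_max_ge0.
Qed.

Lemma measurable_shortfall N : measurable_fun setT (shortfall N).
Proof.
apply: measurable_maxr => //; apply: measurableT_comp => //.
by apply: measurable_funD => //; exact: measurable_future_max.
Qed.

Lemma measurable_expR_max s N k :
  measurable_fun setT (fun w => expR (s * future_max N k w)).
Proof. exact: (measurableT_comp (measurable_expRM s) (@measurable_future_max N k)). Qed.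

Lemma expR_max_le1 s N k w : 0 <= s -> expR (- s * future_max N k w) <= 1.
Proof.
by move=> s0; rewrite -expR0 ler_expR mulNr oppr_le0 mulr_ge0// future_max_ge0.
Qed.

Lemma expR_max_integrable s N k : 0 <= s ->
  P.-integrable setT (fun w => (expR (- s * future_max N k w))%:E).
Proof.
move=> s0; apply: (@bounded_integrable _ _ _ _ _ 1); first exact: measurable_expR_max.
by move=> w; rewrite ger0_norm ?expR_ge0// expR_max_le1.
Qed.

Lemma measurable_expR_shortfall s N :
  measurable_fun setT (fun w => expR (s * shortfall N w) - 1).
Proof.
apply: measurable_funB => //.
exact: (measurableT_comp (measurable_expRM s) (@measurable_shortfall N)).
Qed.

Lemma expR_shortfall_ge0 s N w : 0 <= s -> 0 <= expR (s * shortfall N w) - 1.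
Proof.
by move=> s0; rewrite subr_ge0 -expR0 ler_expR mulr_ge0// shortfall_ge0.
Qed.

Lemma expR_shortfall_integrable s N : 0 <= s ->
  P.-integrable setT (fun w => (expR (s * shortfall N w) - 1)%:E).
Proof.
move=> s0.
have [ig _] := xi_integrable 0 (measurable_expRM (- s)) (fun=> expR_ge0 _) (mgf s0).
apply: integrable_le ig; first exact: measurable_expR_shortfall.
  by move=> w; exact: expR_shortfall_ge0.
move=> w /=; rewrite lerBlDl; apply: le_trans (expR_neg_part _ s0).
by rewrite ler_expR ler_wpM2l// shortfall_le.
Qed.

Lemma pkF_ge0 N s : 0 <= pkF N s.
Proof. by apply: Rintegral_ge0 => w _; rewrite expR_ge0. Qed.

Lemma pkF_ni N s : 0 <= s -> pkF N.+1 s <= pkF N s.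
Proof.
move=> s0; apply: le_Rintegral => //; try exact: expR_max_integrable.
by move=> w _; rewrite ler_expR !mulNr lerN2 ler_wpM2l// future_max_nd.
Qed.

(* With m = future_max and z = xi 0 + m, either [max 0 z = z] and the shortfall
   vanishes, or [max 0 z = 0] and the shortfall is [- z]. *)
Lemma pk_rec N s : 0 <= s -> pkF N.+1 s + pkJ N s = laplace s * pkF N s.
Proof.
move=> s0.
have mF : measurable_fun setT (fun w : OT xi 0 => expR (- s * future_max N 1 w)).
  apply: (measurableT_comp (measurable_expRM (- s))).
  exact: (backward_others 0 measurable_max_step N (isT : (0 < 1)%N)).
have [pi pE] := others_mulR mF (fun=> expR_ge0 _) (expR_max_integrable N 1 s0)
  (measurable_expRM (- s)) (fun=> expR_ge0 _) (mgf s0).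
have FE : pkF N s = \int[P]_w expR (- s * future_max N 1 w).
  congr fine; apply: (@backward_law _ _ _ P xi mu mxi ind max_step 0
    measurable_max_step N 0 1 (fun z => (expR (- s * z))%:E)).
    exact: measurable_EFin_expRM.
  by move=> z; rewrite lee_fin expR_ge0.
rewrite FE mulrC /laplace -pE.
rewrite /pkF /pkJ -RintegralD//; last 2 first.
- exact: expR_max_integrable.
- exact: expR_shortfall_integrable.
apply: eq_Rintegral => w _; rewrite -expRD /shortfall {1}/future_max /= /max_step/=.
rewrite -/(future_max N 1 w).
have [h|h] := leP 0 (xi 0 w + future_max N 1 w).
  rewrite (max_idPl (_ : - _ <= 0)) ?oppr_le0// mulr0 expR0 subrr addr0; congr expR; ring.
rewrite (max_idPr (_ : 0 <= - _)) ?oppr_ge0 ?ltW// mulr0 expR0 addrC subrK; congr expR; ring.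
Qed.

Lemma measurable_jump_tail s e : measurable_fun setT
  (fun y : R => expR (s * Num.max 0 (- y)) * \1_[set y : R | e < - y] y).
Proof.
apply: measurable_funM.
  apply: (measurableT_comp (measurable_expRM s)); apply: measurable_maxr => //.
apply: measurable_indic.
rewrite (_ : [set y | e < - y] = `]-oo, (- e)[%classic)//.
by apply/seteqP; split => z /=; rewrite in_itv/= ltrNr.
Qed.

Lemma jump_tail_fun_ge0 s e (y : R) :
  0 <= expR (s * Num.max 0 (- y)) * \1_[set y : R | e < - y] y.
Proof. by rewrite mulr_ge0// expR_ge0. Qed.

Lemma jump_tail_integrable s e : 0 <= s -> 0 <= e ->
  mu.-integrable setT
    (fun y => (expR (s * Num.max 0 (- y)) * \1_[set y : R | e < - y] y)%:E).
Proof.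
move=> s0 e0; apply: integrable_le (mgf s0).
- exact: measurable_jump_tail.
- exact: jump_tail_fun_ge0.
move=> y; rewrite indicE; case: (boolP (y \in _)); last by rewrite mulr0 expR_ge0.
rewrite inE mulr1/= => ey; rewrite (max_idPr _) ?mulrN ?mulNr//; lra.
Qed.

Lemma jump_tail_ge0 s e : 0 <= jump_tail s e.
Proof. by apply: Rintegral_ge0 => y _; exact: jump_tail_fun_ge0. Qed.

(** A shortfall of at most e is covered by [expR_slope_le]. A larger one forces the step [xi 0]
    itself below -e, because the maximum that follows is nonnegative, and is then bounded by the
    negative part of this step. *)
Lemma pk_compare N s t e : 0 < s -> 0 < t -> 0 <= e ->
  pkJ N s / s <= expR (s * e) * (pkJ N t / t) + s^-1 * jump_tail s e.
Proof.
move=> s0 t0 e0.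
have mJ := measurable_jump_tail s e.
have [ji jE] := xi_integrable 0 mJ (jump_tail_fun_ge0 s e)
  (jump_tail_integrable (ltW s0) e0).
rewrite /jump_tail -jE.
have si := expR_shortfall_integrable N (ltW s0).
have ti := expR_shortfall_integrable N (ltW t0).
rewrite -[X in _ * (X / t)]/(pkJ N t) (mulrC _ t^-1) mulrA.
rewrite /pkJ mulrC -!RintegralZl// -RintegralD//; last 2 first.
- exact: (@integrableZl _ _ _ P setT measurableT (expR (s * e) / t) _ ti).
- exact: (@integrableZl _ _ _ P setT measurableT s^-1 _ ji).
apply: le_Rintegral => //.
- exact: (@integrableZl _ _ _ P setT measurableT s^-1 _ si).
- apply: integrable_EFinD; first exact: integrable_EFinZl ti.
  exact: integrable_EFinZl ji.
move=> w _.
have I0 := shortfall_ge0 N w.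
have [h|h] := leP (shortfall N w) e.
  have := expR_slope_le s0 t0 I0 h.
  have : 0 <= s^-1 * (expR (s * Num.max 0 (- xi 0 w)) * \1_[set y : R | e < - y] (xi 0 w)).
    by rewrite mulr_ge0// ?invr_ge0 ?ltW// jump_tail_fun_ge0.
  by rewrite mulrC [in leRHS]mulrAC -mulrA; lra.
have hx : e < - xi 0 w.
  have := lt_le_trans h (shortfall_le N w).
  by rewrite lt_max ltNge e0.
rewrite indicE mem_set//= mulr1.
apply: (@le_trans _ _ (s^-1 * expR (s * Num.max 0 (- xi 0 w)))).
  rewrite ler_wpM2l ?invr_ge0 ?(ltW s0)// lerBlDr.
  by rewrite ler_wpDr// ler_expR ler_wpM2l ?(ltW s0)// shortfall_le.
rewrite lerDr mulr_ge0//; first by rewrite divr_ge0 ?expR_ge0// ltW.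
by rewrite expR_shortfall_ge0// ltW.
Qed.

Lemma pk_slope N s t : 0 < s -> s <= t -> pkJ N s / s <= pkJ N t / t.
Proof.
move=> s0 st; have t0 := lt_le_trans s0 st.
have si := expR_shortfall_integrable N (ltW s0).
have ti := expR_shortfall_integrable N (ltW t0).
rewrite /pkJ -!RintegralZr//; apply: le_Rintegral => //.
- exact: (@integrableZr _ _ _ P setT measurableT s^-1 _ si).
- exact: (@integrableZr _ _ _ P setT measurableT t^-1 _ ti).
by move=> w _; apply: expR_slope => //; exact: shortfall_ge0.
Qed.

Lemma pkF_cvg1 N : pkF N n.+1%:R^-1 @[n --> \oo] --> (1 : R).
Proof.
rewrite /pkF -[X in _ --> X](Rintegral_cst_prob P).
apply: (@Rintegral_bct _ _ _ _ _ _ 1).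
- by move=> n; exact: measurable_expR_max.
- by [].
- move=> w; rewrite -[X in _ --> X](expR0) -(mul0r (future_max N 0 w)) -oppr0.
  have c0 : - n.+1%:R^-1 * future_max N 0 w @[n --> \oo] --> - 0 * future_max N 0 w.
    by apply: cvgMr_tmp; apply: cvgN; exact: cvg_harmonic.
  exact: (cvg_comp _ expR c0 (@continuous_expR R _)).
- by move=> n w; rewrite ger0_norm ?expR_ge0// expR_max_le1.
Qed.

(* [pkJ N t / t] is nondecreasing in t: let t tend to 0. *)
Lemma pkJ_ge N s (c : R) : 0 < s ->
  (forall t, 0 < t -> c * t <= laplace t - 1) -> c * s <= pkJ N s.
Proof.
move=> s0 Hc; rewrite -ler_pdivlMr//.
have : c * pkF N n.+1%:R^-1 @[n --> \oo] --> c * 1.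
  by apply: cvgMr; exact: pkF_cvg1.
rewrite mulr1 => cv.
rewrite -(cvg_lim _ cv)//; apply: limr_le; first by apply/cvg_ex; exists c.
near=> n; set t : R := n.+1%:R^-1.
have t0 : 0 < t by rewrite invr_gt0.
have ts : t <= s.
  rewrite /t ltW//; near: n; exact: (near_infty_natSinv_lt (PosNum s0)).
apply: le_trans (pk_slope N t0 ts).
rewrite ler_pdivlMr//; have := pk_rec N (ltW t0).
have := pkF_ni N (ltW t0); have := Hc _ t0; have := pkF_ge0 N t.
nra.
Unshelve. all: by end_near. Qed.

End pollaczek_khinchine.

(** The final arithmetic of [passage_estimate]: V1 and V2 are the exit terms for the two exponents.
    Both exceed the discounted exit probability Q only by an overshoot error, so they cancel in the
    difference of the two telescoped identities. *)
Lemma passage_arith {R : realFieldType} (D S U Q V1 V2 u1 u2 r X1 X2 E1 E2 j1 j2 c : R) :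
  D * U = X1 - u1 - V1 -> `|S - U| <= 2 ->
  0 = X2 - u2 - V2 -> 0 <= u1 <= r -> 0 <= u2 <= r ->
  Q <= V1 -> Q <= V2 -> V1 - Q <= E1 + j1 * c -> V2 - Q <= E2 + j2 * c ->
  0 <= E1 -> 0 <= E2 -> 0 <= j1 * c -> 0 <= j2 * c ->
  `|D * S - (X1 - X2)| <= 2 * r + E1 + E2 + (j1 + j2) * c + 2 * `|D|.
Proof.
move=> DU SU *; rewrite (_ : _ - _ = D * (S - U) + ((u2 - u1) + (V2 - V1))).
  apply: le_trans (ler_normD _ _) _; rewrite addrC mulrDl lerD// ?normrM 1?mulrC ?ler_wpM2r//.
  by rewrite ler_norml; apply/andP; split; lra.
by rewrite mulrBr DU; lra.
Qed.

(** * The walk killed on leaving the positive half-line *)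

Section first_passage.
Context {R : realType} {d : measure_display} {Omega : measurableType d}
  (P : probability Omega R) (xi : nat -> Omega -> R) (mu : probability R R).
Hypothesis mxi : forall i, measurable_fun setT (xi i).
Hypothesis ind : forall n (A : nat -> set R), (forall i, measurable (A i)) ->
  P (\bigcap_(i in [set i : nat | (i < n)%N]) (xi i @^-1` A i)) =
  (\prod_(i < n) mu (A i))%E.
Hypothesis mgf : forall b, 0 <= b -> mu.-integrable setT (fun y => (expR (- b * y))%:E).

Definition alive x k : set Omega := [set w | forall i, (i <= k)%N -> 0 < x + walk xi i w].

Lemma aliveS x k : alive x k.+1 `<=` alive x k.
Proof. by move=> w H i ik; apply: H; exact: leqW. Qed.

Lemma alive_others x k : measurable (alive x k : set (OT xi k)).
Proof.
rewrite (_ : alive x k = \bigcap_(i in [set i : nat | (i < k.+1)%N])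
    ((walk xi i : OT xi k -> R) @^-1` `]- x, +oo[%classic)); last first.
  apply/seteqP; split => w H i ik; have := H i ik; rewrite /= in_itv/= andbT.
    by rewrite -ltrBlDl sub0r.
  by rewrite -ltrBlDl sub0r.
apply: fin_bigcap_measurable => // i; rewrite /= ltnS => ik; rewrite -[X in measurable X]setTI.
exact: (walk_others ik).
Qed.

Lemma measurable_alive x k : measurable (alive x k : set Omega).
Proof. exact: (others_sub mxi (@alive_others x k)). Qed.

Variable x : R.
Hypothesis x0 : 0 < x.

Let A := alive x.
(** [q k] is the probability of exit exactly at step k + 1, and [v b k] weights this event with the
    exponential at the exit position. Without overshoot that position would be 0 and [v b k] would
    equal [q k] for every b. *)
Let q k : R := fine (P (A k `\` A k.+1)).
Let p k : R := fine (P (A k)).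
Let u b k : R := \int[P]_w (expR (- b * (x + walk xi k w)) * \1_(A k) w).
Let v b k : R :=
  \int[P]_w (expR (- b * (x + walk xi k.+1 w)) * \1_(A k `\` A k.+1) w).

Let mA k : measurable (A k). Proof. exact: measurable_alive. Qed.
Let mAD k : measurable (A k `\` A k.+1). Proof. exact: measurableD. Qed.

Let mexp b k : measurable_fun setT (fun w => expR (- b * (x + walk xi k w))).
Proof.
apply: (measurableT_comp (measurable_expRM (- b))).
by apply: measurable_funD => //; exact: measurable_walk.
Qed.

Let u_fun_le1 b k w : 0 <= b -> expR (- b * (x + walk xi k w)) * \1_(A k) w <= 1.
Proof.
move=> b0; rewrite indicE; case: (boolP (_ \in _)) => [|_]; last by rewrite mulr0.
rewrite inE => Aw; rewrite mulr1 -expR0 ler_expR mulNr oppr_le0 mulr_ge0//.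
exact/ltW/Aw.
Qed.

Let u_fun_ge0 b k (B : set Omega) w : 0 <= expR (- b * (x + walk xi k w)) * \1_B w.
Proof. by rewrite mulr_ge0// expR_ge0. Qed.

Let ui b k : 0 <= b ->
  P.-integrable setT (fun w => (expR (- b * (x + walk xi k w)) * \1_(A k) w)%:E).
Proof.
move=> b0; apply: (@bounded_integrable _ _ _ _ _ 1).
  by apply: measurable_funM => //; exact: measurable_indic.
by move=> w; rewrite ger0_norm ?u_fun_le1.
Qed.

Let u_ge0 b k : 0 <= u b k.
Proof. by apply: Rintegral_ge0 => w _. Qed.

Let u_le1 b k : 0 <= b -> u b k <= 1.
Proof.
move=> b0; rewrite -[leRHS](Rintegral_cst_prob P); apply: le_Rintegral => //.
- exact: ui.
- exact: finite_measure_integrable_cst.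
- by move=> w _; exact: u_fun_le1.
Qed.

Let step_mul b k : 0 <= b ->
  P.-integrable setT (fun w => (expR (- b * (x + walk xi k.+1 w)) * \1_(A k) w)%:E) /\
  \int[P]_w (expR (- b * (x + walk xi k.+1 w)) * \1_(A k) w) = u b k * laplace mu b.
Proof.
move=> b0.
have mf : measurable_fun setT (fun w : OT xi k => expR (- b * (x + walk xi k w)) * \1_(A k) w).
  apply: measurable_funM; last by apply: measurable_indic; exact: alive_others.
  apply: (measurableT_comp (measurable_expRM (- b))).
  by apply: measurable_funD => //; exact: walk_others.
have [hi hE] := others_mulR mxi ind mf (fun w => u_fun_ge0 b k (A k) w) (ui k b0)
  (measurable_expRM (- b)) (fun=> expR_ge0 _) (mgf b0).
have fE w : expR (- b * (x + walk xi k.+1 w)) * \1_(A k) w =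
    expR (- b * (x + walk xi k w)) * \1_(A k) w * expR (- b * xi k w).
  by rewrite walkS addrA mulrDr expRD mulrAC.
split; last by rewrite -hE; apply: eq_Rintegral => w _.
by apply: eq_integrable hi => // w _; rewrite fE.
Qed.

Let indicS k w : (\1_(A k) w : R) = \1_(A k.+1) w + \1_(A k `\` A k.+1) w.
Proof.
rewrite !indicE in_setD.
case: (boolP (w \in A k.+1)) => [|h]; last by rewrite andbT add0r.
by rewrite inE => /aliveS; rewrite andbF addr0 => h; rewrite mem_set.
Qed.

Let vi b k : 0 <= b -> P.-integrable setT
  (fun w => (expR (- b * (x + walk xi k.+1 w)) * \1_(A k `\` A k.+1) w)%:E).
Proof.
move=> b0; have [hi _] := step_mul k b0; apply: integrable_le hi => //.
  by apply: measurable_funM => //; exact: measurable_indic.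
move=> w; rewrite ler_wpM2l ?expR_ge0// (indicS k) lerDr.
by rewrite indicE.
Qed.

Let uvE b k : 0 <= b -> u b k.+1 + v b k = laplace mu b * u b k.
Proof.
move=> b0; have [_ hE] := step_mul k b0.
rewrite mulrC -hE -RintegralD//; [|exact: ui|exact: vi].
by apply: eq_Rintegral => w _; rewrite (indicS k) [RHS]mulrDr.
Qed.

Let q_ge0 k : 0 <= q k. Proof. exact: fine_ge0. Qed.

Let fin (B : set Omega) : measurable B -> P B \is a fin_num.
Proof. by move=> mB; exact: fin_num_measure. Qed.

Let pS k : p k = p k.+1 + q k.
Proof.
rewrite /p /q -fineD ?fin// -measureU//; last first.
  by apply/seteqP; split => w // [? []].
by rewrite setDUK//; exact: aliveS.
Qed.

Let p_ge0 k : 0 <= p k. Proof. exact: fine_ge0. Qed.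

Let p_le1 k : p k <= 1.
Proof. by rewrite /p -lee_fin fineK ?fin//; exact: probability_le1. Qed.

Let overshoot k w : (A k `\` A k.+1) w ->
  0 <= - (x + walk xi k.+1 w) <= Num.max 0 (- xi k w).
Proof.
move=> [Ak nA]; have Skp : 0 < x + walk xi k w by apply: Ak.
have : x + walk xi k.+1 w <= 0.
  rewrite leNgt; apply/negP => h; apply: nA => i.
  by rewrite leq_eqVlt ltnS => /predU1P[->//|]; exact: Ak.
by rewrite walkS le_max => h; apply/andP; split; [|apply/orP; right]; lra.
Qed.

Let v_ge b k : 0 <= b -> q k <= v b k.
Proof.
move=> b0; rewrite /q -(Rintegral_indic P)//; apply: le_Rintegral => //.
- exact: integrable_indicR.
- exact: vi.
move=> w _; rewrite indicE; case: (boolP (_ \in _)) => [|_]; last by rewrite mulr0.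
rewrite inE => /overshoot/andP[h _]; rewrite mulr1 -[leLHS]expR0 ler_expR.
by rewrite mulNr -mulrN mulr_ge0.
Qed.

(** An overshoot of at most e costs a factor exp(b e). A larger one needs a step below -e, and this
    step is independent of survival up to time k, whence the product with [p k]. *)
Let v_le b e k : 0 <= b -> 0 <= e ->
  v b k <= expR (b * e) * q k + p k * jump_tail mu b e.
Proof.
move=> b0 e0.
have mJ := measurable_jump_tail b e.
have i1 B : measurable B -> P.-integrable setT (EFin \o (\1_B : Omega -> R)).
  exact: integrable_indicR.
have i0 (w : OT xi k) : 0 <= \1_(A k) w :> R by rewrite indicE.
have [ji jE] := others_mulR mxi ind
  (f := fun w : OT xi k => \1_(A k) w) (measurable_indic (@alive_others x k))
  i0 (i1 _ (mA k)) mJ (jump_tail_fun_ge0 b e)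
  (jump_tail_integrable mgf b0 e0).
rewrite -[p k](Rintegral_indic P)// -[q k](Rintegral_indic P)//.
rewrite /jump_tail -jE -RintegralZl//; last exact: i1.
rewrite -RintegralD//; last exact: (integrable_EFinZl _ (i1 _ (mAD k))).
apply: le_Rintegral => //; first exact: vi.
  by apply: integrable_EFinD => //; exact: (integrable_EFinZl _ (i1 _ (mAD k))).
move=> w _; rewrite [X in _ * X <= _]indicE.
case: (boolP (_ \in _)) => [Bw|_]; last first.
  rewrite mulr0 addr_ge0// mulr_ge0// ?expR_ge0//; exact: jump_tail_fun_ge0.
have Aw : \1_(A k) w = 1 :> R by rewrite (indicS k) [in X in _ + X]indicE Bw indicE memNset ?add0r//; move: Bw; rewrite inE => -[].
rewrite mulr1 Aw mul1r [X in _ * X + _]indicE Bw mulr1.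
move: Bw; rewrite inE => /overshoot/andP[h0 h1].
rewrite mulNr -mulrN.
have [h|h] := leP (- (x + walk xi k.+1 w)) e.
  rewrite ler_wpDr ?jump_tail_fun_ge0// ler_expR ler_wpM2l//.
rewrite ler_wpDl ?expR_ge0// indicE mem_set/= ?mulr1 ?ler_expR ?ler_wpM2l//.
by have := lt_le_trans h h1; rewrite lt_max ltNge e0.
Qed.

(** Survival is tested up to step k but the position is read at step k + 1. For t in the k-th grid
    cell these are the grid times up to t and the grid point to the right of t, from which X t is
    recovered by right-continuity. The maximum with 0 keeps the integrand bounded on exit. *)
Definition passage_sum r b N : R := \sum_(k < N)
  r ^+ k.+1 * \int[P]_w (expR (- b * Num.max 0 (x + walk xi k.+1 w)) * \1_(alive x k) w).

(** Both exponents are telescoped. The condition r laplace(f) = 1 annihilates the left side of the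
    identity for f, which thus determines the exit term that is missing in the identity for b. *)
Lemma passage_estimate r b f e N : 0 < r -> r < 1 -> 0 <= b -> 0 <= f -> 0 <= e ->
  r * laplace mu f = 1 ->
  `|(1 - r * laplace mu b) * passage_sum r b N - (expR (- b * x) - expR (- f * x))|
  <= 2 * r ^+ N + (expR (b * e) - 1) + (expR (f * e) - 1)
     + (jump_tail mu b e + jump_tail mu f e) / (1 - r)
     + 2 * `|1 - r * laplace mu b|.
Proof.
move=> r0 r1 b0 f0 e0 rf.
have A0 : A 0 = setT.
  apply/seteqP; split => // w _ i; rewrite leqn0 => /eqP ->.
  by rewrite walk0 addr0.
have u0 c : u c 0 = expR (- c * x).
  rewrite /u -[RHS](Rintegral_cst_prob P); apply: eq_Rintegral => w _.
  by rewrite A0 indicT mulr1 walk0 addr0.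
pose Q := \sum_(k < N) r ^+ k.+1 * q k.
pose V c := \sum_(k < N) r ^+ k.+1 * v c k.
pose U c := \sum_(k < N) r ^+ k * u c k.
have rk k : 0 <= r ^+ k by rewrite exprn_ge0// ltW.
have rk1 k : r ^+ k <= 1 by rewrite exprn_ile1 ?ltW.
have tele c : 0 <= c -> (1 - r * laplace mu c) * U c = expR (- c * x) - r ^+ N * u c N - V c.
  move=> c0; rewrite /U /V; elim: (N) => [|n IH].
    by rewrite !big_ord0 mulr0 u0 expr0; ring.
  rewrite !big_ord_recr/= mulrDr IH; have := uvE n c0.
  move=> /(congr1 (fun z => r ^+ n.+1 * z)); rewrite exprS; lra.
have Qle1 : 0 <= Q <= 1.
  rewrite /Q sumr_ge0 => [/=|k _]; last by rewrite mulr_ge0.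
  have : forall n, \sum_(k < n) r ^+ k.+1 * q k <= 1 - p n.
    elim=> [|n IH]; first by rewrite big_ord0 subr_ge0.
    rewrite big_ord_recr/=; have := pS n; have := rk1 n.+1; have := q_ge0 n.
    have := rk n.+1; nra.
  by move=> /(_ N); have := p_ge0 N; lra.
have VQ c : 0 <= c -> Q <= V c.
  by move=> c0; apply: ler_sum => k _; rewrite ler_wpM2l// v_ge.
have geo : \sum_(k < N) r ^+ k.+1 <= (1 - r)^-1.
  have h : (1 - r) * \sum_(k < N) r ^+ k.+1 = r - r ^+ N.+1.
    elim: (N) => [|n IH]; first by rewrite big_ord0 mulr0 expr1 subrr.
    by rewrite big_ord_recr/= mulrDr IH (exprS r n.+1); ring.
  rewrite -[leRHS]mul1r ler_pdivlMr ?subr_gt0// mulrC h; have := rk N.+1; lra.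
have Vle c : 0 <= c -> V c <= expR (c * e) * Q + jump_tail mu c e / (1 - r).
  move=> c0; apply: (@le_trans _ _ (\sum_(k < N) (expR (c * e) * (r ^+ k.+1 * q k) +
      jump_tail mu c e * r ^+ k.+1))).
    apply: ler_sum => k _; apply: le_trans (ler_wpM2l (rk _) (v_le k c0 e0)) _.
    rewrite (_ : _ * (_ + _) = expR (c * e) * (r ^+ k.+1 * q k) +
      (jump_tail mu c e * r ^+ k.+1) * p k); last by ring.
    by rewrite lerD2l ler_piMr// mulr_ge0 ?jump_tail_ge0.
  rewrite big_split/= -!mulr_sumr lerD2l.
  by rewrite ler_wpM2l ?jump_tail_ge0.
(* The passage sum is U moved on by one step plus the exit events, which carry weight 1 because of
   the maximum with 0. The difference is -u(0) + r^N u(N) + Q, with all three quantities in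
   [0, 1]. *)
have US : `|passage_sum r b N - U b| <= 2.
  pose t k := \int[P]_w (expR (- b * Num.max 0 (x + walk xi k.+1 w)) * \1_(alive x k) w).
  have tE k : t k = u b k.+1 + q k.
    rewrite /t /q -(Rintegral_indic P)// -RintegralD//; [|exact: ui|]; last first.
      exact: integrable_indicR.
    apply: eq_Rintegral => w _; rewrite -/(A k) (indicS k) [LHS]mulrDr; congr (_ + _).
      rewrite !indicE; case: (boolP (_ \in _)); last by rewrite !mulr0.
      by rewrite inE => Aw; rewrite (max_idPr _)// ltW// Aw.
    rewrite !indicE; case: (boolP (_ \in _)); last by rewrite !mulr0.
    rewrite inE => /overshoot/andP[h _]; rewrite (max_idPl _) ?mulr0 ?expR0 ?mulr1//; lra.
  have -> : passage_sum r b N = U b - expR (- b * x) + r ^+ N * u b N + Q.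
    rewrite /passage_sum /U /Q -u0; elim: (N) => [|n IH].
      by rewrite !big_ord0 expr0; ring.
    rewrite !big_ord_recr/= IH -/(t n) tE; move: (\sum_(_ < _) _) (\sum_(_ < _) _).
    by move=> ? ?; ring.
  have := u_ge0 b N; have := u_le1 N b0; have := rk N; have := rk1 N.
  have := u_ge0 b 0%N; have := u_le1 0 b0; rewrite u0.
  move: Qle1 => /andP[]; rewrite ler_norml => *; nra.
have Tf := tele f f0; rewrite rf subrr mul0r in Tf.
have Tb := tele b b0.
have Vb := Vle b b0; have Vf := Vle f f0; have Vb' := VQ b b0; have Vf' := VQ f f0.
have Nb : 0 <= r ^+ N * u b N <= r ^+ N.
  by rewrite mulr_ge0//= ler_piMr// u_le1.
have Nf : 0 <= r ^+ N * u f N <= r ^+ N.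
  by rewrite mulr_ge0//= ler_piMr// u_le1.
have eb : 1 <= expR (b * e) by rewrite -expR0 ler_expR mulr_ge0.
have ef : 1 <= expR (f * e) by rewrite -expR0 ler_expR mulr_ge0.
have jb : 0 <= jump_tail mu b e / (1 - r) by rewrite divr_ge0 ?jump_tail_ge0// subr_ge0 ltW.
have jf : 0 <= jump_tail mu f e / (1 - r) by rewrite divr_ge0 ?jump_tail_ge0// subr_ge0 ltW.
have VB c j : 1 <= expR (c * e) -> V c <= expR (c * e) * Q + j ->
    V c - Q <= expR (c * e) - 1 + j.
  move=> c1 h; rewrite lerBlDr addrAC (le_trans h)// lerD2r -lerBlDr.
  rewrite -[X in _ - X]mul1r -mulrBl ler_piMr ?subr_ge0//.
  by case/andP: Qle1.
have eb0 : 0 <= expR (b * e) - 1 by rewrite subr_ge0.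
have ef0 : 0 <= expR (f * e) - 1 by rewrite subr_ge0.
exact: (passage_arith Tb US Tf Nb Nf Vb' Vf' (VB _ _ eb Vb) (VB _ _ ef Vf) eb0 ef0 jb jf).
Qed.

End first_passage.

(** * Dyadic skeletons of a spectrally positive Levy process *)

Section dyadic_grid.
Context {R : realType} {d : measure_display} {Omega : measurableType d}
  {P : probability Omega R} (X : R -> {RV P >-> R}).
Hypothesis levyX : levy_process X.

Definition mesh n : R := (2 ^+ n)^-1.
Definition dyad n k : R := k%:R * mesh n.
Definition inc n k : Omega -> R := increment X (dyad n k) (dyad n k.+1).
Definition step_law n : probability R R := distribution P (X (mesh n)).

Lemma mesh_gt0 n : 0 < mesh n. Proof. by rewrite invr_gt0 exprn_gt0. Qed.

Lemma meshM n m : mesh (n + m) * 2 ^+ m = mesh n.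
Proof. by rewrite /mesh exprD invfM -mulrA mulVf ?mulr1// expf_neq0. Qed.

Lemma dyad_ge0 n k : 0 <= dyad n k.
Proof. by rewrite mulr_ge0// ltW// mesh_gt0. Qed.

Lemma dyadS n k : dyad n k.+1 = dyad n k + mesh n.
Proof. by rewrite /dyad -natr1 mulrDl mul1r. Qed.

Lemma dyad0 n : dyad n 0 = 0. Proof. by rewrite /dyad mul0r. Qed.

Lemma dyad_refine n m k : dyad (n + m) (k * 2 ^ m) = dyad n k.
Proof. by rewrite /dyad natrM natrX -mulrA [X in _ * X]mulrC meshM. Qed.

Lemma mesh_cvg0 : mesh n @[n --> \oo] --> (0 : R).
Proof.
rewrite /mesh (_ : (fun n => _) = (fun n => (2^-1 : R) ^+ n)); last first.
  by apply/funext => n; rewrite exprVn.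
by apply: cvg_expr; rewrite ger0_norm// invf_lt1// ltr1n.
Qed.

Lemma measurable_X t : measurable_fun setT (X t : Omega -> R).
Proof. exact: measurable_funPT. Qed.

Lemma measurable_increment s t : measurable_fun setT (increment X s t).
Proof. by apply: measurable_funB; exact: measurable_X. Qed.

Lemma measurable_inc n i : measurable_fun setT (inc n i).
Proof. exact: measurable_increment. Qed.

Lemma increment_law s h (A : set R) : 0 <= s -> 0 <= h -> measurable A ->
  P (increment X s (s + h) @^-1` A) = P (X h @^-1` A).
Proof. by case: levyX => _ _ st _; exact: st. Qed.

Lemma inc_ind n N (A : nat -> set R) : (forall i, measurable (A i)) ->
  P (\bigcap_(i in [set i : nat | (i < N)%N]) (inc n i @^-1` A i)) =
  (\prod_(i < N) step_law n (A i))%E.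
Proof.
move=> mA; have [_ indX _ _] := levyX.
rewrite /inc (indX N (dyad n) A)//; last 2 first.
- by rewrite dyad0.
- by move=> i j ij; rewrite ler_wpM2r ?ler_nat// ltW// mesh_gt0.
apply: eq_bigr => i _; rewrite dyadS increment_law ?dyad_ge0//.
by rewrite ltW// mesh_gt0.
Qed.

Lemma walk_inc n k w : walk (inc n) k w = X (dyad n k) w - X 0 w.
Proof.
elim: k => [|k IH]; first by rewrite walk0 dyad0 subrr.
by rewrite walkS IH /inc /increment; ring.
Qed.

Lemma right_cvg w t : 0 <= t -> X s w @[s --> t^'+] --> X t w.
Proof. by case: levyX => _ _ _ /(_ w) [+ _]; apply. Qed.

(** All finer grids are included, so that one event bounds the walks of every level m >= n on
    [0, mesh n], uniformly in m. *)
Definition dips n : set Omega :=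
  [set w | exists m j, [/\ (n <= m)%N, (j <= 2 ^ (m - n))%N &
                           X (dyad m j) w - X 0 w < - 1]].

Lemma measurable_lt (f : Omega -> R) a : measurable_fun setT f ->
  measurable [set w | f w < a].
Proof.
move=> mf; rewrite -[X in measurable X]setTI.
rewrite (_ : [set w | f w < a] = f @^-1` `]-oo, a[%classic); first exact: mf.
by apply/seteqP; split => z /=; rewrite in_itv.
Qed.

Lemma measurable_dips n : measurable (dips n).
Proof.
rewrite (_ : dips n = \bigcup_m \bigcup_(j in [set j | (n <= m)%N /\ (j <= 2 ^ (m - n))%N])
    [set w | increment X 0 (dyad m j) w < - 1]).
  apply: bigcupT_measurable => m; apply: bigcup_measurable => j _.
  by apply: measurable_lt; exact: measurable_increment.
apply/seteqP; split => w.
  by move=> [m [j [nm jm h]]]; exists m => //; exists j.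
by move=> [m _ [j [nm jm] h]]; exists m, j.
Qed.

Lemma dyad_le_mesh n m j : (n <= m)%N -> (j <= 2 ^ (m - n))%N -> dyad m j <= mesh n.
Proof.
move=> nm jm; rewrite -(meshM n (m - n)) subnKC// /dyad mulrC ler_wpM2l//.
  by rewrite ltW// mesh_gt0.
by rewrite -natrX ler_nat.
Qed.

Lemma right_delta w t e : 0 <= t -> 0 < e ->
  exists2 dl, 0 < dl & forall s, t <= s -> s < t + dl -> `|X t w - X s w| < e.
Proof.
move=> t0 e0; have /cvgrPdist_lt/(_ e e0) := right_cvg (w := w) t0.
move=> [/= dl dl0 H]; exists dl => // s ts sd.
have [->|st] := eqVneq s t; first by rewrite subrr normr0.
apply: H => /=; last by rewrite lt_neqAle eq_sym st.
by rewrite ltr0_norm; lra.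
Qed.

Lemma dips_cvg w : \forall n \near \oo, ~ dips n w.
Proof.
have [dl dl0 H] := right_delta w (lexx 0) (ltr01 : 0 < 1 :> R).
have : \forall n \near \oo, mesh n < dl.
  by apply: (cvgr_lt _ mesh_cvg0).
apply: filterS => n hn [m [j [nm jm]]].
have := H (dyad m j) (dyad_ge0 _ _); rewrite add0r (le_lt_trans (dyad_le_mesh nm jm) hn).
by move=> /(_ isT); rewrite ltr_norml; lra.
Qed.

Lemma prob_cvg0 (E : nat -> set Omega) : (forall n, measurable (E n)) ->
  (forall w, \forall n \near \oo, ~ E n w) ->
  fine (P (E n)) @[n --> \oo] --> (0 : R).
Proof.
move=> mE cE.
rewrite (_ : (fun n => _) = (fun n => \int[P]_w (\1_(E n) w : R))); last first.
  by apply/funext => n; rewrite Rintegral_indic.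
rewrite -[X in _ --> X](Rintegral_cst_prob P).
apply: (@Rintegral_bct _ _ _ _ _ _ 1) => //.
- by move=> n; exact: measurable_indic.
- move=> w; apply: cvg_near_cst; have := cE w; apply: filterS => n nE.
  by rewrite indicE memNset.
- by move=> n w; rewrite indicE; case: (_ \in _); rewrite ?normr0 ?normr1.
Qed.

Definition drops n e : set Omega := [set w | exists2 k, (k < 2 ^ n)%N & inc n k w < - e].

Lemma measurable_drops n e : measurable (drops n e).
Proof.
rewrite (_ : drops n e = \bigcup_(k in [set k | (k < 2 ^ n)%N]) [set w | inc n k w < - e]).
  by apply: bigcup_measurable => k _; apply: measurable_lt; exact: measurable_inc.
by apply/seteqP; split => w [k kn h]; exists k.
Qed.

Hypothesis posX : spectrally_positive X.

(** On either side of t the path is close to its one-sided limit, and crossing t can only push it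
    up, since the left limit is at most [X t w]. *)
Lemma local_drops w t e : no_negative_jumps (fun s => X s w) -> 0 <= t -> 0 < e ->
  exists2 dl, 0 < dl & forall s s', 0 <= s -> s <= s' ->
    t - dl < s -> s' < t + dl -> - e <= X s' w - X s w.
Proof.
move=> njw t0 e0; have e20 : 0 < e / 2 by rewrite divr_gt0.
have [d1 d10 H1] := right_delta w t0 e20.
have [d2 d20 H2] : exists2 dl, 0 < dl & forall s, 0 <= s -> t - dl < s -> s < t ->
    X s w <= X t w + e / 2 /\ forall s', 0 <= s' -> t - dl < s' -> s' < t ->
    `|X s w - X s' w| < e.
  have [->|tn0] := eqVneq t 0; first by exists 1 => // s; lra.
  have tp : 0 < t by rewrite lt_neqAle eq_sym tn0.
  have [_ _ _ /(_ w) [_ /(_ t tp) cl]] := levyX.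
  have /cvgrPdist_lt/(_ _ e20) [/= d2 d20 H2] := cl.
  have ll := njw t tp.
  exists d2 => // s s0 sd st.
  have hs : `|lim (X s w @[s --> t^'-]) - X s w| < e / 2.
    by apply: H2 => //=; rewrite gtr0_norm; lra.
  split; first by move: hs; rewrite ltr_norml; lra.
  move=> s' _ sd' st'.
  have hs' : `|lim (X s w @[s --> t^'-]) - X s' w| < e / 2.
    by apply: H2 => //=; rewrite gtr0_norm; lra.
  rewrite distrC (_ : _ - _ = (lim (X s w @[s --> t^'-]) - X s w) - (lim (X s w @[s --> t^'-]) - X s' w)); last by ring.
  by rewrite (le_lt_trans (ler_normB _ _))//; lra.
exists (Num.min d1 d2); first by rewrite lt_min d10.
move=> s s' s0 ss' sd sd'.
have sd2 : t - d2 < s by apply: le_lt_trans sd; rewrite lerD2l lerN2 ge_min lexx orbT.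
have sd1 : s' < t + d1 by apply: lt_le_trans sd' _; rewrite lerD2l ge_min lexx.
have [ts|st] := leP t s.
  have := H1 s ts (le_lt_trans ss' sd1).
  have := H1 s' (le_trans ts ss') sd1.
  by rewrite !ltr_norml; lra.
have [h1 h2] := H2 s s0 sd2 st.
have [ts'|st'] := leP t s'.
  by have := H1 s' ts' sd1; rewrite ltr_norml; lra.
have := h2 s' (le_trans s0 ss') (lt_le_trans sd2 ss') st'.
by rewrite ltr_norml; lra.
Qed.

(** Otherwise drops of size e occur on arbitrarily fine grids; by compactness their times cluster at
    some z in [0, 1], against [local_drops] at z. *)
Lemma drops_cvg w e : no_negative_jumps (fun s => X s w) -> 0 < e ->
  \forall n \near \oo, ~ drops n e w.
Proof.
move=> njw e0; apply: contrapT => H.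
have H' m : exists n k, [/\ (m <= n)%N, (k < 2 ^ n)%N & inc n k w < - e].
  apply: contrapT => N; apply: H; exists m => // n /= mn [k kn hk].
  by apply: N; exists n, k.
have H2 m : exists p : nat * nat, [/\ (m <= p.1)%N, (p.2 < 2 ^ p.1)%N & inc p.1 p.2 w < - e].
  by have [n [k ?]] := H' m; exists (n, k).
have [nk Hnk] := choice H2.
pose t m := dyad (nk m).1 (nk m).2.
have t01 m : `[0, 1]%classic (t m).
  rewrite /= in_itv/= dyad_ge0/=; have [_ h _] := Hnk m.
  by rewrite /t /dyad ler_pdivrMr ?exprn_gt0// mul1r -natrX ler_nat ltnW.
have cpt := @segment_compact R 0 1.
have tF : (t @ \oo) `[0, 1]%classic by exists 0%N => // m _; exact: t01.
have [z [z01 cz]] := cpt _ _ tF.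
have z0 : 0 <= z by move: z01; rewrite /= in_itv/= => /andP[].
have [dl dl0 Hdl] := local_drops njw z0 e0.
have dl20 : 0 < dl / 2 by rewrite divr_gt0.
have [M _ HM] : \forall n \near \oo, mesh n < dl / 2 by apply: (cvgr_lt _ mesh_cvg0).
have [_ [[m /= Mm <-] tz]] := cz [set t m | m in [set m | (M <= m)%N]] (ball z (dl / 2))
  (ex_intro2 _ _ M I (fun m Mm => ex_intro2 _ _ m Mm erefl)) (nbhsx_ballx _ _ dl20).
have [mn kn hk] := Hnk m.
have hm : mesh (nk m).1 < dl / 2 by apply: HM => /=; exact: leq_trans mn.
have hp := mesh_gt0 (nk m).1.
move: tz; rewrite /ball /= /t ltr_norml => /andP[tz1 tz2].
have := Hdl (dyad (nk m).1 (nk m).2) (dyad (nk m).1 (nk m).2.+1) (dyad_ge0 _ _).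
rewrite dyadS; move: hk; rewrite /inc /increment dyadS => hk.
move=> h.
suff : - e <= X (dyad (nk m).1 (nk m).2 + mesh (nk m).1) w - X (dyad (nk m).1 (nk m).2) w by lra.
by apply: h; lra.
Qed.

Lemma prob_drops_cvg0 e : 0 < e -> fine (P (drops n e)) @[n --> \oo] --> (0 : R).
Proof.
move=> e0; have [N [mN N0 subN]] := posX.
rewrite (_ : (fun n => _) = (fun n => fine (P (drops n e `\` N)))); last first.
  apply/funext => n; congr fine.
  rewrite -[in LHS](setIT (drops n e)) -(setvU N) setIUr measureU//; last 3 first.
  - by apply: measurableI; [exact: measurable_drops|exact: measurableC].
  - by apply: measurableI => //; exact: measurable_drops.
  - by rewrite setIACA setICl setI0.
  rewrite setDE -[RHS]adde0; congr (_ + _)%E.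
  by apply: (subset_measure0 _ mN _ N0) => //; apply: measurableI => //; exact: measurable_drops.
apply: prob_cvg0; first by move=> n; apply: measurableD => //; exact: measurable_drops.
move=> w; have [Nw|Nw] := pselect (N w); first by apply: nearW => n [].
have njw : no_negative_jumps (fun s => X s w) by apply: contrapT => h; apply: Nw; exact: subN.
by have := drops_cvg njw e0; apply: filterS => n nd [].
Qed.

End dyadic_grid.

(** * Finiteness of the exponential moments *)

Section exponential_moments.
Context {R : realType} {d : measure_display} {Omega : measurableType d}
  {P : probability Omega R} (X : R -> {RV P >-> R}).
Hypothesis levyX : levy_process X.
Hypothesis posX : spectrally_positive X.

Let mlt (a : R) : measurable [set y : R | y < a].
Proof.
by rewrite (_ : [set y | y < a] = `]-oo, a[%classic).
Qed.

Lemma step_law_increment n (A : set R) : measurable A ->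
  step_law X n A = P (increment X 0 (mesh n) @^-1` A).
Proof.
move=> mA; have m0 := ltW (@mesh_gt0 R n).
by rewrite -[in RHS](add0r (mesh n)) (increment_law levyX _ m0).
Qed.

Lemma dyad_full n m : (n <= m)%N -> dyad m (2 ^ (m - n)) = mesh n :> R.
Proof. by move=> nm; rewrite /dyad mulrC natrX -(meshM n (m - n)) subnKC. Qed.

(** X at time [mesh n] is read as the endpoint of a walk on a finer grid m. As m grows, the
    probability of a step below -1 vanishes, while the bound by [dips X n] does not change. *)
Lemma step_law_tail n k :
  (step_law X n [set y | (y < - (2 * k%:R))%R] <= P (dips X n) ^+ k)%E.
Proof.
apply/lee_addgt0Pr => e e0.
have [M _ HM] : \forall m \near \oo, fine (P (drops X m 1)) < e.
  exact: (cvgr_lt _ (prob_drops_cvg0 levyX posX ltr01)).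
pose m := maxn M n; have nm : (n <= m)%N by rewrite leq_maxr.
have hm := HM m (leq_maxl _ _).
rewrite step_law_increment//.
have -> : increment X 0 (mesh n) @^-1` [set y | y < - (2 * k%:R)] =
    [set w | walk (inc X m) (2 ^ (m - n)) w < - (2 * k%:R)].
  by apply/seteqP; split => w; rewrite /= walk_inc dyad_full.
apply: le_trans (walk_tail (measurable_inc X m) (inc_ind levyX m) k (lexx _) (lexx _)) _.
apply: leeD.
  elim: k => [|k IH]; first by rewrite !expe0.
  rewrite !expeS; apply: lee_pmul => //; first by rewrite expe_ge0.
  apply: le_measure; rewrite ?inE.
  - rewrite (_ : [set w | _] = \bigcup_(j in [set j | (j <= 2 ^ (m - n))%N])
      [set w | walk (inc X m) j w < - 1]).
      by apply: bigcup_measurable => j _; apply: measurable_lt; exact: measurable_walk (measurable_inc X m) _.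
    by apply/seteqP; split => w [j jn h]; exists j.
  - exact: measurable_dips.
  by move=> w [j jm]; rewrite walk_inc => h; exists m, j.
apply: (@le_trans _ _ (P (drops X m 1))).
  apply: le_measure; rewrite ?inE.
  - rewrite (_ : [set w | _] = \bigcup_(j in [set j | (j < 2 ^ (m - n))%N])
      [set w | inc X m j w < - 1]).
      by apply: bigcup_measurable => j _; apply: measurable_lt; exact: measurable_inc.
    by apply/seteqP; split => w [j jn h]; exists j.
  - exact: measurable_drops.
  move=> w [j jm h]; exists j => //; apply: leq_trans jm _.
  by rewrite leq_exp2l// leq_subr.
rewrite -[leLHS]fineK; last first.
  by apply: fin_num_measure; exact: measurable_drops.
by rewrite lee_fin ltW.
Qed.

Lemma exists_expR_finite (b : R) : 0 <= b ->
  exists n, (\int[step_law X n]_y (expR (- b * y))%:E < +oo)%E.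
Proof.
move=> b0.
(* With q below this constant the layer exp(2 b (k + 2)) q^k is at most exp(4 b) 2^-k, hence
   summable. Such n exists because the probability of [dips] tends to 0. *)
have c0 : 0 < (2 * expR (2 * b))^-1 by rewrite invr_gt0 mulr_gt0// expR_gt0.
have [n _ /(_ n (leqnn _)) /= hn] : \forall n \near \oo, fine (P (dips X n)) < (2 * expR (2 * b))^-1.
  apply: (cvgr_lt _ (prob_cvg0 _ _)) => //.
    by move=> n; exact: measurable_dips.
  by move=> w; exact: dips_cvg.
exists n; set mu := step_law X n.
set q := fine (P (dips X n)) in hn.
have qE : P (dips X n) = q%:E.
  by rewrite /q fineK//; apply: fin_num_measure; exact: measurable_dips.
have q0 : 0 <= q by rewrite fine_ge0.
pose f k (y : R) : \bar R := (expR (2 * b * (k + 2)%:R) * \1_[set y | y < - (2 * k%:R)] y)%:E.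
have mf k : measurable_fun setT (f k).
  by apply/measurable_EFinP; apply: measurable_funM => //; exact: measurable_indic.
have f0 k y : (0 <= f k y)%E by rewrite lee_fin mulr_ge0 ?expR_ge0.
apply: (@le_lt_trans _ _ (\int[mu]_y (1 + \sum_(k <oo) f k y))%E).
  apply: ge0_le_integral => //.
  - exact: measurable_EFin_expRM.
  - apply: emeasurable_funD => //; exact: ge0_emeasurable_sum.
  move=> y _; have [y0|y0] := leP 0 y.
    rewrite -[leLHS]adde0 leeD ?nneseries_ge0// lee_fin -expR0 ler_expR.
    by rewrite mulNr oppr_le0 mulr_ge0.
  rewrite -[leLHS]add0e leeD//.
  pose K := Num.truncn (- y / 2).
  have [K1 K2] : (K%:R <= - y / 2) /\ - y / 2 < K.+1%:R.
    have := @truncn_itv R (- y / 2); rewrite divr_ge0 ?oppr_ge0 ?(ltW y0)// => /(_ isT).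
    by move=> /andP[].
  (* The predecessor is taken because y may equal -2K while the layers are defined by a strict
     inequality; for K = 0 the layer 0 serves, as y < 0. The shift by 2 in the exponent of f makes
     up for the loss. *)
  have hK : y < - (2 * K.-1%:R) /\ - y <= 2 * (K.-1 + 2)%:R.
    case: K K1 K2 => [|K] /= K1 K2; first by rewrite mulr0 oppr0; split => //; lra.
    have e1 : K.+1%:R = K%:R + 1 :> R by rewrite -natr1.
    have e2 : K.+2%:R = K%:R + 2 :> R by rewrite -natr1 e1 -addrA.
    rewrite addn2; rewrite e1 in K1; rewrite e2 in K2 *.
    by split; lra.
  have [h1 h2] := hK.
  apply: (@le_trans _ _ (f K.-1 y)).
    rewrite lee_fin indicE mem_set//= mulr1 ler_expR; nra.
  by rewrite (nneseriesD1 (n := K.-1))// leeDl// nneseries_ge0.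
rewrite ge0_integralD//; last 2 first.
- by move=> y _; exact: nneseries_ge0.
- exact: ge0_emeasurable_sum.
rewrite integral_prob_cst integral_nneseries//.
apply: lte_add_pinfty; first exact: ltry.
apply: (@le_lt_trans _ _ (expR (4 * b) * 2)%:E); last exact: ltry.
apply: lime_le; first by apply: is_cvg_nneseries => k _ _; exact: integral_ge0.
apply: nearW => N; rewrite big_mkord.
apply: (@le_trans _ _ (\sum_(k < N) (expR (4 * b) * (2^-1) ^+ k)%:E)%E).
  apply: lee_sum => k _; rewrite /f.
  under eq_integral do rewrite EFinM.
  rewrite ge0_integralZl//; last first.
    by apply/measurable_EFinP; exact: measurable_indic.
  rewrite integral_indic// setIT.
  apply: le_trans (lee_wpmul2l _ (step_law_tail n k)) _; first by rewrite lee_fin expR_ge0.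
  rewrite qE -EFin_expe -EFinM lee_fin.
  rewrite (_ : expR _ = expR (4 * b) * expR (2 * b) ^+ k); last first.
    by rewrite -expRM_natr -expRD natrD; congr expR; ring.
  rewrite -mulrA ler_wpM2l ?expR_ge0// -exprMn.
  rewrite lerXn2r ?nnegrE ?mulr_ge0 ?expR_ge0//.
  by rewrite mulrC -ler_pdivlMr ?expR_gt0// -invfM ltW.
rewrite sumEFin lee_fin -mulr_sumr ler_wpM2l ?expR_ge0//.
have h : \sum_(k < N) (2^-1 : R) ^+ k = 2 - 2 * 2^-1 ^+ N.
  elim: (N) => [|j IH]; first by rewrite big_ord0; lra.
  by rewrite big_ord_recr/= IH exprS; lra.
by rewrite h lerBlDr lerDl mulr_ge0// exprn_ge0.
Qed.

(** The 2^n steps of level n and the single step of level 0 have the same sum. As an identity of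
    extended reals it carries finiteness from one level n to X(1), and from there back to every
    level. *)
Lemma expR_law_pow n (b : R) :
  ((\int[step_law X n]_y (expR (- b * y))%:E) ^+ (2 ^ n) =
   \int[P]_w (expR (- b * X 1 w))%:E)%E.
Proof.
rewrite -(expR_walk (measurable_inc X n) (inc_ind levyX n) b).
have m1 : mesh 0 = 1 :> R by rewrite /mesh expr0 invr1.
have h : (\int[step_law X 0]_y (expR (- b * y))%:E = \int[P]_w (expR (- b * X 1 w))%:E)%E.
  rewrite (ge0_integral_distribution _ (measurable_EFin_expRM (- b))) ?m1//.
rewrite -h; transitivity (\int[P]_w (expR (- b * walk (inc X 0) 1 w))%:E)%E; last first.
  exact: (expR_walk (measurable_inc X 0) (inc_ind levyX 0) b 1).
have d1 : dyad 0 1 = 1 :> R by rewrite /dyad m1 mulr1.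
have dn : dyad n (2 ^ n) = 1 :> R by rewrite /dyad natrX mulfV// expf_neq0.
by apply: eq_integral => w _; rewrite !walk_inc d1 dn.
Qed.

Lemma expR_X1_finite (b : R) : 0 <= b -> (\int[P]_w (expR (- b * X 1 w))%:E < +oo)%E.
Proof.
move=> b0; have [n hn] := exists_expR_finite b0.
rewrite -(expR_law_pow n) -[X in (X ^+ _)%E]fineK.
  by rewrite -EFin_expe ltry.
by rewrite ge0_fin_numE//; apply: integral_ge0 => y _; rewrite lee_fin expR_ge0.
Qed.

Lemma step_mgf n (b : R) : 0 <= b ->
  (step_law X n).-integrable setT (fun y => (expR (- b * y))%:E).
Proof.
move=> b0; apply/integrableP; split; first exact: measurable_EFin_expRM.
under eq_integral do rewrite /= ger0_norm ?expR_ge0//.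
rewrite ltNge leye_eq; apply/negP => /eqP h.
have := expR_X1_finite b0; rewrite -(expR_law_pow n) h.
have : forall k, ((+oo : \bar R) ^+ k.+1 = +oo)%E.
  by elim=> [|k IH]; rewrite ?expe1// expeS IH mulyy.
have : (0 < 2 ^ n)%N by rewrite expn_gt0.
by case: (2 ^ n)%N => // k _ ->; rewrite ltxx.
Qed.

Local Notation psi := (dual_exponent X).

Lemma laplace_gt0 n (b : R) : 0 <= b -> 0 < laplace (step_law X n) b.
Proof.
move=> b0; rewrite lt_neqAle Rintegral_ge0 ?andbT => [|y _]; last exact: expR_ge0.
apply/negP => /eqP h.
have h0 : (\int[step_law X n]_y `|(expR (- b * y))%:E| = 0)%E.
  under eq_integral do rewrite /= ger0_norm ?expR_ge0//.
  by rewrite Rintegral_EFin ?(step_mgf n b0)// /laplace in h *; rewrite -h.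
have me : measurable_fun setT (fun y : R => (expR (- b * y))%:E).
  exact: measurable_EFin_expRM.
have /(ae_eq_integral_abs _ measurableT me) [N [mN N0 subN]] := h0.
have : step_law X n setT = 0%E.
  apply: (subset_measure0 _ mN _ N0) => // y _; apply: subN => /= /(_ I) /eqP.
  by rewrite eqe gt_eqF// expR_gt0.
by move=> /eqP; rewrite [step_law X n setT]probability_setT onee_eq0.
Qed.

Lemma laplaceE n (b : R) : 0 <= b ->
  laplace (step_law X n) b = expR (mesh n * psi b).
Proof.
move=> b0.
have L n' : (\int[step_law X n']_y (expR (- b * y))%:E = (laplace (step_law X n') b)%:E)%E.
  by rewrite Rintegral_EFin//; exact: step_mgf.
have h : psi b = ln (laplace (step_law X n) b ^+ (2 ^ n)).
  by rewrite /dual_exponent unlock -(expR_law_pow n) L -EFin_expe.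
have l0 := laplace_gt0 n b0.
rewrite h lnXn// -mulr_natr mulrCA natrX /mesh mulVf ?expf_neq0// mulr1.
by rewrite lnK.
Qed.

Lemma psi0 : psi 0 = 0.
Proof.
rewrite /dual_exponent unlock; under eq_integral do rewrite oppr0 mul0r expR0.
by rewrite integral_prob_cst /= ln1.
Qed.

End exponential_moments.

(** * Large downward steps are negligible *)

Section jump_estimates.
Context {R : realType} {d : measure_display} {Omega : measurableType d}
  {P : probability Omega R} (X : R -> {RV P >-> R}).
Hypothesis levyX : levy_process X.
Hypothesis posX : spectrally_positive X.
Local Notation psi := (dual_exponent X).

Lemma meshV n : (mesh n)^-1 = 2 ^+ n :> R.
Proof. by rewrite /mesh invrK. Qed.

Lemma expR_slope_cvg (u : R) : 2 ^+ n * (expR (mesh n * u) - 1) @[n --> \oo] --> u.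
Proof.
apply: (@squeeze_cvgr _ _ _ _ (cst u) (fun n => u * expR (mesh n * u))).
- apply: nearW => n /=; have m0 := @mesh_gt0 R n.
  have := expR_ge1Dx (mesh n * u); have := expRB1_le (mesh n * u).
  rewrite -!meshV; move: (mesh n) m0 => h h0 h1 h2.
  rewrite ![h^-1 * _]mulrC ler_pdivlMr// ler_pdivrMr//.
  by apply/andP; split; lra.
- exact: cvg_cst.
- rewrite -[X in _ --> X]mulr1 -expR0 -(mul0r u); apply: cvgMr.
  apply: (cvg_comp _ expR _ (@continuous_expR R _)).
  by apply: cvgMl; exact: mesh_cvg0.
Qed.

Lemma laplace_slope_cvg (b : R) : 0 <= b ->
  2 ^+ n * (laplace (step_law X n) b - 1) @[n --> \oo] --> psi b.
Proof.
move=> b0; have := @expR_slope_cvg (psi b); apply: cvg_trans; apply: near_eq_cvg.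
by apply: nearW => n; rewrite laplaceE.
Qed.

Let mlt (a : R) : measurable [set y : R | y < a].
Proof. by rewrite (_ : [set y | y < a] = `]-oo, a[%classic). Qed.

Let prob_lt n (a : R) := fine (step_law X n [set y | y < a]).

(** By independence the probability 1 - D of no drop is (1 - p)^(2^n) <= exp(-2^n p) <= 1 / (1 + 2^n
    p). Hence 2^n p <= D / (1 - D), which is at most 2 D once D < 1/2. *)
Lemma drop_rate (e : R) : 0 < e -> 2 ^+ n * prob_lt n (- e) @[n --> \oo] --> (0 : R).
Proof.
move=> e0; have D0 := prob_drops_cvg0 levyX posX e0.
apply: (@squeeze_cvgr _ _ _ _ (cst 0) (fun n => 2 * fine (P (drops X n e)))).
- have : \forall n \near \oo, fine (P (drops X n e)) < 2^-1.
    by apply: (cvgr_lt _ D0); rewrite invr_gt0.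
  apply: filterS => n hn.
  set p := prob_lt n (- e); set D := fine _ in hn *.
  have p0 : 0 <= p by rewrite fine_ge0.
  have pE : step_law X n [set y | y < - e] = p%:E by rewrite fineK ?fin_num_measure.
  have p1 : p <= 1 by rewrite -lee_fin -pE; exact: probability_le1.
  have DE : 1 - D = (1 - p) ^+ (2 ^ n).
    have mC : measurable (~` [set y : R | y < - e]) by exact: measurableC.
    have := inc_ind levyX n (2 ^ n) (fun=> mC).
    rewrite (_ : \bigcap_(_ in _) _ = ~` drops X n e); last first.
      apply/seteqP; split => w.
        by move=> H [k kn hk]; exact: (H k kn).
      by move=> H k kn hk; apply: H; exists k.
    have mD := measurable_drops X n e.
    rewrite probability_setC// -[P _]fineK ?fin_num_measure// -/D.
    under eq_bigr do rewrite probability_setC// pE -EFinB.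
    rewrite -EFinB prodEFin => -[->].
    by rewrite prodr_const card_ord.
  have : (1 - D) * (1 + 2 ^+ n * p) <= 1.
    rewrite DE; apply: (@le_trans _ _ (expR (- p * (2 ^ n)%:R) * expR (2 ^+ n * p))).
      apply: ler_pM; rewrite ?exprn_ge0 ?subr_ge0//; last exact: expR_ge1Dx.
        by rewrite addr_ge0// mulr_ge0// exprn_ge0.
      by rewrite expRM_natr lerXn2r ?nnegrE ?subr_ge0 ?expR_ge0// expR_ge1Dx.
    by rewrite natrX -expRD (_ : _ + _ = 0) ?expR0//; ring.
  have Np0 : 0 <= 2 ^+ n * p by rewrite mulr_ge0// exprn_ge0.
  have D00 : 0 <= D by rewrite fine_ge0.
  by rewrite /= => h; apply/andP; split => //; nra.
- exact: cvg_cst.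
- by rewrite -[X in _ --> X](mulr0 2); exact: cvgMr.
Qed.

(** The second difference of the transform is the mean of exp(-c y) (exp(-y) - 1)^2, and the square
    is at least e^2 when y < -e. The constant terms 1 cancel in the second difference, so it is of
    order 2^-n. *)
Lemma laplace_square n (c e : R) : 0 <= c -> 0 <= e ->
  e ^+ 2 * jump_tail (step_law X n) c e + 2 * laplace (step_law X n) (c + 1) <=
  laplace (step_law X n) c + laplace (step_law X n) (c + 2).
Proof.
move=> c0 e0; set mu := step_law X n.
have I b : 0 <= b -> mu.-integrable setT (fun y => (expR (- b * y))%:E) by exact: step_mgf.
have Ic := I c c0.
have I1 := I (c + 1) (addr_ge0 c0 ler01).
have I2 := I (c + 2) (addr_ge0 c0 (ler0n _ 2)).
have J := jump_tail_integrable I c0 e0.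
rewrite /jump_tail /laplace -!RintegralZl// -!RintegralD//; last 2 first.
- exact: integrable_EFinZl J.
- exact: integrable_EFinZl I1.
apply: le_Rintegral => //.
- by apply: integrable_EFinD; exact: integrable_EFinZl.
- exact: integrable_EFinD.
move=> y _.
rewrite (_ : expR (- (c + 1) * y) = expR (- c * y) * expR (- y)); last first.
  by rewrite -expRD; congr expR; ring.
rewrite (_ : expR (- (c + 2) * y) = expR (- c * y) * expR (- y) ^+ 2); last first.
  by rewrite -expRM_natr -expRD; congr expR; ring.
have E0 := expR_ge0 (- c * y).
have sq : 0 <= expR (- c * y) * (expR (- y) - 1) ^+ 2 by rewrite mulr_ge0// sqr_ge0.
rewrite indicE; case: (boolP (_ \in _)) => [|_]; last by rewrite !mulr0 add0r; nra.
rewrite inE /= => ey; rewrite mulr1 (max_idPr _); last by lra.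
rewrite mulrN -mulNr.
have : e ^+ 2 <= (expR (- y) - 1) ^+ 2.
  by rewrite lerXn2r ?nnegrE//; have := expR_ge1Dx (- y); lra.
move=> /(ler_wpM2l E0); lra.
Qed.

(* AM-GM: [E^b <= lam * E^(2b) + 1 / lam] on the event of a large drop *)
Lemma jump_tail_le n (b e lam : R) : 0 <= b -> 0 < e -> 0 < lam ->
  jump_tail (step_law X n) b e <=
  lam * jump_tail (step_law X n) (2 * b) e + lam^-1 * prob_lt n (- e).
Proof.
move=> b0 e0 l0; set mu := step_law X n.
have I c : 0 <= c -> mu.-integrable setT (fun y => (expR (- c * y))%:E) by exact: step_mgf.
have b20 : 0 <= 2 * b by rewrite mulr_ge0.
have J := jump_tail_integrable I b0 (ltW e0).
have J2 := jump_tail_integrable I b20 (ltW e0).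
rewrite /prob_lt -(Rintegral_indic _ (mlt (- e))) /jump_tail -!RintegralZl//; last first.
  exact: integrable_indicR.
have I1 := integrable_EFinZl lam^-1 (integrable_indicR mu (mlt (- e))).
rewrite -!RintegralD//; last exact: integrable_EFinZl J2.
apply: le_Rintegral => //.
  by apply: integrable_EFinD => //; exact: integrable_EFinZl J2.
move=> y _; rewrite !indicE.
rewrite (_ : (y \in [set y | y < - e]) = (y \in [set y | e < - y])); last first.
  by apply/idP/idP; rewrite !inE /=; lra.
case: (_ \in _); last by rewrite !mulr0 addr0.
rewrite !mulr1 -(mulrA 2) mulrC (mulrC 2) expRM_natr.
move: (Num.max 0 (- y)) => z.
rewrite mulrC; set a := expR _.
rewrite -subr_ge0 (_ : _ - _ = lam * (a - 2^-1 / lam) ^+ 2 + 3 / 4 / lam); last first.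
  by field; rewrite gt_eqF.
apply: addr_ge0; first by apply: mulr_ge0; [exact: ltW|exact: sqr_ge0].
by rewrite divr_ge0// ltW.
Qed.

(** In [jump_tail_le] the first term, scaled by 2^n, is at most lam times a convergent second
    difference; lam is fixed small first, and then the second term vanishes by [drop_rate]. *)
Lemma jump_tail_cvg0 (b e : R) : 0 <= b -> 0 < e ->
  2 ^+ n * jump_tail (step_law X n) b e @[n --> \oo] --> (0 : R).
Proof.
move=> b0 e0; apply/cvgrPdist_lt => eta eta0.
pose c := 2 * b; have c0 : 0 <= c by rewrite mulr_ge0.
pose L n s := laplace (step_law X n) s.
pose a n := 2 ^+ n * (L n c - 1) + 2 ^+ n * (L n (c + 2) - 1) - 2 * (2 ^+ n * (L n (c + 1) - 1)).
pose D := psi c + psi (c + 2) - 2 * psi (c + 1).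
have aD : a n @[n --> \oo] --> D.
  apply: cvgB; first apply: cvgD.
  - exact: laplace_slope_cvg.
  - by apply: laplace_slope_cvg; rewrite addr_ge0.
  - by apply: cvgMr; apply: laplace_slope_cvg; rewrite addr_ge0.
(* Makes lam D / e^2 at most eta / 2; the summand 1 covers D = 0. *)
pose lam := eta / (2 * (`|D| / e ^+ 2 + 1)).
have De0 : 0 <= `|D| / e ^+ 2 by rewrite divr_ge0// exprn_ge0// ltW.
have l0 : 0 < lam by rewrite divr_gt0// mulr_gt0// ltr_wpDl.
have lD : lam * (D / e ^+ 2) < eta.
  apply: (@le_lt_trans _ _ (lam * (`|D| / e ^+ 2 + 1))); last first.
    rewrite /lam invfM mulrA -mulrA mulVf ?mulr1; last by rewrite gt_eqF// ltr_wpDl.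
    lra.
  rewrite ler_wpM2l ?(ltW l0)// ler_wpDr// ler_wpM2r ?ler_norm//.
  by rewrite invr_ge0 exprn_ge0// ltW.
have cv : lam * (a n / e ^+ 2) + lam^-1 * (2 ^+ n * prob_lt n (- e)) @[n --> \oo]
    --> lam * (D / e ^+ 2) + lam^-1 * 0.
  apply: cvgD; first by apply: cvgMr; apply: cvgMl.
  by apply: cvgMr; exact: drop_rate.
rewrite mulr0 addr0 in cv.
have : \forall n \near \oo, lam * (a n / e ^+ 2) + lam^-1 * (2 ^+ n * prob_lt n (- e)) < eta.
  exact: (cvgr_lt _ cv _ lD).
apply: filterS => n hn.
rewrite sub0r normrN ger0_norm ?mulr_ge0 ?exprn_ge0 ?jump_tail_ge0//.
apply: le_lt_trans hn.
have n0 : 0 <= 2 ^+ n :> R by rewrite exprn_ge0.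
apply: le_trans (ler_wpM2l n0 (jump_tail_le n b0 e0 l0)) _.
rewrite mulrDr mulrCA (mulrCA _ lam^-1) lerD2r ler_wpM2l ?(ltW l0)//.
rewrite ler_pdivlMr ?exprn_gt0// -mulrA -(mulrC (e ^+ 2)).
have := laplace_square n c0 (ltW e0) => /(ler_wpM2l n0).
rewrite /a /L; lra.
Qed.

End jump_estimates.

Lemma Rintegral_ae_eq {R : realType} {d} {T : measurableType d} (P : probability T R)
    (f g : T -> R) : measurable_fun setT f -> measurable_fun setT g ->
  {ae P, forall w, f w = g w} -> \int[P]_w f w = \int[P]_w g w.
Proof.
move=> mf mg fg; congr fine; apply: ae_eq_integral => //.
- exact/measurable_EFinP.
- exact/measurable_EFinP.
by apply: filterS fg => w fgw _; rewrite fgw.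
Qed.

Lemma cvgn_ge {R : realType} (u : nat -> R) (l c : R) :
  u @ \oo --> l -> (forall n, c <= u n) -> c <= l.
Proof.
move=> ul cu; rewrite -(cvg_lim _ ul)//; apply: limr_ge; last exact: nearW.
by apply/cvg_ex; exists l.
Qed.

(** * The law of the supremum *)

Definition level {R : realType} n (t : R) : nat := Num.truncn (t * 2 ^+ n).

Section pollaczek_khinchine_limit.
Context {R : realType} {d : measure_display} {Omega : measurableType d}
  {P : probability Omega R} (X : R -> {RV P >-> R}).
Hypothesis levyX : levy_process X.
Hypothesis posX : spectrally_positive X.
Local Notation psi := (dual_exponent X).

(** Strictly to the right of t, even for dyadic t, so that the approach to t is one from the
    right. *)
Definition next_dyad n (t : R) : R := dyad n (level n t).+1.

Lemma next_dyad_gt n t : 0 <= t -> t < next_dyad n t.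
Proof.
move=> t0; rewrite /next_dyad /level /dyad /mesh ltr_pdivlMr ?exprn_gt0//.
by have /andP[] := truncn_itv (mulr_ge0 t0 (exprn_ge0 n (ler0n R 2))).
Qed.

Lemma next_dyad_le n t : 0 <= t -> next_dyad n t <= t + mesh n.
Proof.
move=> t0; rewrite /next_dyad dyadS lerD2r /dyad /mesh ler_pdivrMr ?exprn_gt0//.
by have /andP[] := truncn_itv (mulr_ge0 t0 (exprn_ge0 n (ler0n R 2))).
Qed.

Lemma next_dyad_cvg t : 0 <= t -> next_dyad n t @[n --> \oo] --> t.
Proof.
move=> t0; apply: (@squeeze_cvgr _ _ _ _ (cst t) (fun n => t + mesh n)).
- by apply: nearW => n; rewrite /= ltW ?next_dyad_gt// next_dyad_le.
- exact: cvg_cst.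
- by rewrite -[X in _ --> X]addr0; apply: cvgD; [exact: cvg_cst|exact: mesh_cvg0].
Qed.

Lemma X_next_dyad_cvg w t : 0 <= t -> X (next_dyad n t) w @[n --> \oo] --> X t w.
Proof.
move=> t0; have /cvg_at_rightP := right_cvg levyX (w := w) t0; apply.
by split; [move=> n; exact: next_dyad_gt|exact: next_dyad_cvg].
Qed.

(* 4 ^ n steps of length 2 ^ -n cover the time interval [0, 2 ^ n]. *)
Definition gridmax n (w : Omega) : R := future_max (inc X n) (4 ^ n) 0 w.

Lemma measurable_gridmax n : measurable_fun setT (gridmax n).
Proof. exact: (measurable_future_max (measurable_inc X n)). Qed.

Lemma gridmax_ge n j w : (j <= 4 ^ n)%N -> X (dyad n j) w - X 0 w <= gridmax n w.
Proof. by move=> jn; rewrite -walk_inc; exact: walk_le_max. Qed.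

Lemma gridmax_gt w t a : 0 <= t -> a < X t w -> \forall n \near \oo, a < gridmax n w + X 0 w.
Proof.
move=> t0 aX.
have t10 : 0 < (t + 1)^-1 by rewrite invr_gt0 ltr_wpDl.
have h1 : \forall n \near \oo, mesh n < (t + 1)^-1 by exact: (cvgr_lt _ mesh_cvg0 _ t10).
have h2 : \forall n \near \oo, a < X (next_dyad n t) w.
  by apply: (cvgr_gt _ (@X_next_dyad_cvg w t t0)).
near=> n.
have hn : mesh n < (t + 1)^-1 by near: n.
have hX : a < X (next_dyad n t) w by near: n.
rewrite -ltrBlDr; apply: lt_le_trans (gridmax_ge _ _); last first.
  rewrite -ltnS -(ltr_nat R); have := next_dyad_le n t0.
  rewrite /next_dyad /level /dyad /mesh -ler_pdivlMr ?invr_gt0 ?exprn_gt0// invrK => h.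
  apply: le_lt_trans h _; rewrite mulrDl mulVf ?expf_neq0//.
  rewrite (_ : (4 ^ n).+1%:R = 4 ^+ n + 1 :> R) ?ltrD2r; last by rewrite -natrX natr1.
  have p0 : 0 < 2 ^+ n :> R by rewrite exprn_gt0.
  have e4 : 4 ^+ n = 2 ^+ n * 2 ^+ n :> R by rewrite -exprMn -natrM.
  have p1 : 1 <= 2 ^+ n :> R by rewrite exprn_ege1// ler1n.
  move: hn; rewrite /mesh ltf_pV2 ?posrE ?ltr_wpDl// => hn.
  rewrite e4; nra.
by rewrite ltrD2r.
Unshelve. all: by end_near. Qed.

Definition bounded_path : set Omega := [set w | has_ubound [set X t w | t in `[0, +oo[]].

(** The indicator supplies the value exp(-oo) = 0 on unbounded paths, where [all_time_sup] has the
    default value 0; only so is it the pointwise limit of the grid transforms. *)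
Definition sup_transform s w : R := expR (- s * all_time_sup X w) * \1_bounded_path w.

Lemma all_time_sup_ge w t : bounded_path w -> 0 <= t -> X t w <= all_time_sup X w.
Proof.
move=> Bw t0; apply: sup_upper_bound; last by exists t => //=; rewrite in_itv/= t0.
by split => //; exists (X 0 w), 0 => //=; rewrite in_itv/= lexx.
Qed.

Lemma gridmax_le N n w : bounded_path w ->
  future_max (inc X n) N 0 w + X 0 w <= all_time_sup X w.
Proof.
move=> Bw; have [j _ ->] := max_eq_walk (inc X n) N w.
by rewrite walk_inc subrK; apply: all_time_sup_ge => //; exact: dyad_ge0.
Qed.

Lemma sup_transform_cvg s w : 0 < s ->
  expR (- s * (gridmax n w + X 0 w)) @[n --> \oo] --> sup_transform s w.
Proof.
move=> s0; rewrite /sup_transform indicE; have [Bw|Bw] := pselect (bounded_path w).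
  rewrite mem_set// mulr1.
  apply: (cvg_comp _ expR _ (@continuous_expR R _)); apply: cvgMr.
  apply/cvgrPdist_lt => e e0.
  have hs : has_sup [set X t w | t in `[0, +oo[].
    by split => //; exists (X 0 w), 0 => //=; rewrite in_itv/= lexx.
  have [y [t /=]] := sup_adherent e0 hs; rewrite in_itv/= andbT => t0 yE.
  rewrite -yE -/(all_time_sup X w) => /(gridmax_gt t0); apply: filterS => n hn.
  have := gridmax_le (4 ^ n) n Bw; rewrite -/(gridmax n w) => h2.
  by rewrite ger0_norm; lra.
rewrite memNset// mulr0; apply/cvgrPdist_lt => e e0.
have [y [t /=]] : exists2 y, [set X t w | t in `[0, +oo[] y & - ln e / s < y.
  by move: (- ln e / s); apply/has_ubPn.
rewrite in_itv/= andbT => t0 <- /(gridmax_gt t0); apply: filterS => n.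
rewrite ltr_pdivrMr// => hn; rewrite sub0r normrN ger0_norm ?expR_ge0//.
rewrite -[ltRHS](lnK (_ : e \in Num.pos))// ltr_expR; lra.
Qed.

Lemma measurable_gridmaxD s n :
  measurable_fun setT (fun w => expR (- s * (gridmax n w + X 0 w))).
Proof.
apply: (measurableT_comp (measurable_expRM (- s))); apply: measurable_funD.
  exact: measurable_gridmax.
exact: measurable_X.
Qed.

Lemma measurable_sup_transform s : 0 < s -> measurable_fun setT (sup_transform s).
Proof.
move=> s0; apply: (measurable_fun_cvg (@measurable_gridmaxD s)) => w _.
exact: sup_transform_cvg.
Qed.

Lemma measurable_bounded_path : measurable bounded_path.
Proof.
rewrite (_ : bounded_path = sup_transform 1 @^-1` `]0, +oo[%classic).
  rewrite -[X in measurable X]setTI.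
  by apply: measurable_sup_transform => //; exact: ltr01.
apply/seteqP; split => w; rewrite /= in_itv/= andbT /sup_transform indicE.
  by move=> Bw; rewrite mem_set// mulr1 expR_gt0.
by case: (boolP (w \in _)); [rewrite inE|rewrite mulr0 ltxx].
Qed.

(** On unbounded paths both sides are 0, the left one as the default value of [sup], the right one
    because [ln 0 = 0]. Measurability of the supremum follows. *)
Lemma all_time_supE w : all_time_sup X w = - ln (sup_transform 1 w).
Proof.
rewrite /sup_transform indicE; have [Bw|Bw] := pselect (bounded_path w).
  by rewrite mem_set// mulr1 expRK mulN1r opprK.
rewrite memNset// mulr0 ln0// oppr0 /all_time_sup sup_out//.
by move=> [].
Qed.

Lemma measurable_all_time_sup : measurable_fun setT (all_time_sup X).
Proof.
rewrite (_ : all_time_sup X = (fun w => - ln (sup_transform 1 w))); last first.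
  by apply/funext => w; exact: all_time_supE.
apply: measurableT_comp => //; apply: measurableT_comp; first exact: measurable_ln.
exact: measurable_sup_transform.
Qed.

Let Z : set Omega := [set w | X 0 w = 0].

Lemma measurable_X0 : measurable [set w | X 0 w = 0].
Proof.
have := measurable_X X 0 measurableT (measurable_set1 (0 : R)).
by rewrite setTI.
Qed.

(** The grid maxima are relative to [X 0], the supremum is not, and [X 0 = 0] holds only almost
    surely: the two are compared on Z, where the supremum of a bounded path is nonnegative and its
    transform at most 1. *)
Let aeZ (f : Omega -> R) : measurable_fun setT f ->
  \int[P]_w f w = \int[P]_w (f w * \1_Z w).
Proof.
have [X00 _ _ _] := levyX.
move=> mf; apply: Rintegral_ae_eq => //.
  by apply: measurable_funM => //; apply: measurable_indic; exact: measurable_X0.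
by apply: filterS X00 => w Xw; rewrite indicE mem_set// mulr1.
Qed.

Definition supF s : R := \int[P]_w sup_transform s w.

Let Z_ge0 w : Z w -> bounded_path w -> 0 <= all_time_sup X w.
Proof. by move=> Zw Bw; rewrite -[leLHS]Zw; exact: all_time_sup_ge. Qed.

Let sup_transform_ge0 s w : 0 <= sup_transform s w.
Proof. by rewrite /sup_transform mulr_ge0// expR_ge0. Qed.

Let sup_transformZ s w : 0 <= s -> 0 <= sup_transform s w * \1_Z w <= \1_bounded_path w.
Proof.
move=> s0; rewrite mulr_ge0//=; rewrite !indicE /sup_transform indicE.
case: (boolP (w \in bounded_path)) => [Bw|]; last by rewrite mulr0 mul0r.
case: (boolP (w \in Z)) => [Zw|]; last by rewrite mulr0.
rewrite !mulr1 -expR0 ler_expR mulNr oppr_le0 mulr_ge0//.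
by move: Bw Zw; rewrite !inE => Bw Zw; exact: Z_ge0.
Qed.

Let sup_transformZ1 s w : 0 <= s -> `|sup_transform s w * \1_Z w| <= 1.
Proof.
move=> s0; have /andP[h1 h2] := sup_transformZ w s0.
by rewrite ger0_norm// (le_trans h2)// indicE; case: (_ \in _).
Qed.

Lemma measurable_sup_transform0 s : 0 < s -> measurable_fun setT (fun w => sup_transform s w * \1_Z w).
Proof.
move=> s0; apply: measurable_funM; first exact: measurable_sup_transform.
by apply: measurable_indic; exact: measurable_X0.
Qed.

Lemma supF_start0 s : 0 < s -> supF s = \int[P]_w (sup_transform s w * \1_Z w).
Proof. by move=> s0; rewrite /supF aeZ//; exact: measurable_sup_transform. Qed.

Lemma integrable_sup_transform0 s : 0 < s -> P.-integrable setT (fun w => (sup_transform s w * \1_Z w)%:E).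
Proof.
move=> s0; apply: (@bounded_integrable _ _ _ _ _ 1); first exact: measurable_sup_transform0.
by move=> w; apply: sup_transformZ1; exact: ltW.
Qed.

Lemma gridmax_transform_cvg s : 0 < s ->
  pkF P (inc X n) (4 ^ n) s @[n --> \oo] --> supF s.
Proof.
move=> s0; rewrite supF_start0//.
have mg n : measurable_fun setT (fun w => expR (- s * gridmax n w)).
  exact: (measurableT_comp (measurable_expRM (- s)) (measurable_gridmax n)).
rewrite (_ : (fun n => _) =
    (fun n => \int[P]_w (expR (- s * gridmax n w) * \1_Z w))); last first.
  by apply/funext => n; rewrite /pkF -aeZ.
apply: (@Rintegral_bct _ _ _ _ _ _ 1).
- move=> n; apply: measurable_funM => //.
  by apply: measurable_indic; exact: measurable_X0.
- exact: measurable_sup_transform0.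
- move=> w; rewrite indicE; case: (boolP (w \in Z)) => [|_]; last first.
    by rewrite mulr0; under eq_fun do rewrite mulr0; exact: cvg_cst.
  rewrite inE => Zw; apply: cvgMl; have := @sup_transform_cvg s w s0.
  by rewrite Zw; under eq_fun do rewrite addr0.
- move=> n w; rewrite indicE; case: (w \in Z); rewrite ?mulr0 ?normr0 ?mulr1//.
  rewrite ger0_norm ?expR_ge0// /gridmax; apply: expR_max_le1; exact: ltW.
Qed.

Lemma supF_le n N s : 0 < s -> supF s <= pkF P (inc X n) N s.
Proof.
move=> s0; rewrite supF_start0//; apply: le_Rintegral => //.
- exact: integrable_sup_transform0.
- by apply: expR_max_integrable; [exact: measurable_inc|exact: ltW].
move=> w _; rewrite /sup_transform !indicE.
case: (boolP (w \in bounded_path)) => [|_]; last by rewrite mulr0 mul0r expR_ge0.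
case: (boolP (w \in Z)) => [|_]; last by rewrite mulr0 expR_ge0.
rewrite !inE => Zw Bw; rewrite !mulr1 ler_expR !mulNr lerN2 ler_wpM2l ?(ltW s0)//.
by have := gridmax_le N n Bw; rewrite Zw addr0.
Qed.

(** The transform of the maximum of the level n walk over infinite time. It separates the limits: N
    goes to infinity at fixed mesh, and then n does. *)
Let Fl n s : R := inf (range (fun N => pkF P (inc X n) N s)).

Let Fl_lb n s : has_lbound (range (fun N => pkF P (inc X n) N s)).
Proof. by exists 0 => _ [N _ <-]; exact: pkF_ge0. Qed.

Let Fl_cvg n s : 0 < s -> pkF P (inc X n) N s @[N --> \oo] --> Fl n s.
Proof.
move=> s0; apply: nonincreasing_cvgn => //.
by apply: homo_leq; [move=> u; exact: lexx|move=> x y z xy yz; exact: le_trans yz xy|];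
  move=> N; apply: pkF_ni; [exact: measurable_inc|exact: ltW].
Qed.

Let Fl_supF s : 0 < s -> Fl n s @[n --> \oo] --> supF s.
Proof.
move=> s0; apply: (@squeeze_cvgr _ _ _ _ (cst (supF s)) (fun n => pkF P (inc X n) (4 ^ n) s)).
- apply: nearW => n /=; apply/andP; split.
    apply: lb_le_inf; first by exists (pkF P (inc X n) 0 s), 0%N.
    by move=> _ [N _ <-]; exact: supF_le.
  by apply: ge_inf => //; exists (4 ^ n)%N.
- exact: cvg_cst.
- exact: gridmax_transform_cvg.
Qed.

(** In [pk_rec] the terms [pkF] for N and N + 1 have the same limit, so the defect converges to
    (laplace - 1) times it. *)
Let pkJ_cvg n s : 0 < s -> 2 ^+ n * pkJ P (inc X n) N s @[N --> \oo] -->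
  2 ^+ n * (laplace (step_law X n) s - 1) * Fl n s.
Proof.
move=> s0.
rewrite (_ : (fun N => _) = (fun N => 2 ^+ n * (laplace (step_law X n) s * pkF P (inc X n) N s
   - pkF P (inc X n) N.+1 s))); last first.
  apply/funext => N; rewrite -(pk_rec (measurable_inc X n) (inc_ind levyX n) _ N (ltW s0)).
    by rewrite addrC addKr.
  exact: step_mgf.
rewrite -mulrA mulrBl mul1r; apply: cvgMr; apply: cvgB.
  by apply: cvgMr; exact: Fl_cvg.
by rewrite (cvg_shiftS (fun N => pkF P (inc X n) N s)); exact: Fl_cvg.
Qed.

Let pk_ratio s : 0 < s ->
  2 ^+ n * (laplace (step_law X n) s - 1) * Fl n s @[n --> \oo] --> psi s * supF s.
Proof.
by move=> s0; apply: cvgM; [apply: laplace_slope_cvg => //; exact: ltW|exact: Fl_supF].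
Qed.

(** The limit of [pk_compare]. As s and t are in no particular order, exchanging them gives
    equality. *)
Lemma kappa_le s t : 0 < s -> 0 < t -> psi s * supF s / s <= psi t * supF t / t.
Proof.
move=> s0 t0.
have key e : 0 < e -> psi s * supF s / s <= expR (s * e) * (psi t * supF t / t).
  move=> e0.
  have h n : 2 ^+ n * (laplace (step_law X n) s - 1) * Fl n s / s <=
      expR (s * e) * (2 ^+ n * (laplace (step_law X n) t - 1) * Fl n t / t)
      + s^-1 * (2 ^+ n * jump_tail (step_law X n) s e).
    have c1 : 2 ^+ n * pkJ P (inc X n) N s / s @[N --> \oo] -->
        2 ^+ n * (laplace (step_law X n) s - 1) * Fl n s / s.
      by apply: cvgMl; exact: pkJ_cvg.
    have c2 : expR (s * e) * (2 ^+ n * pkJ P (inc X n) N t / t)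
        + s^-1 * (2 ^+ n * jump_tail (step_law X n) s e) @[N --> \oo] -->
      expR (s * e) * (2 ^+ n * (laplace (step_law X n) t - 1) * Fl n t / t)
      + s^-1 * (2 ^+ n * jump_tail (step_law X n) s e).
      by apply: cvgD; [apply: cvgMr; apply: cvgMl; exact: pkJ_cvg|exact: cvg_cst].
    apply: (ler_cvg_to c1 c2); apply: nearW => N.
    have := pk_compare (measurable_inc X n) (inc_ind levyX n) (step_mgf levyX posX n) N s0 t0 (ltW e0).
    have n0 : 0 <= 2 ^+ n :> R by rewrite exprn_ge0.
    move=> /(ler_wpM2l n0) h; rewrite -mulrA; apply: le_trans h _.
    by rewrite le_eqVlt; apply/orP; left; apply/eqP; ring.
  have c1 : 2 ^+ n * (laplace (step_law X n) s - 1) * Fl n s / s @[n --> \oo] --> psi s * supF s / s.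
    by apply: cvgMl; exact: pk_ratio.
  have c2 : expR (s * e) * (2 ^+ n * (laplace (step_law X n) t - 1) * Fl n t / t)
      + s^-1 * (2 ^+ n * jump_tail (step_law X n) s e) @[n --> \oo] -->
      expR (s * e) * (psi t * supF t / t) + s^-1 * 0.
    apply: cvgD; first by apply: cvgMr; apply: cvgMl; exact: pk_ratio.
    by apply: cvgMr; apply: jump_tail_cvg0 => //; exact: ltW.
  rewrite mulr0 addr0 in c2; exact: (ler_cvg_to c1 c2 (nearW _ h)).
have c2 : expR (s * n.+1%:R^-1) * (psi t * supF t / t) @[n --> \oo] --> 1 * (psi t * supF t / t).
  apply: cvgMl; rewrite -[X in _ --> X]expR0 -(mulr0 s).
  apply: (cvg_comp _ expR _ (@continuous_expR R _)); apply: cvgMr; exact: cvg_harmonic.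
rewrite -[leRHS]mul1r; apply: (cvgn_ge c2) => n.
by apply: key; rewrite invr_gt0.
Qed.

(** The lower bound that excludes a vanishing constant, which would mean an almost surely infinite
    supremum. *)
Lemma kappa_ge c s : 0 < s -> (forall t, 0 < t -> c * t <= psi t) -> c * s <= psi s * supF s.
Proof.
move=> s0 hc.
have h n : c * s <= 2 ^+ n * (laplace (step_law X n) s - 1) * Fl n s.
  apply: (cvgn_ge (@pkJ_cvg n s s0)) => N.
  have m0 := @mesh_gt0 R n.
  have := @pkJ_ge _ _ _ P _ _ (measurable_inc X n) (inc_ind levyX n) (step_mgf levyX posX n) N s (mesh n * c) s0.
  move=> H; rewrite -ler_pdivrMl ?exprn_gt0// mulrA.
  apply: H => t t0; rewrite laplaceE ?(ltW t0)//.
  have := expR_ge1Dx (mesh n * psi t); have := ler_wpM2l (ltW m0) (hc t t0); lra.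
exact: (cvgn_ge (@pk_ratio s s0) h).
Qed.

(** * Consequences of the negative drift *)

Hypothesis driftX : ('E_P[X 1%R] < 0)%E.

Lemma exp_X1_integrable t : 0 <= t -> P.-integrable setT (fun w => (expR (- t * X 1 w))%:E).
Proof.
move=> t0; apply/integrableP; split.
  apply/measurable_EFinP; apply: (measurableT_comp (measurable_expRM (- t))).
  exact: measurable_X.
under eq_integral do rewrite /= ger0_norm ?expR_ge0//.
exact: expR_X1_finite.
Qed.

(** The negative part is dominated by exp(-X(1)); an infinite positive part would then make the mean
    +oo. *)
Lemma X1_integrable : P.-integrable setT (fun w => (X 1 w)%:E).
Proof.
have mX : measurable_fun setT (fun w => (X 1 w)%:E).
  by apply/measurable_EFinP; exact: measurable_X.
have neg : (\int[P]_w ((fun w => (X 1 w)%:E)^\- w) < +oo)%E.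
  have /integrableP[_] := exp_X1_integrable ler01; apply: le_lt_trans.
  apply: ge0_le_integral => //.
  - exact: measurable_funeneg.
  - by apply: measurableT_comp => //; case/integrableP: (exp_X1_integrable ler01).
  move=> w _; rewrite /= ger0_norm ?expR_ge0// funenegE -EFinN -EFin_max lee_fin.
  rewrite mulN1r ge_max expR_ge0 andbT.
  by have := expR_ge1Dx (- X 1 w); lra.
have pos : (\int[P]_w ((fun w => (X 1 w)%:E)^\+ w) < +oo)%E.
  rewrite ltNge leye_eq; apply/negP => /eqP h.
  move: driftX; rewrite unlock integralE h.
  have : (\int[P]_w ((fun w => (X 1 w)%:E)^\- w))%E \is a fin_num.
    by rewrite ge0_fin_numE//; exact: integral_ge0.
  by case: (\int[P]_w _)%E.
apply/integrableP; split => //.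
rewrite (eq_integral (fun w => (fun w => (X 1 w)%:E)^\+ w + (fun w => (X 1 w)%:E)^\- w)%E); last first.
  by move=> w _; exact: (congr1 (fun g => g w) (fune_abse (fun w => (X 1 w)%:E))).
rewrite ge0_integralD//; last 2 first.
- exact: measurable_funepos.
- exact: measurable_funeneg.
exact: lte_add_pinfty.
Qed.

(** Jensen's inequality with c = -E X(1), obtained by integrating the tangent of exp at the point c
    t. *)
Lemma exponent_ge : exists2 c, 0 < c & forall t, 0 < t -> c * t <= psi t.
Proof.
have X1i := X1_integrable.
pose m := - \int[P]_w X 1 w.
have m0 : 0 < m by rewrite /m oppr_gt0 -lte_fin -Rintegral_EFin//; move: driftX; rewrite unlock.
exists m => // t t0; have t0' := ltW t0.
have me := exp_X1_integrable t0'.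
rewrite /dual_exponent unlock -[fine _]/(\int[P]_w expR (- t * X 1 w)).
rewrite -ler_expR lnK; last first.
  rewrite posrE; have := laplace_gt0 levyX posX 0 t0'.
  suff -> : laplace (step_law X 0) t = \int[P]_w expR (- t * X 1 w) by [].
  by rewrite /laplace /Rintegral -(expR_law_pow levyX 0).
have -> : expR (m * t) = \int[P]_w (expR (m * t) * (1 - t * m) + (- expR (m * t) * t) * X 1 w).
  rewrite RintegralD//; last 2 first.
  - exact: finite_measure_integrable_cst.
  - exact: integrable_EFinZl.
  rewrite (Rintegral_cst_prob P (expR (m * t) * (1 - t * m))) RintegralZl//.
  rewrite -[\int[P]_w X 1 w]opprK -/m; ring.
apply: le_Rintegral => //.
  apply: integrable_EFinD; first exact: finite_measure_integrable_cst.
  exact: integrable_EFinZl.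
move=> w _; rewrite (_ : - t * X 1 w = m * t + (- t * (X 1 w + m))); last by ring.
rewrite expRD (_ : _ + _ = expR (m * t) * (1 + - t * (X 1 w + m))); last by ring.
by rewrite ler_wpM2l ?expR_ge0// expR_ge1Dx.
Qed.

Let kappa : R := psi 1 * supF 1.

Let kappaE s : 0 < s -> psi s * supF s = kappa * s.
Proof.
move=> s0; have h1 := kappa_le s0 ltr01; have h2 := kappa_le ltr01 s0.
have : psi s * supF s / s = kappa.
  rewrite !divr1 in h1 h2.
  by apply/eqP; rewrite eq_le; apply/andP; split; [exact: h1|exact: h2].
by move=> <-; rewrite divfK// gt_eqF.
Qed.

Let kappa_gt0 : 0 < kappa.
Proof.
have [c c0 hc] := exponent_ge; have := kappa_ge ltr01 hc.
by rewrite mulr1 -/kappa; exact: lt_le_trans.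
Qed.

Lemma psi_gt0 s : 0 < s -> 0 < psi s.
Proof.
by move=> s0; have [c c0 hc] := exponent_ge; apply: lt_le_trans (hc s s0); rewrite mulr_gt0.
Qed.

Let supF_gt0 s : 0 < s -> 0 < supF s.
Proof.
move=> s0; have : 0 < psi s * supF s by rewrite kappaE// mulr_gt0.
by rewrite pmulr_rgt0// psi_gt0.
Qed.

Let mB := measurable_bounded_path.

Let rho : R := fine (P bounded_path).

Let supF_le_rho s : 0 < s -> supF s <= rho.
Proof.
move=> s0; rewrite /rho -(Rintegral_indic P mB) supF_start0//; apply: le_Rintegral => //.
- exact: integrable_sup_transform0.
- exact: integrable_indicR.
by move=> w _; have /andP[] := sup_transformZ w (ltW s0).
Qed.

(** A self-improving bound: supF <= rho turns psi supF = kappa t into psi(t) >= (kappa / rho) t, and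
    feeding this slope back into [kappa_ge] gives kappa / rho <= kappa, hence rho >= 1. *)
Lemma bounded_path1 : P bounded_path = 1%E.
Proof.
have rho0 : 0 < rho by exact: lt_le_trans (supF_gt0 ltr01) (supF_le_rho ltr01).
have h t : 0 < t -> kappa / rho * t <= psi t.
  move=> t0; rewrite mulrAC ler_pdivrMr// -(kappaE t0) ler_wpM2l ?(ltW (psi_gt0 t0))//.
  exact: supF_le_rho.
have := kappa_ge ltr01 h; rewrite mulr1 -/kappa ler_pdivrMr// ler_pMr// => r1.
apply/eqP; rewrite eq_le probability_le1//=.
by rewrite -[leRHS]fineK ?fin_num_measure// lee_fin.
Qed.

Let supF_ni s t : 0 < s -> s <= t -> supF t <= supF s.
Proof.
move=> s0 st; have t0 := lt_le_trans s0 st.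
rewrite !supF_start0//; apply: le_Rintegral => //; [exact: integrable_sup_transform0|exact: integrable_sup_transform0|move=> w _].
rewrite !indicE /sup_transform indicE.
case: (boolP (w \in Z)) => [Zw|]; last by rewrite !mulr0.
case: (boolP (w \in bounded_path)) => [Bw|]; last by rewrite !mulr0 !mul0r.
rewrite !mulr1 ler_expR !mulNr lerN2 ler_wpM2r//.
by move: Bw Zw; rewrite !inE => Bw Zw; exact: Z_ge0.
Qed.

Lemma supF_cvg1 (u : nat -> R) : (forall n, 0 < u n) -> u n @[n --> \oo] --> (0 : R) ->
  supF (u n) @[n --> \oo] --> (1 : R).
Proof.
move=> u0 cu.
have -> : (1 : R) = \int[P]_w (\1_bounded_path w * \1_Z w).
  rewrite -aeZ; last exact: measurable_indic.
  by rewrite Rintegral_indic// bounded_path1.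
rewrite (_ : (fun n => _) = (fun n => \int[P]_w (sup_transform (u n) w * \1_Z w))); last first.
  by apply/funext => n; rewrite supF_start0.
apply: (@Rintegral_bct _ _ _ _ _ _ 1).
- by move=> n; exact: measurable_sup_transform0.
- by apply: measurable_funM; apply: measurable_indic => //; exact: measurable_X0.
- move=> w; apply: cvgMl; rewrite /sup_transform -[X in _ --> X]mul1r; apply: cvgMl.
  rewrite -[X in _ --> X]expR0 -(mul0r (all_time_sup X w)) -oppr0.
  have c0 : - u n * all_time_sup X w @[n --> \oo] --> - 0 * all_time_sup X w.
    by apply: cvgMl; apply: cvgN.
  exact: (cvg_comp _ expR c0 (@continuous_expR R _)).
- by move=> n w; apply: sup_transformZ1; exact: ltW.
Qed.

(** The quotient psi(u) / u equals kappa / supF(u), and supF(u) tends to 1 because the supremum is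
    finite almost surely. *)
Lemma right_derivative_psi : right_derivative psi 0 = kappa.
Proof.
apply/cvg_lim => //; apply/cvg_at_rightP => u [u0 cu].
have := supF_cvg1 u0 cu => cF.
rewrite -[X in _ --> X]mulr1 -[X in _ * X]invr1.
have : kappa * (supF (u n))^-1 @[n --> \oo] --> kappa * 1^-1.
  by apply: cvgMr; apply: cvgV => //; exact: oner_neq0.
apply: cvg_trans; apply: near_eq_cvg; apply: nearW => n.
rewrite add0r psi0 subr0; have s0 := u0 n; have F0 := supF_gt0 s0.
have -> : kappa = psi (u n) * supF (u n) / u n by rewrite kappaE// mulfK// gt_eqF.
by field; rewrite !gt_eqF.
Qed.

Lemma supFE_psi s : 0 < s -> supF s = right_derivative psi 0 * (s / psi s).
Proof.
move=> s0; rewrite right_derivative_psi mulrA -kappaE// mulrAC divff ?mul1r//.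
by rewrite gt_eqF// psi_gt0.
Qed.

(** As psi(s) supF(s) = kappa s is strictly increasing and supF is nonincreasing, psi must be
    strictly increasing. *)
Lemma psi_lt s t : 0 <= s -> s < t -> psi s < psi t.
Proof.
move=> s0 st; have t0 := le_lt_trans s0 st.
have [s00|sn0] := eqVneq s 0; first by rewrite s00 psi0 psi_gt0.
have sp : 0 < s by rewrite lt_neqAle eq_sym sn0.
rewrite -(ltr_pM2r (supF_gt0 sp)) (kappaE sp).
apply: (@lt_le_trans _ _ (kappa * t)); first by rewrite ltr_pM2l.
rewrite -(kappaE t0) ler_wpM2l ?(ltW (psi_gt0 t0))//.
by apply: supF_ni => //; exact: ltW.
Qed.

(** The derivative of exp(-s m) in s has modulus m exp(-s m), which is at most 1 / s, whatever m >=
    0. *)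
Let supF_lip dl s t : 0 < dl -> dl <= s -> s <= t -> supF s - supF t <= (t - s) / dl.
Proof.
move=> d0 ds st; have s0 := lt_le_trans d0 ds; have t0 := lt_le_trans s0 st.
rewrite !supF_start0// -RintegralB//; [|exact: integrable_sup_transform0|exact: integrable_sup_transform0].
rewrite -[leRHS](Rintegral_cst_prob P); apply: le_Rintegral => //.
- have := integrableB measurableT (integrable_sup_transform0 s0) (integrable_sup_transform0 t0).
  by apply: eq_integrable => // w _ /=; rewrite EFinB.
- exact: finite_measure_integrable_cst.
have r0 : 0 <= (t - s) / dl by rewrite divr_ge0 ?subr_ge0// ltW.
move=> w _; rewrite !indicE /sup_transform indicE.
case: (boolP (w \in Z)) => [Zw|]; last by rewrite !mulr0 subrr.
case: (boolP (w \in bounded_path)) => [Bw|]; last by rewrite !mulr0 !mul0r subrr.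
rewrite !mulr1.
have S0 : 0 <= all_time_sup X w by move: Bw Zw; rewrite !inE => Bw Zw; exact: Z_ge0.
set m := all_time_sup X w in S0 *.
have h1 : expR (- s * m) - expR (- t * m) <= expR (- s * m) * ((t - s) * m).
  rewrite (_ : - t * m = - s * m + (- ((t - s) * m))) ?expRD; last by ring.
  have := expR_ge1Dx (- ((t - s) * m)); have := expR_ge0 (- s * m); nra.
apply: le_trans h1 _.
have h2 : expR (- s * m) * (s * m) <= 1.
  rewrite mulNr expRN mulrC ler_pdivrMr ?expR_gt0// mul1r.
  by have := expR_ge1Dx (s * m); lra.
rewrite ler_pdivlMr//.
have h3 : expR (- s * m) * (dl * m) <= 1.
  by apply: le_trans h2; rewrite ler_wpM2l ?expR_ge0// ler_wpM2r.
rewrite (_ : _ * dl = (t - s) * (expR (- s * m) * (dl * m))); last by ring.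
by rewrite ler_piMr// subr_ge0.
Qed.

Let supF_continuous s : 0 < s -> {for s, continuous supF}.
Proof.
move=> s0; apply/cvgrPdist_lt => e e0.
pose dl := s / 2; have d0 : 0 < dl by rewrite divr_gt0.
pose r := Num.min dl (e * dl); have r0 : 0 < r by rewrite lt_min d0 mulr_gt0.
apply: (filterS _ (nbhsx_ballx s r r0)) => t; rewrite /ball /= lt_min => /andP[td te].
have td' : dl <= t by move: td; rewrite /dl ltr_norml; lra.
have sd' : dl <= s by rewrite /dl; lra.
have [st|ts] := leP s t.
  have := supF_lip d0 sd' st; have := supF_ni s0 st.
  rewrite -subr_ge0 => h1 h2; rewrite ger0_norm// (le_lt_trans h2)//.
  rewrite ltr_pdivrMr//; apply: le_lt_trans te; rewrite ler0_norm ?subr_le0//; lra.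
have := supF_lip d0 td' (ltW ts); have := supF_ni (lt_le_trans d0 td') (ltW ts).
rewrite -subr_ge0 => h1 h2; rewrite distrC ger0_norm// (le_lt_trans h2)//.
by rewrite ltr_pdivrMr//; apply: le_lt_trans te; rewrite gtr0_norm ?subr_gt0.
Qed.

Lemma dual_inverseP theta : 0 < theta ->
  0 < dual_inverse X theta /\ psi (dual_inverse X theta) = theta.
Proof.
move=> th0; have [c c0 hc] := exponent_ge.
pose b := theta / c; have b0 : 0 < b by rewrite divr_gt0.
(* The lower end of the interval for the intermediate value theorem: a <= 1 gives supF(a) >=
   supF(1), so psi(a) = kappa a / supF(a) is at most theta as soon as a <= theta supF(1) / kappa. *)
pose a := Num.min 1 (Num.min b (theta * supF 1 / kappa)).
have a0 : 0 < a by rewrite !lt_min ltr01 b0 divr_gt0// mulr_gt0// supF_gt0.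
have ab : a <= b by rewrite !ge_min lexx orbT.
have a1 : a <= 1 by rewrite ge_min lexx.
have pb : theta <= psi b by have := hc b b0; rewrite /b mulrC divfK// gt_eqF.
have pa : psi a <= theta.
  rewrite -(ler_pM2r (supF_gt0 a0)) (kappaE a0).
  apply: (@le_trans _ _ (theta * supF 1)); last first.
    by rewrite ler_wpM2l ?(ltW th0)//; exact: supF_ni.
  by rewrite mulrC -ler_pdivlMr// /a !ge_min lexx !orbT.
have cpsi : {within `[a, b], continuous psi}.
  apply: continuous_in_subspaceT => s; rewrite inE /= in_itv/= => /andP[as_ _].
  have s0 := lt_le_trans a0 as_.
  have cq : {for s, continuous (fun s => kappa * s / supF s)}.
    apply: cvgM; first by apply: cvgMr; exact: cvg_id.
    apply: cvgV; first by rewrite gt_eqF// supF_gt0.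
    exact: supF_continuous.
  have E : \forall t \near s, kappa * t / supF t = psi t.
    near=> t; have t0 : 0 < t by near: t; exact: lt_nbhsr.
    by rewrite -(kappaE t0) mulfK// gt_eqF// supF_gt0.
  rewrite /continuous_at -(nbhs_singleton E).
  by apply: cvg_trans cq; exact: near_eq_cvg.
have [|phi] := IVT (v := theta) ab cpsi.
  by rewrite ge_min pa/= le_max pb orbT.
rewrite in_itv/= => /andP[ap _] pphi.
have phi0 := lt_le_trans a0 ap.
suff -> : dual_inverse X theta = phi by [].
rewrite /dual_inverse (_ : [set _ | _] = [set phi]) ?sup1//.
apply/seteqP; split => [eta [/= e0 pe]|_ ->]; last by split => //; exact: ltW.
apply/eqP; rewrite eq_le !leNgt; apply/andP; split; apply/negP => h.
  by have := psi_lt (ltW phi0) h; rewrite pphi pe ltxx.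
by have := psi_lt e0 h; rewrite pphi pe ltxx.
Unshelve. all: by end_near. Qed.

End pollaczek_khinchine_limit.

(** * Survival of the workload *)

Section survival.
Context {R : realType} {d : measure_display} {Omega : measurableType d}
  {P : probability Omega R} (X : R -> {RV P >-> R}).
Hypothesis levyX : levy_process X.
Variables (beta : R).
Hypothesis beta_gt0 : 0 < beta.

(** Countably many conditions, hence a measurable event; taken relative to [X 0] to agree with
    [walk]. *)
Definition dyadic_alive (y t : R) : set Omega :=
  [set w | forall n j, dyad n j <= t -> 0 < y + (X (dyad n j) w - X 0 w)].

Definition survival (y t : R) : R :=
  \int[P]_w (expR (- beta * Num.max 0 (y + (X t w - X 0 w))) * \1_(dyadic_alive y t) w).

Definition survival_step n k (y : R) : R :=
  \int[P]_w (expR (- beta * Num.max 0 (y + walk (inc X n) k.+1 w))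
             * \1_(alive (inc X n) y k) w).

Lemma dyad_le_level n (t : R) j : 0 <= t -> (j <= level n t)%N = (dyad n j <= t).
Proof.
move=> t0; rewrite /dyad /mesh ler_pdivrMr ?exprn_gt0//.
by rewrite /level truncn_ge_nat// mulr_ge0// exprn_ge0.
Qed.

Lemma alive_level n y (t : R) w : 0 <= t -> alive (inc X n) y (level n t) w <->
  forall j, dyad n j <= t -> 0 < y + (X (dyad n j) w - X 0 w).
Proof.
move=> t0; split=> H j jt.
  by rewrite -walk_inc; apply: H; rewrite dyad_le_level.
by rewrite walk_inc; apply: H; rewrite -dyad_le_level.
Qed.

Lemma measurable_dyadic_alive y t : measurable (dyadic_alive y t).
Proof.
rewrite (_ : dyadic_alive y t = \bigcap_n \bigcap_(j in [set j | dyad n j <= t])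
   (~` [set w | y + increment X 0 (dyad n j) w < 0]
    `\` [set w | y + increment X 0 (dyad n j) w = 0])).
  apply: bigcapT_measurable => n; apply: bigcap_measurableType => j _.
  have mf : measurable_fun setT (fun w => y + increment X 0 (dyad n j) w).
    by apply: measurable_funD => //; exact: measurable_increment.
  apply: measurableD; first by apply: measurableC; exact: measurable_lt.
  have := mf measurableT _ (measurable_set1 (0 : R)); by rewrite setTI.
apply/seteqP; split => w H.
  move=> n _ j jt; have := H n j jt; rewrite /increment /= => h; split.
    by apply/negP; rewrite -leNgt ltW.
  by move=> h0; rewrite h0 ltxx in h.
move=> n j jt; have [/negP] := H n I j jt; rewrite -leNgt => h1 h2.
by rewrite lt_neqAle h1 andbT eq_sym; apply/eqP.
Qed.

Lemma survival_integrand_le1 (a : R) (B : set Omega) w : `|expR (- beta * Num.max 0 a) * \1_B w| <= 1.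
Proof.
rewrite ger0_norm ?mulr_ge0 ?expR_ge0// indicE; case: (_ \in _); rewrite ?mulr0 ?mulr1//.
by rewrite -expR0 ler_expR mulNr oppr_le0 mulr_ge0 ?(ltW beta_gt0)// le_max lexx.
Qed.

Lemma prob_integral_le1 d' (T : measurableType d') (Q : probability T R) (f : T -> R) :
  measurable_fun setT f -> (forall w, 0 <= f w <= 1) -> 0 <= \int[Q]_w f w <= 1.
Proof.
move=> mf f01; rewrite Rintegral_ge0 => [/=|w _]; last by have /andP[] := f01 w.
rewrite -[leRHS](Rintegral_cst_prob Q); apply: le_Rintegral => //.
- apply: (@bounded_integrable _ _ _ _ _ 1) => // w; have /andP[h1 h2] := f01 w.
  by rewrite ger0_norm.
- exact: finite_measure_integrable_cst.
- by move=> w _; have /andP[] := f01 w.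
Qed.

Lemma measurable_step_integrand n k y :
  measurable_fun setT (fun w => expR (- beta * Num.max 0 (y + walk (inc X n) k.+1 w))
             * \1_(alive (inc X n) y k) w).
Proof.
apply: measurable_funM; last first.
  by apply: measurable_indic; apply: measurable_alive; exact: measurable_inc.
apply: (measurableT_comp (measurable_expRM (- beta))); apply: measurable_maxr => //.
by apply: measurable_funD => //; apply: measurable_walk; exact: measurable_inc.
Qed.

Lemma measurable_survival_integrand y t :
  measurable_fun setT (fun w => expR (- beta * Num.max 0 (y + (X t w - X 0 w)))
             * \1_(dyadic_alive y t) w).
Proof.
apply: measurable_funM; last first.
  by apply: measurable_indic; exact: measurable_dyadic_alive.
apply: (measurableT_comp (measurable_expRM (- beta))); apply: measurable_maxr => //.
by apply: measurable_funD => //; exact: (measurable_increment X 0 t).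
Qed.

Lemma survival_step01 n k y : 0 <= survival_step n k y <= 1.
Proof.
apply: prob_integral_le1; first exact: measurable_step_integrand.
by move=> w; rewrite mulr_ge0 ?expR_ge0//=; apply: le_trans (survival_integrand_le1 _ _ w); exact: ler_norm.
Qed.

Lemma survival01 y t : 0 <= survival y t <= 1.
Proof.
apply: prob_integral_le1; first exact: measurable_survival_integrand.
by move=> w; rewrite mulr_ge0 ?expR_ge0//=; apply: le_trans (survival_integrand_le1 _ _ w); exact: ler_norm.
Qed.

Lemma survival_step_cvg y t : 0 <= t ->
  survival_step n (level n t) y @[n --> \oo] --> survival y t.
Proof.
move=> t0; apply: (@Rintegral_bct _ _ _ _ _ _ 1).
- by move=> n; exact: measurable_step_integrand.
- exact: measurable_survival_integrand.
- move=> w; apply: cvgM.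
    apply: (cvg_comp _ expR _ (@continuous_expR R _)); apply: cvgMr.
    have cY : y + walk (inc X n) (level n t).+1 w @[n --> \oo] --> y + (X t w - X 0 w).
      apply: cvgD; first exact: cvg_cst.
      under eq_fun do rewrite walk_inc.
      by apply: cvgB; [exact: (@X_next_dyad_cvg _ _ _ _ _ levyX w t t0)|exact: cvg_cst].
    have cm := @continuous_max R R (cst 0) idfun (y + (X t w - X 0 w)).
    exact: (cvg_comp _ (fun z => Num.max 0 z) cY (cm (@cvg_cst _ _ _ _ _) (@cvg_id _ _))).
  (* The grids are nested: a violation at one level persists at all finer ones, so the indicators
     are eventually constant. *)
  apply: cvg_near_cst; have [Aw|Aw] := pselect (dyadic_alive y t w).
    apply: nearW => n; rewrite !indicE !mem_set//.
    by apply/alive_level => // j; exact: Aw.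
  have [n [j [jt h]]] : exists n j, dyad n j <= t /\ ~ (0 < y + (X (dyad n j) w - X 0 w)).
    apply: contrapT => H; apply: Aw => n j jt; apply: contrapT => h.
    by apply: H; exists n, j.
  exists n => // m /= nm; rewrite !indicE !memNset//.
  move=> /(alive_level m y w t0)/(_ (j * 2 ^ (m - n))%N).
  rewrite -[in dyad m](subnKC nm) dyad_refine.
  by move=> /(_ jt).
- by move=> n w; exact: survival_integrand_le1.
Qed.

Lemma measurable_survival_step n k : measurable_fun setT (survival_step n k).
Proof.
pose F (z : R * Omega) : \bar R :=
  (expR (- beta * Num.max 0 (z.1 + walk (inc X n) k.+1 z.2))
   * \1_[set z : R * Omega | alive (inc X n) z.1 k z.2] z)%:E.
have mW j : measurable_fun setT (fun z : R * Omega => z.1 + walk (inc X n) j z.2).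
  apply: measurable_funD => //.
  exact: (measurableT_comp (measurable_walk (measurable_inc X n) j) measurable_snd).
have mF : measurable_fun setT F.
  apply/measurable_EFinP; apply: measurable_funM.
    apply: (measurableT_comp (measurable_expRM (- beta))); exact: measurable_maxr.
  apply: measurable_indic.
  rewrite (_ : [set z | _] = \bigcap_(i in [set i : nat | (i < k.+1)%N])
    ((fun z : R * Omega => z.1 + walk (inc X n) i z.2) @^-1` `]0, +oo[%classic)); last first.
    by apply/seteqP; split => z H i ik; have := H i ik; rewrite /= in_itv/= andbT.
  apply: fin_bigcap_measurable => // i _; rewrite -[X in measurable X]setTI.
  exact: mW.
have F0 z : (0 <= F z)%E by rewrite lee_fin mulr_ge0 ?expR_ge0.
have := measurable_fun_fubini_tonelli_F (m2 := P) F mF F0.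
move=> /(measurableT_comp (@fine_measurable R _ measurableT)).
by apply: eq_measurable_fun.
Qed.

Lemma measurable_survival t : 0 <= t -> measurable_fun setT (survival ^~ t).
Proof.
move=> t0; apply: (measurable_fun_cvg (fun n => measurable_survival_step n (level n t))).
by move=> y _; exact: survival_step_cvg.
Qed.

End survival.

(** * Step functions of time and integration over the half-line *)

Section half_line.
Context {R : realType}.
Local Notation mu := (@lebesgue_measure R).
Local Notation D := (`[0%R, +oo[%classic : set R).

Definition grid_cell n k : set R := `[dyad n k, dyad n k.+1[%classic.

Lemma grid_cell_level n k t : grid_cell n k t -> level n t = k.
Proof.
rewrite /grid_cell /= in_itv/= => /andP[h1 h2]; apply: truncn_def.
rewrite -ler_pdivrMr ?exprn_gt0// -[_ / _]/(dyad n k) h1/=.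
by rewrite -ltr_pdivlMr ?exprn_gt0.
Qed.

Lemma level_grid_cell n t : 0 <= t -> grid_cell n (level n t) t.
Proof.
move=> t0; rewrite /grid_cell /= in_itv/= /level /dyad /mesh.
rewrite ler_pdivrMr ?exprn_gt0// ltr_pdivlMr ?exprn_gt0//.
by apply: truncn_itv; rewrite mulr_ge0// exprn_ge0.
Qed.

Lemma bigcup_grid_cell n : \bigcup_k grid_cell n k = D.
Proof.
apply/seteqP; split => [t [k _]|t]; rewrite /grid_cell /= !in_itv/= andbT.
  by move=> /andP[h _]; exact: le_trans (dyad_ge0 n k) h.
by move=> t0; exists (level n t) => //; exact: level_grid_cell.
Qed.

Lemma trivIset_grid_cell n : trivIset setT (grid_cell n).
Proof.
apply/trivIsetP => i j _ _ /eqP ij; apply/seteqP; split => // t [ti tj]; apply: ij.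
by rewrite -(grid_cell_level ti) (grid_cell_level tj).
Qed.

Lemma measurable_step (a : nat -> R) n : measurable_fun D (fun t => a (level n t)).
Proof.
rewrite -(bigcup_grid_cell n); apply/measurable_fun_bigcup => k.
  exact: measurable_itv.
apply: (eq_measurable_fun (cst (a k))) => // t; rewrite inE => tk.
by rewrite (grid_cell_level tk).
Qed.

Lemma step_integral (a : nat -> R) n : (forall k, 0 <= a k) ->
  (\int[mu]_(t in D) (a (level n t))%:E = \sum_(0 <= k <oo) (mesh n * a k)%:E)%E.
Proof.
move=> a0; rewrite -(bigcup_grid_cell n) ge0_integral_bigcup//; last 4 first.
- by move=> k; exact: measurable_itv.
- by rewrite bigcup_grid_cell; apply/measurable_EFinP; exact: measurable_step.
- by move=> t _; rewrite lee_fin.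
- exact: trivIset_grid_cell.
apply: eq_eseriesr => k _.
rewrite (eq_integral (cst (a k)%:E)) => [|t]; last first.
  by rewrite inE => /grid_cell_level ->.
rewrite integral_cst; last exact: measurable_itv.
rewrite mulrC EFinM; congr (_ * _)%E.
apply: (etrans (lebesgue_measure_itv `[dyad n k, dyad n k.+1[)); rewrite /= lte_fin dyadS.
by rewrite ltrDl mesh_gt0 -EFinB addrAC subrr add0r.
Qed.

Lemma integrable_exp (theta : R) : 0 < theta ->
  mu.-integrable D (EFin \o (fun t => expR (- theta * t))).
Proof.
move=> th0; have h : mu.-integrable D (EFin \o exponential_pdf theta).
  by apply: (integrableS _ _ _ (integrable_exponential_pdf th0)) => //; exact: measurable_itv.
have := @integrableZl _ _ _ mu D (measurable_itv _) theta^-1 _ h.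
apply: (@eq_integrable _ _ _ mu D (measurable_itv _)) => t; rewrite inE/= in_itv/= andbT => t0.
rewrite exponential_pdfE// -EFinM mulrA mulVf ?mul1r//; exact: lt0r_neq0.
Qed.

Lemma half_line_integrable (f : R -> R) theta : 0 < theta -> measurable_fun D f ->
  (forall t, 0 <= t -> `|f t| <= 1) ->
  mu.-integrable D (EFin \o (fun t => expR (- theta * t) * f t)).
Proof.
move=> th0 mf f1.
have m : measurable_fun D (EFin \o (fun t => expR (- theta * t) * f t)).
  apply/measurable_EFinP; apply: measurable_funM => //.
  by apply: measurable_funS (measurable_expRM (- theta)).
apply: (@le_integrable _ _ _ mu D (measurable_itv _) _ _ m _ (integrable_exp th0)).
move=> t; rewrite /= in_itv/= andbT => t0; rewrite lee_fin normrM ler_piMr//.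
exact: f1.
Qed.

Lemma half_line_dct (f_ : nat -> R -> R) (f : R -> R) theta : 0 < theta ->
  (forall n, measurable_fun D (f_ n)) -> measurable_fun D f ->
  (forall t, 0 <= t -> f_ n t @[n --> \oo] --> f t) ->
  (forall n t, 0 <= t -> `|f_ n t| <= expR (- theta * t)) ->
  \int[mu]_(t in D) f_ n t @[n --> \oo] --> \int[mu]_(t in D) f t.
Proof.
move=> th0 mf_ mf cf bf; have mD : measurable D by exact: measurable_itv.
have mf_' n : measurable_fun D (EFin \o f_ n) by exact/measurable_EFinP.
have mf' : measurable_fun D (EFin \o f) by exact/measurable_EFinP.
have [||i1 _ c] := @dominated_convergence _ _ _ mu D mD (fun n => EFin \o f_ n) (EFin \o f)
  (EFin \o (fun t => expR (- theta * t))) mf_' mf' _ (integrable_exp th0) _.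
- apply: aeW => t; rewrite /= in_itv/= andbT => t0.
  apply: cvg_EFin; [by apply: nearW|exact: cf].
- by apply: aeW => t n; rewrite /= in_itv/= andbT => t0; rewrite lee_fin bf.
apply: fine_cvg; rewrite fineK//; exact: integrable_fin_num.
Qed.

End half_line.

(** * Laplace transform in time of the averaged survival *)

Section mean_survival.
Context {R : realType} {d : measure_display} {Omega : measurableType d}
  {P : probability Omega R} (X : R -> {RV P >-> R}).
Hypothesis levyX : levy_process X.
Hypothesis posX : spectrally_positive X.
Local Notation psi := (dual_exponent X).
Variable beta : R.
Hypothesis beta_gt0 : 0 < beta.
Context {d' : measure_display} {T : measurableType d'} (Q : probability T R).
Variables (v y : T -> R).
Hypotheses (mv : measurable_fun setT v) (my : measurable_fun setT y).
Hypothesis v01 : forall x, 0 <= v x <= 1.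
Hypothesis vy : forall x, v x != 0 -> 0 < y x.
Local Notation mu := (@lebesgue_measure R).
Local Notation D := (`[0%R, +oo[%classic : set R).

(** Weight and starting point stay general because the sandwich needs a family of them:
    [weight alpha dl] with start x - dl, under the stationary law. *)
Definition mean_survival (t : R) : R := \int[Q]_x (v x * survival X beta (y x) t).

Definition mean_step n k : R := \int[Q]_x (v x * survival_step X beta n k (y x)).

Let prod01 (a b : R) : 0 <= a <= 1 -> 0 <= b <= 1 -> 0 <= a * b <= 1.
Proof.
move=> /andP[a0 a1] /andP[b0 b1]; rewrite mulr_ge0//= (le_trans _ a1)//.
by rewrite ler_piMr.
Qed.

Let measurable_mean_step_integrand n k :
  measurable_fun setT (fun x => v x * survival_step X beta n k (y x)).
Proof.
by apply: measurable_funM => //; apply: measurableT_comp => //; exact: measurable_survival_step.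
Qed.

Let measurable_mean_survival_integrand t : 0 <= t ->
  measurable_fun setT (fun x => v x * survival X beta (y x) t).
Proof.
move=> t0; apply: measurable_funM => //.
exact: (measurableT_comp (measurable_survival levyX beta_gt0 t0)).
Qed.

Let step_integrand01 n k x : 0 <= v x * survival_step X beta n k (y x) <= 1.
Proof. by apply: prod01 => //; exact: survival_step01. Qed.

Lemma mean_step01 n k : 0 <= mean_step n k <= 1.
Proof. by apply: prob_integral_le1. Qed.

Lemma mean_survival01 t : 0 <= t -> 0 <= mean_survival t <= 1.
Proof.
move=> t0; apply: prob_integral_le1; first exact: measurable_mean_survival_integrand.
by move=> x; apply: prod01 => //; exact: survival01.
Qed.

Lemma mean_step_cvg t : 0 <= t -> mean_step n (level n t) @[n --> \oo] --> mean_survival t.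
Proof.
move=> t0; apply: (@Rintegral_bct _ _ _ _ _ _ 1) => //.
- exact: measurable_mean_survival_integrand.
- by move=> x; apply: cvgMr; exact: survival_step_cvg.
- by move=> n x; have /andP[h1 h2] := step_integrand01 n (level n t) x; rewrite ger0_norm.
Qed.

Lemma measurable_mean_survival : measurable_fun D mean_survival.
Proof.
apply: (measurable_fun_cvg (fun n => measurable_step (mean_step n) n)) => t.
by rewrite /= in_itv/= andbT; exact: mean_step_cvg.
Qed.

Variables (theta phi : R).
Hypotheses (theta_gt0 : 0 < theta) (phi_gt0 : 0 < phi) (phiE : psi phi = theta).

(** The discount over one step. As psi phi = theta, it is the inverse of
    [laplace (step_law X n) phi], which is the condition on r in [passage_estimate]. *)
Let r n : R := expR (- theta * mesh n).

Let r_gt0 n : 0 < r n. Proof. exact: expR_gt0. Qed.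

Let r_lt1 n : r n < 1.
Proof. by rewrite -expR0 ltr_expR mulNr oppr_lt0 mulr_gt0// mesh_gt0. Qed.

Let L n : R := laplace (step_law X n) beta.

Let rL n : r n * L n = expR (mesh n * (psi beta - theta)).
Proof. by rewrite /r /L laplaceE ?(ltW beta_gt0)// -expRD; congr expR; ring. Qed.

Definition passage_limit : R := \int[Q]_x (v x * (expR (- beta * y x) - expR (- phi * y x))).

Let discounted n N : R := \sum_(k < N) r n ^+ k.+1 * mean_step n k.

Let passage_sumE n N x : passage_sum P (inc X n) x (r n) beta N =
  \sum_(k < N) r n ^+ k.+1 * survival_step X beta n k x.
Proof. by []. Qed.

Let measurable_vpassage n N : measurable_fun setT
  (fun x => v x * passage_sum P (inc X n) (y x) (r n) beta N).
Proof.
apply: measurable_funM => //; apply: measurable_sum => k; apply: measurable_funM => //.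
exact: (measurableT_comp (measurable_survival_step X beta n k) my).
Qed.

Let passage_le n N x : `|v x * passage_sum P (inc X n) (y x) (r n) beta N| <= N%:R.
Proof.
have /andP[v0 v1] := v01 x.
rewrite normrM (ger0_norm v0) (le_trans (ler_piMl _ v1))//.
rewrite passage_sumE (le_trans (ler_norm_sum _ _ _))//.
rewrite -[leRHS]mulr1 -[N in leRHS]card_ord mulrC mulr_natr -sumr_const ler_sum// => k _.
have /andP[h1 h2] := survival_step01 X beta_gt0 n k (y x).
rewrite ger0_norm ?mulr_ge0 ?exprn_ge0 ?(ltW (r_gt0 n))// mulr_ile1//.
  by rewrite exprn_ge0// ltW.
by rewrite exprn_ile1// ltW.
Qed.

Let mean_passage n N : discounted n N =
  \int[Q]_x (v x * passage_sum P (inc X n) (y x) (r n) beta N).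
Proof.
elim: N => [|N IHN].
  rewrite /discounted big_ord0; under eq_Rintegral do rewrite passage_sumE big_ord0 mulr0.
  by rewrite Rintegral_cst_prob.
rewrite /discounted big_ord_recr/= -/(discounted n N) IHN /mean_step -RintegralZl//; last first.
  apply: (@bounded_integrable _ _ _ _ _ 1) => // x.
  by have /andP[h1 h2] := step_integrand01 n N x; rewrite ger0_norm.
rewrite -RintegralD//.
- apply: eq_Rintegral => x _; rewrite !passage_sumE big_ord_recr/=; ring.
- exact: (bounded_integrable Q (measurable_vpassage n N) (passage_le n N)).
- apply: integrable_EFinZl; apply: (@bounded_integrable _ _ _ _ _ 1) => // x.
  by have /andP[h1 h2] := step_integrand01 n N x; rewrite ger0_norm.
Qed.

Let E n (e : R) : R := (expR (beta * e) - 1) + (expR (phi * e) - 1) +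
  (jump_tail (step_law X n) beta e + jump_tail (step_law X n) phi e) / (1 - r n) +
  2 * `|1 - r n * L n|.

Lemma measurable_passage_integrand : measurable_fun setT
  (fun x => v x * (expR (- beta * y x) - expR (- phi * y x))).
Proof.
apply: measurable_funM => //; apply: measurable_funB.
  exact: (measurableT_comp (measurable_expRM (- beta)) my).
exact: (measurableT_comp (measurable_expRM (- phi)) my).
Qed.

Lemma passage_integrand_le1 x :
  `|v x * (expR (- beta * y x) - expR (- phi * y x))| <= 1.
Proof.
have [->|vx] := eqVneq (v x) 0; first by rewrite mul0r normr0.
have y0 := vy vx; have /andP[v0 v1] := v01 x.
rewrite normrM (ger0_norm v0) mulr_ile1//.
have h b : 0 < b -> 0 < expR (- b * y x) <= 1.
  by move=> b0; rewrite expR_gt0/= -expR0 ler_expR mulNr oppr_le0 mulr_ge0// ltW.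
by have := h _ beta_gt0; have := h _ phi_gt0; rewrite ler_norml; lra.
Qed.

Let mean_estimate n N e : 0 <= e ->
  `|(1 - r n * L n) * discounted n N - passage_limit| <= 2 * r n ^+ N + E n e.
Proof.
move=> e0.
have i1 := bounded_integrable Q (measurable_vpassage n N) (passage_le n N).
have i2 := bounded_integrable Q measurable_passage_integrand passage_integrand_le1.
have i3 := integrable_EFinZl (1 - r n * L n) i1.
have i4 := integrableB measurableT i3 i2.
rewrite mean_passage -RintegralZl// -RintegralB//.
have E0 : 0 <= 2 * r n ^+ N + E n e.
  rewrite /E addr_ge0 ?mulr_ge0 ?exprn_ge0 ?(ltW (r_gt0 n))//.
  have hb b : 0 < b -> 0 <= expR (b * e) - 1.
    by move=> b0; rewrite subr_ge0 -expR0 ler_expR mulr_ge0// ltW.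
  apply: addr_ge0; last by rewrite mulr_ge0.
  apply: addr_ge0; first by apply: addr_ge0; exact: hb.
  by rewrite divr_ge0 ?subr_ge0 ?(ltW (r_lt1 n))// addr_ge0// jump_tail_ge0// ltW.
apply: le_trans (le_normr_Rintegral _ _) _ => //.
rewrite -[leRHS](Rintegral_cst_prob Q); apply: le_Rintegral => //.
- exact: integrable_abse i4.
- exact: finite_measure_integrable_cst.
move=> x _; rewrite mulrCA -mulrBr; have /andP[v0 v1] := v01 x.
have [->|vx] := eqVneq (v x) 0; first by rewrite mul0r normr0.
rewrite normrM (ger0_norm v0) (le_trans (ler_piMl _ v1))//.
have lp : r n * laplace (step_law X n) phi = 1.
  by rewrite laplaceE ?(ltW phi_gt0)// phiE /r -expRD mulNr mulrC addNr expR0.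
have := passage_estimate (measurable_inc X n) (inc_ind levyX n) (step_mgf levyX posX n)
  (vy vx) N (r_gt0 n) (r_lt1 n) (ltW beta_gt0) (ltW phi_gt0) e0 lp.
by rewrite /E !addrA.
Qed.

(** Constant on grid cells, with integral the mesh times the infinite discounted sum. The discount
    is that of the grid point to the right of t, so exp(-theta t) dominates. *)
Let f_ n (t : R) : R := r n ^+ (level n t).+1 * mean_step n (level n t).

Let f_E n t : f_ n t = expR (- theta * next_dyad n t) * mean_step n (level n t).
Proof.
congr (_ * _); rewrite /r -expRM_natl; congr expR.
by rewrite /next_dyad /dyad mulrCA.
Qed.

Let f_ge0 n k : 0 <= r n ^+ k.+1 * mean_step n k.
Proof. by have /andP[h _] := mean_step01 n k; rewrite mulr_ge0// exprn_ge0// ltW. Qed.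

Let f_le n t : 0 <= t -> `|f_ n t| <= expR (- theta * t).
Proof.
move=> t0; rewrite ger0_norm; last exact: f_ge0.
rewrite f_E; have /andP[_ h] := mean_step01 n (level n t).
rewrite (le_trans (ler_piMr _ h)) ?expR_ge0// ler_expR !mulNr lerN2.
by rewrite ler_wpM2l ?(ltW theta_gt0)// ltW// next_dyad_gt.
Qed.

Let mf_ n : measurable_fun D (f_ n).
Proof. exact: measurable_step (fun k => r n ^+ k.+1 * mean_step n k) n. Qed.

Let discounted_cvg n :
  mesh n * discounted n N @[N --> \oo] --> \int[mu]_(t in D) f_ n t.
Proof.
have fi : mu.-integrable D (EFin \o f_ n).
  have m : measurable_fun D (EFin \o f_ n) by exact/measurable_EFinP.
  apply: (@le_integrable _ _ _ mu D (measurable_itv _) _ _ m _ (integrable_exp theta_gt0)).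
  move=> t; rewrite /= in_itv/= andbT => t0; rewrite lee_fin (ger0_norm (expR_ge0 _)).
  exact: f_le.
have := step_integral n (f_ge0 n).
rewrite -[X in X = _ -> _]/(\int[mu]_(t in D) (EFin \o f_ n) t)%E => sE.
apply: (@fine_cvg _ _ _ _ (fun N => (mesh n * discounted n N)%:E)); rewrite fineK//; last first.
  by apply: integrable_fin_num => //; exact: measurable_itv.
rewrite sE.
have h k : (0 <= k)%N -> true -> (0 <= (mesh n * (r n ^+ k.+1 * mean_step n k))%:E)%E.
  by move=> _ _; rewrite lee_fin mulr_ge0// ltW// mesh_gt0.
have cs := is_cvg_nneseries h.
rewrite (_ : (fun N => _) = (fun N => \sum_(0 <= k < N) (mesh n * (r n ^+ k.+1 * mean_step n k))%:E)%E).
  exact: cs.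
apply/funext => N; rewrite sumEFin /discounted mulr_sumr; congr EFin; exact/esym/big_mkord.
Qed.

Let time_cvg : \int[mu]_(t in D) f_ n t @[n --> \oo] -->
  \int[mu]_(t in D) (expR (- theta * t) * mean_survival t).
Proof.
apply: (half_line_dct theta_gt0) => //.
- apply: measurable_funM; last exact: measurable_mean_survival.
  by apply: measurable_funS (measurable_expRM (- theta)).
- move=> t t0; under eq_fun do rewrite f_E.
  apply: cvgM; last exact: mean_step_cvg.
  apply: (cvg_comp _ expR _ (@continuous_expR R _)); apply: cvgMr.
  exact: next_dyad_cvg.
Qed.

(** [mean_estimate] in the limit N to infinity, which removes r^N, then n to infinity, which removes
    the jump tails and the factor 1 - r L, then e to 0. *)
Lemma mean_survival_transform :
  (theta - psi beta) * \int[mu]_(t in D) (expR (- theta * t) * mean_survival t) = passage_limit.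
Proof.
set V := \int[mu]_(t in D) _.
have p2 n : 0 < 2 ^+ n :> R by rewrite exprn_gt0.
have sL : 2 ^+ n * (1 - r n * L n) @[n --> \oo] --> theta - psi beta.
  rewrite -[X in _ --> X]opprB; have /cvgN := @expR_slope_cvg R (psi beta - theta).
  apply: cvg_trans; apply: near_eq_cvg; apply: nearW => n.
  by rewrite rL /= -mulrN opprB.
have sr : 2 ^+ n * (1 - r n) @[n --> \oo] --> theta.
  rewrite -[X in _ --> X]opprK; have /cvgN := @expR_slope_cvg R (- theta).
  apply: cvg_trans; apply: near_eq_cvg; apply: nearW => n.
  by rewrite /r (mulrC _ (mesh n)) -opprB mulrN.
have n_est n e : 0 <= e -> `|2 ^+ n * (1 - r n * L n) * \int[mu]_(t in D) f_ n t - passage_limit| <= E n e.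
  move=> e0.
  have c1 : `|(1 - r n * L n) * discounted n N - passage_limit| @[N --> \oo] -->
      `|2 ^+ n * (1 - r n * L n) * \int[mu]_(t in D) f_ n t - passage_limit|.
    apply: cvg_norm; apply: cvgB; last exact: cvg_cst.
    rewrite (_ : (fun N => _) =
        (fun N => 2 ^+ n * (1 - r n * L n) * (mesh n * discounted n N))).
      by apply: cvgMr; exact: discounted_cvg.
    by apply/funext => N; rewrite mulrACA /mesh mulfV ?mul1r// gt_eqF.
  have c2 : 2 * r n ^+ N + E n e @[N --> \oo] --> 2 * 0 + E n e.
    apply: cvgD; last exact: cvg_cst.
    by apply: cvgMr; apply: cvg_expr; rewrite ger0_norm ?(ltW (r_gt0 n)).
  rewrite mulr0 add0r in c2.
  by apply: (ler_cvg_to c1 c2); apply: nearW => N; exact: mean_estimate.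
have lim_est e : 0 < e -> `|(theta - psi beta) * V - passage_limit| <=
    (expR (beta * e) - 1) + (expR (phi * e) - 1).
  move=> e0.
  have c1 : `|2 ^+ n * (1 - r n * L n) * \int[mu]_(t in D) f_ n t - passage_limit| @[n --> \oo]
     --> `|(theta - psi beta) * V - passage_limit|.
    by apply: cvg_norm; apply: cvgB; [apply: cvgM => //; exact: time_cvg|exact: cvg_cst].
  have c2 : E n e @[n --> \oo] --> (expR (beta * e) - 1) + (expR (phi * e) - 1) +
     (0 + 0) / theta + 2 * `|(0 : R)|.
    apply: cvgD; last first.
      apply: cvgMr; apply: cvg_norm.
      rewrite -(mul0r (theta - psi beta)).
      rewrite (_ : (fun n => _) = (fun n => mesh n * (2 ^+ n * (1 - r n * L n)))).
        by apply: cvgM => //; exact: mesh_cvg0.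
      by apply/funext => n; rewrite mulrA /mesh mulVf ?mul1r// gt_eqF.
    apply: cvgD; first exact: cvg_cst.
    (* Numerator and denominator both vanish; scaled by 2^n they tend to 0 and to theta. *)
    rewrite (_ : (fun n => _) = (fun n => (2 ^+ n * jump_tail (step_law X n) beta e +
        2 ^+ n * jump_tail (step_law X n) phi e) / (2 ^+ n * (1 - r n)))).
      apply: cvgM; last by apply: cvgV => //; rewrite gt_eqF.
      by apply: cvgD; apply: jump_tail_cvg0 => //; exact: ltW.
    by apply/funext => n; rewrite -mulrDr invfM mulrACA mulfV ?mul1r// gt_eqF.
  rewrite addr0 mul0r normr0 mulr0 !addr0 in c2.
  by apply: (ler_cvg_to c1 c2); apply: nearW => n; apply: n_est; exact: ltW.
have c : (expR (beta * n.+1%:R^-1) - 1) + (expR (phi * n.+1%:R^-1) - 1) @[n --> \oo] --> (0 : R).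
  have cb b : expR (b * n.+1%:R^-1) - 1 @[n --> \oo] --> (0 : R).
    rewrite -[X in _ --> X](subrr 1); apply: cvgB; last exact: cvg_cst.
    rewrite -[X in _ --> X]expR0 -(mulr0 b).
    apply: (cvg_comp _ expR _ (@continuous_expR R _)); apply: cvgMr; exact: cvg_harmonic.
  by rewrite -[X in _ --> X](addr0 0); apply: cvgD.
apply/eqP; rewrite -subr_eq0 -normr_le0.
by apply: (cvgn_ge c) => n; apply: lim_est; rewrite invr_gt0.
Qed.

End mean_survival.

(** * Comparing integrals of functions not known to be measurable *)

Section integral_monotone.
Context {d : measure_display} {T : measurableType d} {R : realType}
  (mu : {measure set T -> \bar R}).
Implicit Types f g : T -> \bar R.

(* As a supremum over the simple functions below the integrand, the integral is
   monotone without any measurability assumption. *)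
Lemma nonmeasurable_le_integral (D : set T) f g :
  (forall x, D x -> (0 <= f x)%E) -> (forall x, D x -> (f x <= g x)%E) ->
  (\int[mu]_(x in D) f x <= \int[mu]_(x in D) g x)%E.
Proof.
move=> f0 fg; rewrite integral_mkcond [leRHS]integral_mkcond.
have h x : (0 <= (f \_ D) x <= (g \_ D) x)%E.
  rewrite /patch; case: ifPn => [|_]; last by rewrite lexx.
  by rewrite inE => xD; rewrite f0//= fg.
rewrite !ge0_integralTE => [|x|x]; last 2 first.
- by have /andP[h1 h2] := h x; exact: le_trans h2.
- by have /andP[] := h x.
apply: ereal_sup_le => _ [k /= kf <-]; exists k => // x.
by have /andP[_ h2] := h x; exact: le_trans (kf x) h2.
Qed.

(** Only g is measurable, so the exceptional null set is absorbed on its side: raising g to +oo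
    there leaves its integral unchanged and makes the inequality hold everywhere. *)
Lemma le_integral_ae f g : (forall x, (0 <= f x)%E) -> (forall x, (0 <= g x)%E) ->
  measurable_fun setT g -> {ae mu, forall x, (f x <= g x)%E} ->
  (\int[mu]_x f x <= \int[mu]_x g x)%E.
Proof.
move=> f0 g0 mg [N [mN N0 sN]].
pose g' x := (g x + (\1_N x)%:E * +oo)%E.
have mg' : measurable_fun setT g'.
  apply: emeasurable_funD => //; apply: emeasurable_funM => //.
  by apply/measurable_EFinP; exact: measurable_indic.
have gg' x : (g x <= g' x)%E.
  by rewrite /g' leeDl// mule_ge0// lee_fin.
have -> : (\int[mu]_x g x = \int[mu]_x g' x)%E.
  apply: ge0_ae_eq_integral => //.
    by move=> x _; exact: le_trans (gg' x).
  exists N; split => // x /= xN; apply: contrapT => nN; apply: xN => _.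
  by rewrite /g' indicE memNset// mul0e adde0.
apply: nonmeasurable_le_integral => // x _.
have [xN|xN] := pselect (N x).
  by rewrite /g' indicE mem_set// mul1e addey ?leey// gt_eqF// (lt_le_trans _ (g0 x))// ltNy0.
apply: le_trans (gg' x); apply: contrapT => h; exact/xN/sN.
Qed.

(** Here the null set is removed from the domain of integration of g, the measurable side. *)
Lemma ge_integral_ae f g : (forall x, (0 <= f x)%E) -> (forall x, (0 <= g x)%E) ->
  measurable_fun setT g -> {ae mu, forall x, (g x <= f x)%E} ->
  (\int[mu]_x g x <= \int[mu]_x f x)%E.
Proof.
move=> f0 g0 mg [N [mN N0 sN]].
rewrite (ge0_negligible_integral _ measurableT mg _ N0)//.
rewrite [leLHS]integral_mkcond; apply: nonmeasurable_le_integral => x _.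
  by rewrite /patch; case: ifP.
rewrite /patch; case: ifPn => [|_]; last exact: f0.
rewrite inE => -[_ xN]; apply: contrapT => h; exact/xN/sN.
Qed.

End integral_monotone.

(** * The busy period in terms of positivity of the path *)

Section busy_period.
Context {R : realType} {d : measure_display} {Omega : measurableType d}
  {P : probability Omega R} (X : R -> {RV P >-> R}).
Hypothesis levyX : levy_process X.
Hypothesis posX : spectrally_positive X.

Definition alive_until (x t : R) (w : Omega) : Prop := forall s, 0 <= s <= t -> 0 < x + X s w.

Lemma workload_alive x t w : 0 <= t -> (forall s, 0 <= s <= t -> 0 <= x + X s w) ->
  workload X x t w = x + X t w.
Proof.
move=> t0 H; rewrite /workload.
have h : 0 <= inf [set x + X s w | s in `[0, t]].
  apply: lb_le_inf; first by exists (x + X t w), t => //=; rewrite in_itv/= t0 lexx.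
  by move=> z [s /= + <-]; rewrite in_itv/= => st; exact: H.
by rewrite (min_idPl h) subr0.
Qed.

Lemma workload_hit x t w : 0 <= t -> (forall s, 0 <= s < t -> 0 < x + X s w) ->
  x + X t w <= 0 -> workload X x t w = 0.
Proof.
move=> t0 H xt; rewrite /workload.
have -> : inf [set x + X s w | s in `[0, t]] = x + X t w.
  have lb : lbound [set x + X s w | s in `[0, t]] (x + X t w).
    move=> z [s /= + <-]; rewrite in_itv/= => /andP[s0 st].
    move: st; rewrite le_eqVlt => /orP[/eqP->//|st].
    by apply: le_trans xt _; apply/ltW/H; rewrite s0.
  have mem : [set x + X s w | s in `[0, t]] (x + X t w).
    by exists t => //=; rewrite in_itv/= t0 lexx.
  apply/eqP; rewrite eq_le; apply/andP; split.
    by apply: ge_inf => //; exists (x + X t w).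
  by apply: lb_le_inf => //; exists (x + X t w).
by rewrite (min_idPr xt) subrr.
Qed.

(** The infimum of the hitting times is itself one: a positive value there would, by
    right-continuity, stay positive for a while. *)
Lemma first_hit x t w : 0 <= t -> x + X t w <= 0 ->
  exists s, [/\ 0 <= s, s <= t, x + X s w <= 0 & forall u, 0 <= u < s -> 0 < x + X u w].
Proof.
move=> t0 xt; pose H := [set s | 0 <= s /\ x + X s w <= 0].
have Ht : H t by [].
have lbH : lbound H 0 by move=> s [].
have hasH : has_inf H by split; [exists t|exists 0].
have s0 : 0 <= inf H by apply: lb_le_inf => //; exists t.
exists (inf H); split => //.
- by apply: ge_inf => //; exists 0.
- rewrite leNgt; apply/negP => xs.
  have [dl dl0 hdl] := right_delta levyX w s0 xs.
  have [u [u0 xu] us] := inf_adherent dl0 hasH.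
  have hu : inf H <= u by apply: ge_inf => //; exists 0.
  by have := hdl u hu us; rewrite ltr_norml; lra.
- move=> u /andP[u0 us]; rewrite ltNge; apply/negP => xu.
  by move: us; rewrite ltNge => /negP; apply; apply: ge_inf => //; exists 0.
Qed.

(** Positivity on [0, t] extends beyond t by right-continuity, which makes the inequality strict;
    conversely the workload vanishes at the first time the path is nonpositive. *)
Lemma lt_busy_period x t w : 0 <= t ->
  (t%:E < busy_period X x w)%E <-> alive_until x t w.
Proof.
move=> t0; split => [tb s /andP[s0 st]|A].
  rewrite ltNge; apply/negP => /(first_hit s0)[u [u0 us xu hu]].
  suff : (busy_period X x w <= t%:E)%E by rewrite leNgt tb.
  apply: (@le_trans _ _ u%:E); last by rewrite lee_fin (le_trans us).
  by apply: ereal_inf_lbound; exists u => //; split => //; exact: workload_hit.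
have xt : 0 < x + X t w by apply: A; rewrite t0 lexx.
have [dl dl0 hdl] := right_delta levyX w t0 xt.
have A' s : 0 <= s -> s < t + dl -> 0 < x + X s w.
  move=> s0 sd; have [st|ts] := leP s t; first by apply: A; rewrite s0.
  by have := hdl s (ltW ts) sd; rewrite ltr_norml; lra.
apply: (@lt_le_trans _ _ (t + dl)%:E); first by rewrite lte_fin ltrDl.
apply: le_ereal_inf_tmp => _ [s [s0 ws] <-]; rewrite lee_fin leNgt; apply/negP => sd.
have := A' s s0 sd; rewrite -(@workload_alive x s w s0) ?ws ?ltxx// => u /andP[u0 us].
by apply/ltW/A' => //; exact: le_lt_trans us sd.
Qed.

Lemma alive_until_dyadic x t w : X 0 w = 0 -> alive_until x t w -> dyadic_alive X x t w.
Proof.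
by move=> X0 A n j jt; rewrite X0 subr0; apply: A; rewrite dyad_ge0.
Qed.

(* Right-continuity bounds the path below before t, and the absence of negative
   jumps bounds it below at t. *)
Lemma dyadic_alive_until x dl t w : 0 <= t -> 0 < dl -> X 0 w = 0 ->
  no_negative_jumps (fun s => X s w) ->
  dyadic_alive X (x - dl) t w -> alive_until x t w.
Proof.
move=> t0 dl0 X0 nj A.
have before s : 0 <= s -> s < t -> dl - x <= X s w.
  move=> s0 st; have c := @X_next_dyad_cvg _ _ _ _ _ levyX w s s0.
  rewrite -(cvg_lim _ c)//; apply: limr_ge; first by apply/cvg_ex; exists (X s w).
  have ct : \forall n \near \oo, next_dyad n s < t by apply: (cvgr_lt _ (next_dyad_cvg s0)).
  apply: filterS ct => n /ltW nt.
  by have := A n _ nt; rewrite X0; lra.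
have at_t : dl - x <= X t w.
  have [->|tn0] := eqVneq t 0.
    by have := A 0%N 0%N; rewrite dyad0 => /(_ t0); rewrite subrr X0; lra.
  have t0' : 0 < t by rewrite lt_neqAle eq_sym tn0.
  apply: le_trans (nj t t0'); have [_ _ _ /(_ w)[_ /(_ t t0') c]] := levyX.
  apply: limr_ge => //; near=> s; apply: before; last by near: s; exact: nbhs_left_lt.
  by apply/ltW; near: s; exact: nbhs_left_gt.
move=> s /andP[s0]; rewrite le_eqVlt => /orP[/eqP->|st]; first by lra.
by have := before s s0 st; lra.
Unshelve. all: by end_near. Qed.

Variables (alpha beta : R).
Hypotheses (alpha_gt0 : 0 < alpha) (beta_gt0 : 0 < beta).

Let integrand x t w : R := expR (- alpha * workload X x 0 w - beta * workload X x t w)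
  * \1_[set w | (t%:E < busy_period X x w)%E] w.

Let integrandE x t w : 0 <= t -> X 0 w = 0 -> alive_until x t w ->
  integrand x t w = expR (- alpha * x) * expR (- beta * (x + X t w)).
Proof.
move=> t0 X0 A; rewrite /integrand indicE mem_set ?mulr1; last exact/lt_busy_period.
have A0 s : 0 <= s <= t -> 0 <= x + X s w by move=> /A/ltW.
rewrite (workload_alive t0 A0) (@workload_alive x 0 w) ?X0 ?addr0 ?lexx//.
  by rewrite -expRD !mulNr.
by move=> s /andP[s0 st]; apply: A0; rewrite s0 (le_trans st).
Qed.

Let integrand0 x t w : 0 <= t -> ~ alive_until x t w -> integrand x t w = 0.
Proof.
move=> t0 A; rewrite /integrand indicE memNset ?mulr0// => /= tb; apply: A.
exact/lt_busy_period.
Qed.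

Let integrand_ge0 x t w : 0 <= integrand x t w.
Proof. by rewrite mulr_ge0// expR_ge0. Qed.

(** The open end makes the lowered start x - dl positive wherever the weight is nonzero; for dl = 0
    it discards x = 0, where the busy period is over at once. *)
Definition weight (dl x : R) : R := expR (- alpha * x) * \1_(`]dl, +oo[%classic : set R) x.

Lemma measurable_weight dl : measurable_fun setT (weight dl).
Proof.
apply: measurable_funM; first exact: measurable_expRM.
by apply: measurable_indic; exact: measurable_itv.
Qed.

Lemma weight01 dl x : 0 <= dl -> 0 <= weight dl x <= 1.
Proof.
move=> dl0; rewrite /weight indicE; case: (boolP (x \in _)); rewrite ?mulr0 ?mulr1 ?lexx ?ler01//.
rewrite inE/= in_itv/= andbT => /ltW dx; rewrite expR_ge0/= -expR0 ler_expR mulNr oppr_le0.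
by rewrite mulr_ge0 ?(ltW alpha_gt0)// (le_trans dl0).
Qed.

Lemma weight_neq0 dl x : weight dl x != 0 -> 0 < x - dl.
Proof.
rewrite /weight indicE subr_gt0; case: (boolP (x \in _)); last by rewrite mulr0 eqxx.
by rewrite inE/= in_itv/= andbT.
Qed.

Lemma busy_transform_at_le x t : 0 <= t ->
  (busy_transform_at X alpha beta t x <= (weight 0 x * survival X beta (x - 0) t)%:E)%E.
Proof.
move=> t0; have [X00 _ _ _] := levyX.
pose g w := weight 0 x * (expR (- beta * Num.max 0 (x - 0 + (X t w - X 0 w)))
  * \1_(dyadic_alive X (x - 0) t) w).
have w0 : 0 <= weight 0 x by have /andP[] := @weight01 0 x (lexx 0).
have mi := measurable_survival_integrand X beta (x - 0) t.
have mg : measurable_fun setT g by apply: measurable_funM.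
have ii := bounded_integrable P mi
  (fun w => survival_integrand_le1 beta_gt0 (x - 0 + (X t w - X 0 w)) _ w).
rewrite /busy_transform_at unlock /survival -RintegralZl// -(Rintegral_EFin (integrable_EFinZl _ ii)).
apply: le_integral_ae.
- by move=> w; rewrite lee_fin; exact: integrand_ge0.
- by move=> w; rewrite lee_fin mulr_ge0// mulr_ge0 ?expR_ge0.
- exact/measurable_EFinP.
apply: filterS X00 => w X0; rewrite lee_fin -/(integrand x t w).
have [A|A] := pselect (alive_until x t w); last first.
  by rewrite integrand0// mulr_ge0// mulr_ge0 ?expR_ge0.
have x0 : 0 < x by have := A 0; rewrite lexx t0 X0 addr0; exact.
rewrite integrandE// /weight !indicE !mem_set/=; last 2 first.
- by rewrite subr0; exact: alive_until_dyadic.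
- by rewrite in_itv/= x0.
have xt : 0 < x + X t w by apply: A; rewrite t0 lexx.
by rewrite !mulr1 X0 !subr0 (max_idPr (ltW xt)).
Qed.

(** The path lowered by dl survives less often, but its exponential is larger by exp(beta dl); the
    prefactor compensates for this. *)
Lemma busy_transform_at_ge x t dl : 0 <= t -> 0 < dl ->
  ((expR (- beta * dl) * (weight dl x * survival X beta (x - dl) t))%:E
   <= busy_transform_at X alpha beta t x)%E.
Proof.
move=> t0 dl0; have [X00 _ _ _] := levyX.
pose c := expR (- beta * dl) * weight dl x.
have w0 : 0 <= weight dl x by have /andP[] := @weight01 dl x (ltW dl0).
have c0 : 0 <= c by rewrite mulr_ge0// expR_ge0.
pose g w := c * (expR (- beta * Num.max 0 (x - dl + (X t w - X 0 w)))
  * \1_(dyadic_alive X (x - dl) t) w).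
have mi := measurable_survival_integrand X beta (x - dl) t.
have mg : measurable_fun setT g by apply: measurable_funM.
have ii := bounded_integrable P mi
  (fun w => survival_integrand_le1 beta_gt0 (x - dl + (X t w - X 0 w)) _ w).
rewrite mulrA -/c /busy_transform_at unlock /survival -RintegralZl//.
rewrite -(Rintegral_EFin (integrable_EFinZl _ ii)).
apply: ge_integral_ae.
- by move=> w; rewrite lee_fin; exact: integrand_ge0.
- by move=> w; rewrite lee_fin mulr_ge0// mulr_ge0 ?expR_ge0.
- exact/measurable_EFinP.
move: X00 posX; apply: filterS2 => w X0 nj; rewrite lee_fin -/(integrand x t w).
rewrite /c /weight !indicE.
case: (boolP (w \in _)) => [|_]; last by rewrite !mulr0.
rewrite inE => A; have Aw := dyadic_alive_until t0 dl0 X0 nj A.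
case: (boolP (x \in _)) => [_|_]; last by rewrite !(mulr0, mul0r).
rewrite integrandE//= !mulr1 X0 subr0 (mulrC (expR (- beta * dl))) -mulrA ler_wpM2l ?expR_ge0//.
rewrite -expRD ler_expR -mulrDr !mulNr lerN2 ler_wpM2l ?(ltW beta_gt0)//.
have : x - dl + X t w <= Num.max 0 (x - dl + X t w) by rewrite le_max lexx orbT.
lra.
Qed.

End busy_period.

(** * The sandwich in dl and the closed formula *)

Section transform.
Context {R : realType} {d : measure_display} {Omega : measurableType d}
  {P : probability Omega R} (X : R -> {RV P >-> R}).
Hypothesis levyX : levy_process X.
Hypothesis posX : spectrally_positive X.
Hypothesis driftX : ('E_P[X 1%R] < 0)%E.
Local Notation psi := (dual_exponent X).
Local Notation Phi := (dual_inverse X).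
Variables (alpha beta : R).
Hypotheses (alpha_gt0 : 0 < alpha) (beta_gt0 : 0 < beta).
Local Notation mu := (@lebesgue_measure R).
Local Notation D := (`[0%R, +oo[%classic : set R).

Definition stationary_prob : probability R R :=
  distribution P (mfun_Sub (mem_set (measurable_all_time_sup levyX))).
Local Notation Q := stationary_prob.

(* A version of E_pi[exp(-alpha Q(0) - beta Q(t)), T > t] in which the path is
   observed at dyadic times only and has to stay above dl. *)
Definition shifted_transform (dl t : R) : R :=
  mean_survival X beta Q (weight alpha dl) (fun x => x - dl) t.
Local Notation A := shifted_transform.

Let mshift dl : measurable_fun setT (fun x : R => x - dl).
Proof. exact: measurable_funB. Qed.

Let A01 dl t : 0 <= dl -> 0 <= t -> 0 <= A dl t <= 1.
Proof.
move=> dl0 t0; apply: mean_survival01 => //; first exact: measurable_weight.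
by move=> x; exact: weight01.
Qed.

Let mA dl : 0 <= dl -> measurable_fun D (A dl).
Proof.
move=> dl0; apply: measurable_mean_survival => //; first exact: measurable_weight.
by move=> x; exact: weight01.
Qed.

Let survival_integrable dl t : 0 <= dl -> 0 <= t ->
  Q.-integrable setT (EFin \o (fun x => weight alpha dl x * survival X beta (x - dl) t)).
Proof.
move=> dl0 t0; apply: (@bounded_integrable _ _ _ _ _ 1).
  apply: measurable_funM; first exact: measurable_weight.
  exact: (measurableT_comp (measurable_survival levyX beta_gt0 t0)).
move=> x; have /andP[w0 w1] := weight01 alpha_gt0 x dl0.
have /andP[s0 s1] := survival01 X beta_gt0 (x - dl) t.
by rewrite ger0_norm ?mulr_ge0// mulr_ile1.
Qed.

Let busy_transform_at_ge0 t x : (0 <= busy_transform_at X alpha beta t x)%E.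
Proof.
rewrite /busy_transform_at unlock; apply: integral_ge0 => w _.
by rewrite lee_fin mulr_ge0// expR_ge0.
Qed.

Let busy_transformE t : busy_transform X alpha beta t =
  (\int[Q]_(x in D) busy_transform_at X alpha beta t x)%E.
Proof. by []. Qed.

Let busy_transform_ge0 t : (0 <= busy_transform X alpha beta t)%E.
Proof. by rewrite busy_transformE; exact: integral_ge0. Qed.

Let busy_transform_le t : 0 <= t -> (busy_transform X alpha beta t <= (A 0 t)%:E)%E.
Proof.
move=> t0; rewrite busy_transformE /A /mean_survival -(Rintegral_EFin (survival_integrable (lexx 0) t0)).
rewrite integral_mkcond; apply: nonmeasurable_le_integral => x _.
  by rewrite /patch; case: ifP.
rewrite /patch; case: ifPn => _; first exact: busy_transform_at_le.
have /andP[w0 _] := weight01 alpha_gt0 x (lexx 0).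
have /andP[s0 _] := survival01 X beta_gt0 (x - 0) t.
by rewrite lee_fin mulr_ge0.
Qed.

Let busy_transform_ge dl t : 0 < dl -> 0 <= t ->
  ((expR (- beta * dl) * A dl t)%:E <= busy_transform X alpha beta t)%E.
Proof.
move=> dl0 t0; have si := survival_integrable (ltW dl0) t0.
rewrite busy_transformE /A /mean_survival -RintegralZl//.
rewrite -(Rintegral_EFin (integrable_EFinZl _ si)).
rewrite [leRHS]integral_mkcond; apply: nonmeasurable_le_integral => x _.
  have /andP[w0 _] := weight01 alpha_gt0 x (ltW dl0).
  have /andP[s0 _] := survival01 X beta_gt0 (x - dl) t.
  by rewrite lee_fin !mulr_ge0// expR_ge0.
rewrite /patch; case: ifPn => [_|]; first exact: busy_transform_at_ge.
rewrite notin_setE/= in_itv/= andbT => x0.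
rewrite /weight indicE memNset ?(mulr0, mul0r)//= in_itv/= andbT => dx; apply: x0.
by rewrite ltW// (lt_trans dl0).
Qed.

Let V dl th : R := \int[mu]_(t in D) (expR (- th * t) * A dl t).

Let lhs th : \bar R :=
  (\int[mu]_(t in D) ((expR (- th * t))%:E * busy_transform X alpha beta t))%E.

Let iA dl th : 0 <= dl -> 0 < th ->
  mu.-integrable D (EFin \o (fun t => expR (- th * t) * A dl t)).
Proof.
move=> dl0 th0; apply: half_line_integrable => //; first exact: mA.
by move=> t t0; have /andP[h1 h2] := A01 dl0 t0; rewrite ger0_norm.
Qed.

Let VE dl th : 0 <= dl -> 0 < th ->
  (\int[mu]_(t in D) (expR (- th * t) * A dl t)%:E = (V dl th)%:E)%E.
Proof.
move=> dl0 th0; rewrite /V /Rintegral fineK//.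
exact: (@integrable_fin_num _ _ _ mu D (measurable_itv _) _ (iA dl0 th0)).
Qed.

Let inD t : D t -> 0 <= t. Proof. by rewrite /= in_itv/= andbT. Qed.

Let lhs_le th : 0 < th -> (lhs th <= (V 0 th)%:E)%E.
Proof.
move=> th0; rewrite -VE//; apply: nonmeasurable_le_integral => t /inD t0.
  by rewrite mule_ge0// lee_fin expR_ge0.
rewrite EFinM lee_pmul2l ?lte_fin ?expR_gt0//; exact: busy_transform_le.
Qed.

Let lhs_ge dl th : 0 < dl -> 0 < th -> ((expR (- beta * dl) * V dl th)%:E <= lhs th)%E.
Proof.
move=> dl0 th0; rewrite EFinM -VE ?(ltW dl0)//.
rewrite -(@integralZl _ _ _ mu D (measurable_itv _) _ (iA (ltW dl0) th0)).
apply: nonmeasurable_le_integral => t /inD t0.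
  have /andP[h _] := A01 (ltW dl0) t0.
  by rewrite lee_fin !mulr_ge0// expR_ge0.
rewrite -EFinM mulrCA EFinM lee_pmul2l ?lte_fin ?expR_gt0//; exact: busy_transform_ge.
Qed.

Let gap dl th := V 0 th - expR (- beta * dl) * V dl th.

Let gapE dl th : 0 <= dl -> 0 < th -> gap dl th =
  \int[mu]_(t in D) (expR (- th * t) * A 0 t - expR (- beta * dl) * (expR (- th * t) * A dl t)).
Proof.
move=> dl0 th0; have i1 := iA (lexx 0) th0; have i2 := iA dl0 th0.
have i3 := @integrableZl _ _ _ mu D (measurable_itv _) (expR (- beta * dl)) _ i2.
rewrite /gap /V -(@RintegralZl _ _ _ mu D _ _ (measurable_itv _) i2).
by rewrite -(@RintegralB _ _ _ mu D _ _ (measurable_itv _) i1 i3).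
Qed.

(** At each t both bounds enclose the same busy transform, so the integrand of the gap is exp(-th t)
    times a nonnegative quantity. *)
Let gap_le dl th th' : 0 < dl -> 0 < th' -> th' <= th -> gap dl th <= gap dl th'.
Proof.
move=> dl0 th0' thth; have th0 := lt_le_trans th0' thth.
have ib s : 0 < s -> mu.-integrable D (EFin \o
    (fun t => expR (- s * t) * A 0 t - expR (- beta * dl) * (expR (- s * t) * A dl t))).
  move=> s0; have i1 := iA (lexx 0) s0; have i2 := iA (ltW dl0) s0.
  have i3 := @integrableZl _ _ _ mu D (measurable_itv _) (expR (- beta * dl)) _ i2.
  exact: (@integrableB _ _ _ mu D (measurable_itv _) _ _ i1 i3).
rewrite (gapE (ltW dl0) th0) (gapE (ltW dl0) th0').
apply: (@le_Rintegral _ _ _ mu D _ _ (measurable_itv _) (ib _ th0) (ib _ th0')) => t /inD t0.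
rewrite !(mulrCA (expR (- beta * dl))) -!mulrBr ler_wpM2r//.
  rewrite subr_ge0 -lee_fin; apply: le_trans (busy_transform_le t0).
  exact: busy_transform_ge.
by rewrite ler_expR !mulNr lerN2 ler_wpM2r.
Qed.

Let K dl phi := passage_limit beta Q (weight alpha dl) (fun x => x - dl) phi.

Let VK dl th : 0 <= dl -> 0 < th -> (th - psi beta) * V dl th = K dl (Phi th).
Proof.
move=> dl0 th0; have [p0 pE] := dual_inverseP levyX posX driftX th0.
apply: mean_survival_transform => //.
- exact: measurable_weight.
- by move=> x; exact: weight01.
- by move=> x; exact: weight_neq0.
Qed.

Let K_cvg phi : 0 < phi -> K n.+1%:R^-1 phi @[n --> \oo] --> K 0 phi.
Proof.
move=> p0; have n0 n : 0 <= n.+1%:R^-1 :> R by rewrite invr_ge0.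
apply: (@Rintegral_bct _ _ _ _ _ _ 1).
- by move=> n; apply: measurable_passage_integrand => //; exact: measurable_weight.
- by apply: measurable_passage_integrand => //; exact: measurable_weight.
- move=> x; have [x0|x0] := ltP 0 x; last first.
    have z dl : 0 <= dl -> weight alpha dl x = 0.
      move=> dl0; rewrite /weight indicE memNset ?mulr0//= in_itv/= andbT.
      by apply/negP; rewrite -leNgt (le_trans x0).
    rewrite z//; under eq_fun do rewrite z// mul0r.
    by rewrite mul0r; exact: cvg_cst.
  have ce b : expR (- b * (x - n.+1%:R^-1)) @[n --> \oo] --> expR (- b * (x - 0)).
    apply: (cvg_comp _ expR _ (@continuous_expR R _)); apply: cvgMr.
    by apply: cvgB; [exact: cvg_cst|exact: cvg_harmonic].
  apply: cvgM; last by apply: cvgB.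
  apply: cvg_near_cst.
  have hx : \forall n \near \oo, (@harmonic R n) < x by apply: (cvgr_lt _ (@cvg_harmonic R)).
  by apply: filterS hx => n nx; rewrite /weight !indicE !mem_set//= in_itv/= andbT.
- move=> n x.
  apply: (@passage_integrand_le1 _ _ beta_gt0 _ _ (weight alpha n.+1%:R^-1)
    (fun x => x - n.+1%:R^-1)) => // y; first exact: weight01.
  exact: weight_neq0.
Qed.

Let gap_cvg0 th : 0 < th -> th != psi beta -> gap n.+1%:R^-1 th @[n --> \oo] --> (0 : R).
Proof.
move=> th0 thn; have [p0 _] := dual_inverseP levyX posX driftX th0.
have nz : th - psi beta != 0 by rewrite subr_eq0.
have VE' dl : 0 <= dl -> V dl th = (th - psi beta)^-1 * K dl (Phi th).
  by move=> dl0; rewrite -VK// mulKf.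
have n0 n : 0 <= n.+1%:R^-1 :> R by rewrite invr_ge0.
rewrite -(subrr (V 0 th)) /gap; apply: cvgB; first exact: cvg_cst.
rewrite -[X in _ --> X]mul1r; apply: cvgM.
  rewrite -[X in _ --> X]expR0 -[X in _ --> expR X](mulr0 (- beta)).
  apply: (cvg_comp _ expR _ (@continuous_expR R _)); apply: cvgMr; exact: cvg_harmonic.
rewrite VE'//; under eq_fun do rewrite VE'//.
by apply: cvgMr; exact: K_cvg.
Qed.

Let lhsE th : 0 < th -> lhs th = (V 0 th)%:E.
Proof.
(* Of th / 2 and th / 3 at least one differs from psi beta, and there the gap is known to vanish. *)
move=> th0; have [th' [th0' thn thth]] : exists th', [/\ 0 < th', th' != psi beta & th' <= th].
  have [h|h] := eqVneq (th / 2) (psi beta); last first.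
    by exists (th / 2); split => //; lra.
  by exists (th / 3); split; [|rewrite -h; apply/eqP|]; lra.
have lb n : ((V 0 th - gap n.+1%:R^-1 th')%:E <= lhs th)%E.
  have dl0 : 0 < n.+1%:R^-1 :> R by rewrite invr_gt0.
  apply: le_trans (lhs_ge dl0 th0); rewrite lee_fin.
  by rewrite lerBlDr -lerBlDl; exact: gap_le.
have lfin : lhs th \is a fin_num.
  rewrite ge0_fin_numE; first exact: le_lt_trans (lhs_le th0) (ltry _).
  by apply: integral_ge0 => t _; rewrite mule_ge0// lee_fin expR_ge0.
apply/eqP; rewrite eq_le lhs_le//= -(fineK lfin) lee_fin.
have c : V 0 th - gap n.+1%:R^-1 th' @[n --> \oo] --> V 0 th - 0.
  by apply: cvgB; [exact: cvg_cst|exact: gap_cvg0].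
rewrite subr0 in c; apply: (ler_cvg_to c (@cvg_cst _ (fine (lhs th)) _ _ _)).
by apply: nearW => n; rewrite -lee_fin fineK.
Qed.

Let KE phi : 0 < phi -> K 0 phi = supF X (alpha + beta) - supF X (alpha + phi).
Proof.
move=> p0; have ab0 : 0 < alpha + beta by rewrite addr_gt0.
have ap0 : 0 < alpha + phi by rewrite addr_gt0.
rewrite !supF_start0//.
rewrite -RintegralB//; [|exact: integrable_sup_transform0|exact: integrable_sup_transform0].
pose h x := weight alpha 0 x * (expR (- beta * (x - 0)) - expR (- phi * (x - 0))).
have mh : measurable_fun setT h.
  by apply: measurable_passage_integrand => //; exact: measurable_weight.
have h1 x : `|h x| <= 1.
  apply: (@passage_integrand_le1 _ _ beta_gt0 _ _ (weight alpha 0) (fun x => x - 0)) => // y.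
    exact: weight01.
  exact: weight_neq0.
have mS := measurable_all_time_sup levyX.
have -> : K 0 phi = \int[P]_w h (all_time_sup X w).
  congr fine; rewrite integral_distribution//; first exact/measurable_EFinP.
  apply: (bounded_integrable P (measurableT_comp mh mS) (fun w => h1 _)).
apply: Rintegral_ae_eq.
- exact: measurableT_comp.
- apply: measurable_funB; exact: measurable_sup_transform0.
have [X00 _ _ _] := levyX.
have aeB : {ae P, forall w, bounded_path X w}.
  exists (~` bounded_path X); split => //.
    by apply: measurableC; exact: measurable_bounded_path.
  by rewrite probability_setC ?bounded_path1 ?subee//; exact: measurable_bounded_path.
move: X00 aeB; apply: filterS2 => w X0 Bw.
have S0 : 0 <= all_time_sup X w by rewrite -[leLHS]X0; exact: all_time_sup_ge.
rewrite /sup_transform !indicE !(mem_set Bw) (mem_set (X0 : [set w | X 0 w = 0] w)) !mulr1.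
rewrite /h /weight indicE subr0.
(* The stationary law may have an atom at 0, which the weight drops; nothing is lost, since the two
   exponentials coincide there. *)
move: S0; rewrite le_eqVlt => /orP[/eqP<-|S0].
  by rewrite !mulr0 subrr mulr0.
rewrite mem_set/= ?in_itv/= ?S0// mulr1 mulrBr -!expRD; congr (expR _ - expR _); ring.
Qed.

Let V_formula th : 0 < th -> th != psi beta -> V 0 th = busy_formula X alpha beta th.
Proof.
move=> th0 thn; have [p0 _] := dual_inverseP levyX posX driftX th0.
have nz : th - psi beta != 0 by rewrite subr_eq0.
apply: (mulfI nz); rewrite VK// KE// !(supFE_psi levyX posX driftX) ?addr_gt0//.
by rewrite /busy_formula -mulrBr mulrA mulrCA mulfV// mulr1.
Qed.

Let V_continuous (th : R) : 0 < th -> V 0 s @[s --> (th : R)] --> V 0 th.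
Proof.
move=> th0; have t2 : 0 < th / 2 by rewrite divr_gt0.
have t01 t : 0 <= t -> `|A 0 t| <= 1.
  by move=> t0; have /andP[h1 h2] := A01 (lexx 0) t0; rewrite ger0_norm.
have := @continuity_under_integral R _ _ mu (fun s t => expR (- s * t) * A 0 t) D
  (measurable_itv _) (th / 2) (th + 1) _ _ (fun t => expR (- (th / 2) * t)) (integrable_exp t2) _.
apply.
- move=> s /=; rewrite in_itv/= => /andP[s0 _]; apply: iA => //; exact: lt_trans s0.
- apply: aeW => t _ s _; apply: cvgMl.
  apply: (cvg_comp _ expR _ (@continuous_expR R _)); apply: cvgMl; apply: cvgN; exact: cvg_id.
- move=> s /=; rewrite in_itv/= => /andP[s0 _]; apply: aeW => t /inD t0.
  rewrite normrM ger0_norm ?expR_ge0// (le_trans (ler_piMr _ (t01 _ t0))) ?expR_ge0//.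
  by rewrite ler_expR !mulNr lerN2 ler_wpM2r// ltW.
- by rewrite inE/= in_itv/=; lra.
Qed.

Lemma busy_transform_formula th : 0 < th -> th != psi beta ->
  lhs th = (busy_formula X alpha beta th)%:E.
Proof. by move=> th0 thn; rewrite lhsE// V_formula. Qed.

(** The formula coincides with [V 0] on a punctured neighbourhood of th, and [V 0] is continuous at
    th. *)
Lemma busy_formula_cvg th : 0 < th -> th = psi beta ->
  (busy_formula X alpha beta s)%:E @[s --> th^'] --> lhs th.
Proof.
move=> th0 thE; rewrite lhsE//; apply: cvg_EFin; first by apply: nearW.
have c : V 0 s @[s --> th^'] --> V 0 th.
  by apply: cvg_within_filter; exact: V_continuous.
apply: cvg_trans c; apply: near_eq_cvg; near=> s => /=; apply: V_formula.
  by near: s; apply: cvg_within; exact: lt_nbhsr.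
by rewrite -thE; near: s; exact: nbhs_dnbhs_neq.
Unshelve. all: by end_near. Qed.

End transform.

Theorem proposition5 (R : realType) (d : measure_display)
    (Omega : measurableType d) (P : probability Omega R)
    (X : R -> {RV P >-> R})
    (levyX : levy_process X) (posX : spectrally_positive X)
    (driftX : ('E_P[X 1%R] < 0)%E)
    (alpha beta theta : R)
    (alpha_gt0 : 0 < alpha) (beta_gt0 : 0 < beta) (theta_gt0 : 0 < theta) :
  let lhs : \bar R :=
    (\int[lebesgue_measure]_(t in `[0%R, +oo[)
       ((expR (- theta * t))%:E * busy_transform X alpha beta t))%E in
  (theta <> dual_exponent X beta ->
     lhs = (busy_formula X alpha beta theta)%:E) /\
  (theta = dual_exponent X beta ->
     (busy_formula X alpha beta s)%:E @[s --> theta^'] --> lhs).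
Proof.
split => thE; last exact: busy_formula_cvg.
by apply: busy_transform_formula => //; exact/eqP.
Qed.
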